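(* Let $\alpha\in(0,2)$, $\alpha\ne 1$, let $W_j\sim\mathcal{N}(0,\sigma_W^2)$ with $\sigma_W>0$, and let $X$, $\hat X$, $a$, $K(a)$, $\bar g$, $\bar\gamma(a)$ and $\omega_{X_{(0,c)}}$ be as in the context. Let $N\ge1$ be an integer and let $0=:u_0<u_1<\cdots<u_N:=1$ be arbitrary points of $[0,1]$. Put $f_0:=0$, $f_i:=\log(\omega_{X_{(0,c)}}(u_i))$ for $i=1,\dots,N$, and for $i=0,\dots,N-1$, $$m_i:=\frac{f_{i+1}-f_i}{u_{i+1}-u_i},\qquad q_i:=-m_iu_i+f_i,\qquad \tilde m_i:=m_i+(c-1)\bar g.$$ Put also $$k_{(1,\infty)}:=-c\left((1-e^{-1})+\Gamma(1-a,1)\right),\quad \tilde k_{(1,\infty)}:=k_{(1,\infty)}-(c-1)(e^{-1}-1),\quad \tilde l_{(1,\infty)}:=(c-1)\bar\gamma(a).$$ Then, for any $c>1$, the Kolmogorov distance $\Delta(X,\hat X):=\sup_{x\in\mathbb{R}}|\mathbb{P}(X\le x)-\mathbb{P}(\hat X\le x)|$ is bounded above by $$B_5(c,\alpha,N):=cK(a)\left\{\sum_{i=0}^{N-1}\frac{e^{q_i}}{\tilde m_i}\left[e^{\tilde m_iu_{i+1}}\left(u_{i+1}-\frac1{\tilde m_i}\right)-e^{\tilde m_iu_i}\left(u_i-\frac1{\tilde m_i}\right)\right]+\frac{e^{\tilde k_{(1,\infty)}}}{a\,\big(\tilde l_{(1,\infty)}\big)^{2/a}}\,\Gamma\!\left(\frac2a,\tilde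 l_{(1,\infty)}\right)\right\}.$$
   Context: Lower and upper incomplete gamma functions: $\gamma(s,x)=\int_0^x t^{s-1}e^{-t}\,dt$ and $\Gamma(s,x)=\int_x^\infty t^{s-1}e^{-t}\,dt$. Set $a=\alpha/2$, $\eta=(1-a)/a$, $g(w):=1-e^{-w}-w^a\gamma(1-a,w)$ for $w\ge0$, $\bar\gamma(a):=\gamma(1-a,1)$, $\bar g:=g(1)$, $$K(a):=\frac1\pi\left[\frac{a}{2(2-a)}+\frac1{\eta^2}\right],$$ and, for $u>0$, $\omega_{X_{(0,c)}}(u):=\exp\left(-c\left(1-e^{-u}+u^a\Gamma(1-a,u)\right)\right)$. (This is the characteristic function of $X_{(0,c)}$ below at argument $s$, expressed in the variable $u=\sigma_W^2s^2c^{-2/\alpha}/2$.) Let $\{\Gamma_j\}_{j\ge1}$ be the successive arrival times of a unit rate Poisson process on $(0,\infty)$ and let $\{W_j\}_{j\ge1}$ be i.i.d. $\mathcal{N}(0,\sigma_W^2)$ independent of $\{\Gamma_j\}$. Let $X=\sum_{j=1}^\infty W_j\Gamma_j^{-1/\alpha}$ (a convergent series); $X$ has the symmetric $\alpha$-stable law with characteristic function $\exp(-\sigma^\alpha|s|^\alpha)$, where $\sigma^\alpha=\mathbb{E}[|W_1|^\alpha]/C_\alpha$ and $C_\alpha=\frac{1-\alpha}{\Gamma(2-\alpha)\cos(\pi\alpha/2)}$ (here $\Gamma(\cdot)$ is the gamma function). For $c>0$ let $X_{(0,c)}:=\sum_{j:\Gamma_j\in[0,c]}W_j\Gamma_j^{-1/\alpha}$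 (an empty sum is $0$) and $\hat X:=X_{(0,c)}+\hat R_{(c,\infty)}$, where $\hat R_{(c,\infty)}\sim\mathcal{N}(0,S^2_{(c,\infty)})$ is independent of $X_{(0,c)}$ and $S^2_{(c,\infty)}:=\sigma_W^2\frac{\alpha}{2-\alpha}c^{(\alpha-2)/\alpha}$. *)

(* Defs.v *)
From HB Require Import structures.
From mathcomp Require Import all_boot all_order all_algebra.
From mathcomp Require Import finmap.
From mathcomp Require Import all_classical all_reals all_analysis measurable_realfun.

Set Implicit Arguments.
Unset Strict Implicit.
Unset Printing Implicit Defensive.

Import Order.TTheory GRing.Theory Num.Theory.
Import numFieldNormedType.Exports.

Local Open Scope classical_set_scope.
Local Open Scope ring_scope.

Section independence.
Local Open Scope ereal_scope.
Context {d} {T : measurableType d} {R : realType} (P : probability T R).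
Context {d1 d2} {T1 : measurableType d1} {T2 : measurableType d2}.

Definition mutually_independent (I : choiceType) (Y : I -> T -> T1) : Prop :=
  forall (J : {fset I}) (B : I -> set T1), (forall i, measurable (B i)) ->
    P (\bigcap_(i in [set` J]) (Y i @^-1` B i)) =
    \prod_(i <- J) P (Y i @^-1` B i).

Definition independent2 (Y : T -> T1) (Z : T -> T2) : Prop :=
  forall (A : set T1) (B : set T2), measurable A -> measurable B ->
    P ((Y @^-1` A) `&` (Z @^-1` B)) = P (Y @^-1` A) * P (Z @^-1` B).

End independence.

Definition sigma_of_family {d1} {T : Type} {T1 : measurableType d1} {I : Type}
    (Y : I -> T -> T1) : set (set T) :=
  <<s \bigcup_i preimage_set_system setT (Y i) measurable >>.

Definition independent_families {d} {T : measurableType d} {R : realType}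
    (P : probability T R) {d1 d2} {T1 : measurableType d1}
    {T2 : measurableType d2} {I J : Type} (Y : I -> T -> T1)
    (Z : J -> T -> T2) : Prop :=
  forall A B, sigma_of_family Y A -> sigma_of_family Z B ->
    P (A `&` B) = (P A * P B)%E.

Section model.
Context {d} {T : measurableType d} {R : realType} (P : probability T R).

(* Number of points of the process in ]s, t], possibly +oo. *)
Definition arrival_count (G : nat -> T -> R) (s t : R) (w : T) : \bar R :=
  counting [set j | s < G j w <= t].

(* Indices are shifted by one: G j is the (j+1)-st arrival time. The counting
   process of the arrivals has independent increments, the one over ]s, t]
   being Poisson of mean t - s (so a.s. finite). *)
Definition unit_poisson_arrivals (G : nat -> T -> R) : Prop :=
  [/\ {ae P, forall w, 0 < G 0%N w /\ forall j, G j w < G j.+1 w},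
      (forall s t : R, 0 <= s -> s < t -> forall n : nat,
         P [set w | arrival_count G s t w = n%:R%:E]
         = (poisson_pmf (t - s) n)%:E) &
      (forall t : nat -> R, 0 <= t 0%N -> (forall k, t k <= t k.+1) ->
         mutually_independent P
           (fun k : nat => arrival_count G (t k) (t k.+1)))].

Definition lepage_term (alpha : R) (W G : nat -> T -> R) (w : T) (j : nat) : R :=
  W j w * (G j w) `^ (- alpha^-1).

(* Almost surely the index set is finite; on the null event where infinitely
   many terms are nonzero, the sum is 0 by convention. *)
Definition lepage_head (alpha c : R) (W G : nat -> T -> R) (w : T) : R :=
  \sum_(j \in [set j | 0 <= G j w <= c]) lepage_term alpha W G w j.

Definition kolmogorov_distance (X Y : T -> R) : \bar R :=
  ereal_sup (range (fun x : R =>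
    `| P [set w | (X w <= x)%R] - P [set w | (Y w <= x)%R] |%E)).

End model.

Section bound.
Context {R : realType}.
Implicit Types (a c s w x alpha sigmaW : R) (u : nat -> R) (i N : nat).

Definition lower_gamma s x : R :=
  \int[lebesgue_measure]_(t in `[0, x]) (t `^ (s - 1) * expR (- t)).

Definition upper_gamma s x : R :=
  \int[lebesgue_measure]_(t in `[x, +oo[) (t `^ (s - 1) * expR (- t)).

(* Variance of the Gaussian replacing the tail of the series. *)
Definition tail_variance sigmaW alpha c : R :=
  sigmaW ^+ 2 * (alpha / (2 - alpha)) * c `^ ((alpha - 2) / alpha).

Definition gfun a w : R := 1 - expR (- w) - w `^ a * lower_gamma (1 - a) w.

Definition gbar a : R := gfun a 1.

Definition gammabar a : R := lower_gamma (1 - a) 1.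

Definition eta a : R := (1 - a) / a.

Definition Kconst a : R := pi^-1 * (a / (2 * (2 - a)) + (eta a ^+ 2)^-1).

Definition omega_head c a (v : R) : R :=
  expR (- (c * (1 - expR (- v) + v `^ a * upper_gamma (1 - a) v))).

Definition fpt c a u i : R := if i == 0%N then 0 else ln (omega_head c a (u i)).

Definition mpt c a u i : R :=
  (fpt c a u i.+1 - fpt c a u i) / (u i.+1 - u i).

Definition qpt c a u i : R := - mpt c a u i * u i + fpt c a u i.

Definition mtpt c a u i : R := mpt c a u i + (c - 1) * gbar a.

Definition ktail c a : R := - (c * ((1 - expR (-1)) + upper_gamma (1 - a) 1)).

Definition kttail c a : R := ktail c a - (c - 1) * (expR (-1) - 1).

Definition lttail c a : R := (c - 1) * gammabar a.

Definition B5 c alpha N u : R :=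
  let a := alpha / 2 in
  let mt := mtpt c a u in
  let lt := lttail c a in
  c * Kconst a *
  (\sum_(i < N) (expR (qpt c a u i) / mt i *
      (expR (mt i * u i.+1) * (u i.+1 - (mt i)^-1)
       - expR (mt i * u i) * (u i - (mt i)^-1)))
   + expR (kttail c a) / (a * lt `^ (2 / a)) * upper_gamma (2 / a) lt).

End bound.

(* Main.v *)
(* Conditionally on the arrival times both variables are Gaussian mixtures, so with
   u = sigmaW^2 s^2 c^(-2/alpha) / 2 the Laplace functional of the Poisson process
   yields the characteristic functions omega(u) e^(c g(u)) of X and
   omega(u) e^(-c u / eta) of the approximation.  As
   -u/eta <= g(u) <= -u/eta + a u^2 / (2 (2 - a)), they differ by at most
   c a / (2 (2 - a)) u^2 omega(u) e^((c - 1) g(u)), and a smoothing inequality bounds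
   the Kolmogorov distance by 2/pi times the integral of this difference against ds/s
   over (0, +oo), where ds/s = du/(2u).  Finally ln omega and g are convex, hence below
   their chords on each [u_i, u_(i+1)] and on [0, 1] respectively, while for u >= 1 the
   exponent is at most kt - lt u^a; integrating these majorants gives the bracket of
   B5.  Only the first summand of Kconst is consumed. *)

Require Import Defs.
From HB Require Import structures.
From mathcomp Require Import all_boot all_order all_algebra.
From mathcomp Require Import finmap.
From mathcomp Require Import all_classical all_reals all_analysis measurable_realfun.
From mathcomp Require Import ring lra.

Set Implicit Arguments.
Unset Strict Implicit.
Unset Printing Implicit Defensive.

Import Order.TTheory GRing.Theory Num.Theory.
Import numFieldNormedType.Exports.

Local Open Scope classical_set_scope.
Local Open Scope ring_scope.

(** * Bounded measurable functions *)

(** Only real integrals occur: a symmetric law is encoded by E cos (s X + th) = phi s * cos th for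
    every phase th, so that Gaussian averaging acts directly on cosines. The smoothing step has no
    truncation error: the indicator of ]-oo, x] is approximated by the mass that a normal law
    centred at the random point gives to a long interval, the difference of expectations is bounded
    uniformly in the deviation and in the interval, and only then does the deviation tend to 0. The
    two endpoints of the interval cost |sin - sin| <= 2, hence 2/pi; since ds/s = du/(2u), the
    integral over u carries exactly the 1/pi of [Kconst]. The series need not converge absolutely,
    so its characteristic function is computed on partial sums, integrating out one mark at a time,
    and passed to the limit by bounded convergence. In the Laplace functional the limits in the
    number of arrivals, the mesh and the horizon are never exchanged: monotonicity encloses the
    wanted quantity between bounds with known limits. *)

Section bounded_measurable.
Context {d} {T : measurableType d} {R : realType}.
Implicit Types f g : T -> R.

(** Stable under sums and products and integrable for every probability measure, so the expectations
    below need no separate integrability argument. *)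
Definition bounded_mfun f := measurable_fun setT f /\ exists M, forall x, `|f x| <= M.

Lemma bounded_mfunM f g : bounded_mfun f -> bounded_mfun g -> bounded_mfun (f \* g).
Proof.
move=> [mf [M fM]] [mg [N gN]]; split; first exact: measurable_funM.
by exists (M * N) => x; rewrite normrM ler_pM.
Qed.

Lemma bounded_mfunD f g : bounded_mfun f -> bounded_mfun g -> bounded_mfun (f \+ g).
Proof.
move=> [mf [M fM]] [mg [N gN]]; split; first exact: measurable_funD.
by exists (M + N) => x; rewrite (le_trans (ler_normD _ _))// lerD.
Qed.

Lemma bounded_mfunB f g : bounded_mfun f -> bounded_mfun g -> bounded_mfun (f \- g).
Proof.
move=> [mf [M fM]] [mg [N gN]]; split; first exact: measurable_funB.
by exists (M + N) => x; rewrite (le_trans (ler_normB _ _))// lerD.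
Qed.

Lemma bounded_mfun_cst (k : R) : bounded_mfun (cst k).
Proof. by split; [exact: measurable_cst|exists `|k|]. Qed.

Lemma measurable_cos_comp f : measurable_fun setT f -> measurable_fun setT (fun x => cos (f x)).
Proof.
apply: measurableT_comp; apply: continuous_measurable_fun; exact: continuous_cos.
Qed.

Lemma measurable_sin_comp f : measurable_fun setT f -> measurable_fun setT (fun x => sin (f x)).
Proof.
apply: measurableT_comp; apply: continuous_measurable_fun; exact: continuous_sin.
Qed.

Lemma norm_cos_le1 (x : R) : `|cos x| <= 1.
Proof. by rewrite ler_norml cos_geN1 cos_le1. Qed.

Lemma norm_sin_le1 (x : R) : `|sin x| <= 1.
Proof. by rewrite ler_norml sin_geN1 sin_le1. Qed.

Lemma bounded_mfun_cos f : measurable_fun setT f -> bounded_mfun (fun x => cos (f x)).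
Proof.
by move=> mf; split; [exact: measurable_cos_comp|exists 1 => x; exact: norm_cos_le1].
Qed.

Lemma bounded_mfun_expR f : measurable_fun setT f -> (forall x, f x <= 0) ->
  bounded_mfun (fun x => expR (f x)).
Proof.
move=> mf f0; split; first exact: measurableT_comp.
by exists 1 => x; rewrite ger0_norm ?expR_ge0// -expR0 ler_expR.
Qed.

End bounded_measurable.

Lemma bounded_mfun_comp {d d'} {T : measurableType d} {T' : measurableType d'}
    {R : realType} (f : T' -> R) (h : T -> T') :
  bounded_mfun f -> measurable_fun setT h -> bounded_mfun (f \o h).
Proof.
move=> [mf [M fM]] mh; split; first exact: measurableT_comp.
by exists M => x; exact: fM.
Qed.

Section bounded_integral.
Context {d} {T : measurableType d} {R : realType} (P : probability T R).
Implicit Types f g : T -> R.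

Lemma bounded_mfun_integrable f : bounded_mfun f -> P.-integrable setT (EFin \o f).
Proof.
move=> [mf [M fM]]; apply: measurable_bounded_integrable => //.
  by rewrite (le_lt_trans (probability_le1 P measurableT))// ltry.
exists M; split; first exact: num_real.
by move=> x Mx y _; rewrite /= (le_trans (fM y))// ltW.
Qed.

Lemma bounded_RintegralD f g : bounded_mfun f -> bounded_mfun g ->
  \int[P]_x (f x + g x) = \int[P]_x f x + \int[P]_x g x.
Proof. by move=> bf bg; rewrite RintegralD//; exact: bounded_mfun_integrable. Qed.

Lemma bounded_RintegralB f g : bounded_mfun f -> bounded_mfun g ->
  \int[P]_x (f x - g x) = \int[P]_x f x - \int[P]_x g x.
Proof. by move=> bf bg; rewrite RintegralB//; exact: bounded_mfun_integrable. Qed.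

Lemma bounded_RintegralZl (k : R) f : bounded_mfun f ->
  \int[P]_x (k * f x) = k * \int[P]_x f x.
Proof. by move=> bf; rewrite RintegralZl//; exact: bounded_mfun_integrable. Qed.

Lemma bounded_Rintegral_le f g : bounded_mfun f -> bounded_mfun g ->
  (forall x, f x <= g x) -> \int[P]_x f x <= \int[P]_x g x.
Proof.
by move=> bf bg fg; apply: le_Rintegral => //; exact: bounded_mfun_integrable.
Qed.

Lemma Rintegral_prob_cst (k : R) : \int[P]_x k = k.
Proof.
have /= -> := Rintegral_cst P measurableT k.
by rewrite [P _]probability_setT/= mulr1.
Qed.

Lemma norm_Rintegral_le f (M : R) : measurable_fun setT f -> (forall x, `|f x| <= M) ->
  `|\int[P]_x f x| <= M.
Proof.
move=> mf fM; have bf : bounded_mfun f by split => //; exists M.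
rewrite (le_trans (le_normr_Rintegral _ _))//; first exact: bounded_mfun_integrable.
rewrite -[leRHS]Rintegral_prob_cst; apply: bounded_Rintegral_le => //.
  by split; [exact: measurableT_comp|exists M => x; rewrite normr_id].
exact: bounded_mfun_cst.
Qed.

Lemma bounded_cvg_Rintegral (f_ : nat -> T -> R) f (M : R) :
  (forall n, measurable_fun setT (f_ n)) -> measurable_fun setT f ->
  (forall n x, `|f_ n x| <= M) ->
  {ae P, forall x, f_ n x @[n --> \oo] --> f x} ->
  \int[P]_x f_ n x @[n --> \oo] --> \int[P]_x f x.
Proof.
move=> mf_ mf fM fcvg.
have m1 n : measurable_fun setT (EFin \o f_ n) by exact/measurable_EFinP.
have m2 : measurable_fun setT (EFin \o f) by exact/measurable_EFinP.
have aef : {ae P, forall x, setT x -> (EFin \o f_ n) x @[n --> \oo] --> (EFin \o f) x}.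
  by apply: filterS fcvg => x fx _; exact: cvg_EFin (nearW _ _) fx.
have iM : P.-integrable setT (EFin \o cst M).
  by apply: bounded_mfun_integrable; exact: bounded_mfun_cst.
have aeM : {ae P, forall x n, setT x -> (`|(EFin \o f_ n) x| <= (EFin \o cst M) x)%E}.
  by apply: aeW => x n _; rewrite /= lee_fin.
have [intf _ cvgi] := dominated_convergence measurableT m1 m2 aef iM aeM.
apply: fine_cvg; rewrite fineK//.
exact: integrable_fin_num.
Qed.

Lemma Rintegral_indic (A : set T) : measurable A -> \int[P]_x \1_A x = fine (P A).
Proof. by move=> mA; rewrite /Rintegral integral_indic// setIT. Qed.

End bounded_integral.

Section bounded_Fubini.
Context {d1 d2} {T1 : measurableType d1} {T2 : measurableType d2} {R : realType}.
Variables (P1 : probability T1 R) (P2 : probability T2 R).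
Variable f : T1 * T2 -> R.
Hypothesis bf : bounded_mfun f.

Let intf : (P1 \x P2)%E.-integrable setT (EFin \o f).
Proof.
have [mf [M fM]] := bf.
apply: measurable_bounded_integrable => //.
  have := @product_measure1E _ _ _ _ _ P1 P2 setT setT measurableT measurableT.
  by rewrite setXTT => /= ->; rewrite !probability_setT mule1 ltry.
exists M; split; first exact: num_real.
by move=> x Mx y _; rewrite /= (le_trans (fM y))// ltW.
Qed.

Let msec1 x : measurable_fun setT (fun y => f (x, y)).
Proof. by have [mf _] := bf; apply: measurableT_comp => //; exact: measurable_pair1. Qed.

Let msec2 y : measurable_fun setT (fun x => f (x, y)).
Proof. by have [mf _] := bf; apply: measurableT_comp => //; exact: measurable_pair2. Qed.

Let E1 x : (\int[P2]_y (f (x, y))%:E)%E = (\int[P2]_y f (x, y))%:E.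
Proof.
rewrite /Rintegral fineK//; apply: integrable_fin_num => //.
by apply: bounded_mfun_integrable; split => //; have [_ [M fM]] := bf; exists M.
Qed.

Let E2 y : (\int[P1]_x (f (x, y))%:E)%E = (\int[P1]_x f (x, y))%:E.
Proof.
rewrite /Rintegral fineK//; apply: integrable_fin_num => //.
by apply: bounded_mfun_integrable; split => //; have [_ [M fM]] := bf; exists M.
Qed.

Lemma bounded_mfun_fubini1 : bounded_mfun (fun x => \int[P2]_y f (x, y)).
Proof.
split; last first.
  by have [mf [M fM]] := bf; exists M => x; apply: norm_Rintegral_le.
apply/measurable_EFinP; have := measurable_fubini_F intf.
by apply: eq_measurable_fun => x _; rewrite /fubini_F/= E1.
Qed.

Lemma bounded_Fubini1 : \int[P1]_x \int[P2]_y f (x, y) = \int[(P1 \x P2)%E]_z f z.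
Proof.
congr fine; rewrite -(integral12_prod_meas1 intf); apply: eq_integral => x _.
by rewrite /fubini_F/= E1.
Qed.

Lemma bounded_Fubini :
  \int[P1]_x \int[P2]_y f (x, y) = \int[P2]_y \int[P1]_x f (x, y).
Proof.
congr fine; have := Fubini intf.
rewrite /=; under eq_integral do rewrite E1.
by move=> ->; apply: eq_integral => y _; rewrite /= E2.
Qed.

End bounded_Fubini.

(** * Gaussian integrals of cosines *)

Section normal_characteristic.
Context {R : realType}.
Notation mu := (@lebesgue_measure R).
Implicit Types s t x : R.

(** The change of variables goes through the Radon-Nikodym derivative, which agrees almost
    everywhere with [normal_pdf] because both have the same integral over every measurable set. *)
Lemma Rintegral_normal_prob (m s : R) (f : R -> R) : bounded_mfun f ->
  \int[normal_prob m s]_x f x = \int[mu]_x (f x * normal_pdf m s x).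
Proof.
move=> bf; have [mf [M fM]] := bf; congr fine.
have dom := @normal_prob_dominates R m s.
have intf : (normal_prob m s).-integrable setT (EFin \o f).
  exact: bounded_mfun_integrable.
rewrite -(Radon_Nikodym_change_of_variables dom)//=.
apply: ae_eq_integral => //.
- apply: emeasurable_funM; first exact/measurable_EFinP.
  by apply: (measurable_int mu); exact: Radon_Nikodym_integrable.
- apply/measurable_EFinP/measurable_funM => //; exact: measurable_normal_pdf.
- under [X in ae_eq _ _ _ X]eq_fun do rewrite EFinM.
  apply: ae_eqe_mul2l => /=.
  rewrite Radon_NikodymE//=.
  case: cid => /= h [h1 h2 h3].
  apply: integral_ae_eq => //=.
  + by apply/measurable_EFinP; exact: measurable_normal_pdf.
  + by move=> E _ mE; rewrite -h3.
Qed.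

Lemma normal_pdf0E s x : s != 0 ->
  normal_pdf 0 s x = normal_peak s * expR (- x ^+ 2 / (s ^+ 2 *+ 2)).
Proof. by move=> s0; rewrite normal_pdfE// /normal_fun subr0. Qed.

Lemma is_derive_normal_pdf0 s x : s != 0 ->
  is_derive x 1 (normal_pdf 0 s) (- (x / s ^+ 2) * normal_pdf 0 s x).
Proof.
move=> s0.
have -> : normal_pdf 0 s = (fun y => normal_peak s * expR (- y ^+ 2 / (s ^+ 2 *+ 2))).
  by apply/funext => y; exact: normal_pdf0E.
have s20 : s ^+ 2 *+ 2 != 0 by rewrite mulrn_eq0/= expf_neq0.
apply: is_derive_eq.
rewrite /GRing.scale/=.
by rewrite -[s ^+ 2 *+ 2]mulr_natr; field.
Qed.

(** The factor |x| is traded for a wider Gaussian: with y = |x|/s, y <= 1 + y^2/4 <= e^(y^2/4),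
    which uses up half of the exponent x^2/(2 s^2) and leaves that of deviation sqrt 2 * s. It
    serves both for first moments and for tail bounds. *)
Lemma normal_pdf_moment_le s x : 0 < s ->
  `|x| * normal_pdf 0 s x <=
  s * normal_peak s / normal_peak (Num.sqrt 2 * s) * normal_pdf 0 (Num.sqrt 2 * s) x.
Proof.
move=> s0; have s0' : s != 0 by rewrite gt_eqF.
have q0 : Num.sqrt 2 * s != 0 by rewrite mulf_neq0// gt_eqF// sqrtr_gt0.
rewrite !normal_pdf0E//.
have pk := normal_peak_gt0 q0; have pk1 := normal_peak_gt0 s0'.
rewrite mulrCA.
set e2 := expR (- x ^+ 2 / ((Num.sqrt 2 * s) ^+ 2 *+ 2)).
have -> : s * normal_peak s / normal_peak (Num.sqrt 2 * s) *
    (normal_peak (Num.sqrt 2 * s) * e2) = normal_peak s * (s * e2).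
  by field; rewrite gt_eqF.
rewrite /e2.
rewrite ler_pM2l//.
have -> : - x ^+ 2 / (s ^+ 2 *+ 2) =
    - (x ^+ 2 / (s ^+ 2 *+ 4)) + - x ^+ 2 / ((Num.sqrt 2 * s) ^+ 2 *+ 2).
  rewrite exprMn sqr_sqrtr// -[s ^+ 2 *+ 2]mulr_natr -[_ *+ 4]mulr_natr -[_ *+ 2]mulr_natr.
  by field.
rewrite expRD mulrA ler_wpM2r ?expR_ge0//.
rewrite expRN ler_pdivrMr ?expR_gt0//.
have := expR_ge1Dx (x ^+ 2 / (s ^+ 2 *+ 4)); set e := expR _ => h.
rewrite -ler_pdivrMl//; apply: le_trans h.
have -> : x ^+ 2 / (s ^+ 2 *+ 4) = (s^-1 * `|x|) ^+ 2 / 4.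
  by rewrite exprMn real_normK ?num_real// -[_ *+ 4]mulr_natr; field.
rewrite -subr_ge0.
have -> : 1 + (s^-1 * `|x|) ^+ 2 / 4 - s^-1 * `|x| = (1 - (s^-1 * `|x|) / 2) ^+ 2 by field.
exact: sqr_ge0.
Qed.

Lemma integrable_normal_moment s : 0 < s ->
  mu.-integrable setT (fun x => (`|x| * normal_pdf 0 s x)%:E).
Proof.
move=> s0.
set k := s * normal_peak s / normal_peak (Num.sqrt 2 * s).
have int2 : mu.-integrable setT (fun x => (k * normal_pdf 0 (Num.sqrt 2 * s) x)%:E).
  under eq_fun do rewrite EFinM.
  by apply: integrableZl => //; exact: integrable_normal_pdf.
apply: le_integrable int2 => //.
  apply/measurable_EFinP/measurable_funM; last exact: measurable_normal_pdf.
  exact: (@normr_measurable R setT).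
move=> x _; rewrite !lee_fin ger0_norm ?mulr_ge0 ?normal_pdf_ge0//.
by rewrite (le_trans (normal_pdf_moment_le x s0))// ler_norm.
Qed.

Lemma integrable_bounded_normal_pdf s (f : R -> R) : bounded_mfun f ->
  mu.-integrable setT (fun x => (f x * normal_pdf 0 s x)%:E).
Proof.
move=> [mf [M fM]].
have int2 : mu.-integrable setT (fun x => (M * normal_pdf 0 s x)%:E).
  under eq_fun do rewrite EFinM.
  by apply: integrableZl => //; exact: integrable_normal_pdf.
apply: le_integrable int2 => //.
  by apply/measurable_EFinP/measurable_funM; last exact: measurable_normal_pdf.
move=> x _; rewrite !lee_fin !normrM ler_wpM2r//.
by rewrite (le_trans (fM x))// ler_norm.
Qed.

Lemma normal_pdf_cvg0 s (f : nat -> R) : 0 < s -> (forall n, n%:R <= `|f n|) ->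
  normal_pdf 0 s (f n) @[n --> \oo] --> 0.
Proof.
move=> s0 fn.
set k := s * normal_peak s / normal_peak (Num.sqrt 2 * s) * normal_peak (Num.sqrt 2 * s).
have q0 : Num.sqrt 2 * s != 0 by rewrite mulf_neq0 ?gt_eqF// sqrtr_gt0.
have kle n : normal_pdf 0 s (f n.+1) <= k * n.+1%:R^-1.
  rewrite ler_pdivlMr// mulrC.
  apply: (@le_trans _ _ (`|f n.+1| * normal_pdf 0 s (f n.+1))).
    by rewrite ler_wpM2r ?normal_pdf_ge0.
  rewrite (le_trans (normal_pdf_moment_le _ s0))// /k ler_wpM2l ?normal_pdf_ub//.
  by rewrite divr_ge0 ?mulr_ge0 ?normal_peak_ge0// ltW.
rewrite -(cvg_shiftS (fun n => normal_pdf 0 s (f n))).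
apply: (@squeeze_cvgr _ _ _ _ (cst 0) (fun n => k * n.+1%:R^-1)).
- by near=> n; rewrite normal_pdf_ge0/= kle.
- exact: cvg_cst.
- rewrite -[X in _ --> X](mulr0 k); apply: cvgMr.
  exact: cvg_harmonic.
Unshelve. all: by end_near. Qed.

(* Stein's identity for the test function [cos (t x + th)]. *)
Lemma normal_pdf_by_parts s t th : 0 < s ->
  \int[mu]_x (s ^+ 2 * t * cos (t * x + th) * normal_pdf 0 s x
              - x * sin (t * x + th) * normal_pdf 0 s x) = 0.
Proof.
move=> s0; have s0' : s != 0 by rewrite gt_eqF.
pose h x := s ^+ 2 * t * cos (t * x + th) * normal_pdf 0 s x
              - x * sin (t * x + th) * normal_pdf 0 s x.
pose H x := s ^+ 2 * sin (t * x + th) * normal_pdf 0 s x.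
have dH x : is_derive x 1 H (h x).
  have ? := is_derive_normal_pdf0 x s0'.
  apply: is_derive_eq; rewrite /h /GRing.scale/=; field.
  by rewrite s0'.
have mlin : measurable_fun setT (fun x : R => t * x + th).
  by apply: measurable_funD => //; exact: measurable_funM.
have inth : mu.-integrable setT (EFin \o h).
  rewrite /comp /h; under eq_fun do rewrite EFinB.
  apply: integrableB => //.
    apply: integrable_bounded_normal_pdf; apply: bounded_mfunM.
      exact: bounded_mfun_cst.
    exact: bounded_mfun_cos.
  apply: le_integrable (integrable_normal_moment s0) => //.
    apply/measurable_EFinP/measurable_funM; last exact: measurable_normal_pdf.
    by apply: measurable_funM => //; exact: measurable_sin_comp.
  move=> x _; rewrite !lee_fin !normrM normr_id ler_wpM2r// ler_piMr//.
  exact: norm_sin_le1.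
have ch : continuous h.
  move=> x; apply: differentiable_continuous; apply/derivable1_diffP.
  have ? := is_derive_normal_pdf0 x s0'.
  by rewrite /h.
have ftc n : \int[mu]_(x in `[- n.+1%:R, n.+1%:R]) h x = H n.+1%:R - H (- n.+1%:R).
  rewrite /Rintegral (@continuous_FTC2 _ h H) -?EFinB//.
  - by rewrite gtrN.
  - by apply: continuous_subspaceT.
  - split => //.
    + by apply: cvg_at_right_filter; apply: differentiable_continuous; apply/derivable1_diffP.
    + by apply: cvg_at_left_filter; apply: differentiable_continuous; apply/derivable1_diffP.
  - by move=> x _; rewrite derive1E; exact: derive_val.
(* [H] is at most s^2 times the density in absolute value, so the boundary terms vanish. *)
have lim0 : H n.+1%:R - H (- n.+1%:R) @[n --> \oo] --> 0.
  have H0 (f : nat -> R) : (forall n, n%:R <= `|f n|) -> H (f n) @[n --> \oo] --> 0.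
    move=> fn; apply: norm_cvg0.
    apply: (@squeeze_cvgr _ _ _ _ (cst 0) (fun n => s ^+ 2 * normal_pdf 0 s (f n))).
    - near=> n; rewrite normr_ge0/= /H 2!normrM [ `|s ^+ 2|]ger0_norm ?sqr_ge0//.
      rewrite [ `|normal_pdf _ _ _|]ger0_norm ?normal_pdf_ge0// ler_wpM2r ?normal_pdf_ge0//.
      by rewrite ler_piMr ?sqr_ge0// norm_sin_le1.
    - exact: cvg_cst.
    - rewrite -[X in _ --> X](mulr0 (s ^+ 2)); apply: cvgMr.
      exact: normal_pdf_cvg0.
  rewrite -[X in _ --> X](subr0 0); apply: cvgB.
    by apply: H0 => n; rewrite ger0_norm// ler_nat.
  by apply: H0 => n; rewrite normrN ger0_norm// ler_nat.
have limI : \int[mu]_(x in `[- n.+1%:R, n.+1%:R]) h x @[n --> \oo] --> \int[mu]_x h x.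
  under eq_cvg do rewrite Rintegral_mkcond.
  pose hn (n : nat) : R -> R := h \_ `[- n.+1%:R, n.+1%:R].
  have m1 n : measurable_fun setT (EFin \o hn n).
    apply/measurable_EFinP; apply/measurable_restrict => //.
    apply: measurable_funS (continuous_measurable_fun ch) => //.
  have aef : {ae mu, forall x, setT x ->
      (EFin \o hn n) x @[n --> \oo] --> (EFin \o h) x}.
    apply: aeW => x _; apply: cvg_near_cst; near=> n => /=.
    rewrite /hn patchE mem_set//= in_itv/= -ler_norml.
    near: n; exists (Num.truncn `|x|) => // n /= xn.
    by rewrite (le_trans (ltW (truncnS_gt _)))// ler_nat.
  have aeM : {ae mu, forall x n, setT x ->
      (`|(EFin \o hn n) x| <= (abse \o (EFin \o h)) x)%E}.
    apply: aeW => x n _ /=; rewrite lee_fin /hn patchE; case: ifP => //.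
    by rewrite normr0.
  have [_ _ cvgi] := @dominated_convergence _ _ _ mu setT measurableT
    (fun n => EFin \o hn n) (EFin \o h) (abse \o (EFin \o h))
    m1 (measurable_int _ inth) aef (integrable_abse inth) aeM.
  apply: fine_cvg; rewrite fineK//.
  exact: integrable_fin_num.
rewrite -(cvg_lim (@Rhausdorff R) limI); apply: (cvg_lim (@Rhausdorff R)).
by under eq_cvg do rewrite ftc.
Unshelve. all: by end_near. Qed.

(** Differentiating under the integral and applying [normal_pdf_by_parts] gives I'(t) = - s^2 t
    I(t). Hence I(t) e^((s t)^2/2) is constant, and its value at 0 is cos th. *)
Lemma Rintegral_cos_normal s t th : 0 < s ->
  \int[normal_prob 0 s]_x cos (t * x + th) = expR (- (s * t) ^+ 2 / 2) * cos th.
Proof.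
move=> s0; have s0' : s != 0 by rewrite gt_eqF.
pose I (t : R) := \int[mu]_x (cos (t * x + th) * normal_pdf 0 s x).
have mlin (a : R) : measurable_fun setT (fun x : R => a * x + th).
  by apply: measurable_funD => //; exact: measurable_funM.
have dI (a : R) : is_derive a 1 I (- (s ^+ 2 * a) * I a).
  have intf (y : R) : (`]a - 1, a + 1[%classic : set R) y ->
      mu.-integrable setT (EFin \o (fun x => cos (y * x + th) * normal_pdf 0 s x)).
    by move=> _; apply: integrable_bounded_normal_pdf; exact: (bounded_mfun_cos (mlin y)).
  have der (y x : R) : is_derive y 1 (fun t => cos (t * x + th) * normal_pdf 0 s x)
      (- x * sin (y * x + th) * normal_pdf 0 s x).
    apply: is_derive_eq; rewrite /GRing.scale/=; ring.
  have Ia : (`]a - 1, a + 1[%classic : set R) a by rewrite /= in_itv/=; lra.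
  have der1 (y x : R) : (`]a - 1, a + 1[%classic : set R) y -> [set: R] x ->
      derivable (fun t => cos (t * x + th) * normal_pdf 0 s x) y 1 by [].
  have Gub (y x : R) : (`]a - 1, a + 1[%classic : set R) y -> [set: R] x ->
      `|partial1of2 (fun t x => cos (t * x + th) * normal_pdf 0 s x) y x|
      <= `|x| * normal_pdf 0 s x.
    move=> _ _; rewrite partial1of2E derive_val !normrM normrN.
    rewrite [ `|normal_pdf _ _ _|]ger0_norm ?normal_pdf_ge0//.
    by rewrite ler_wpM2r ?normal_pdf_ge0// ler_piMr// norm_sin_le1.
  have G0 (x : R) : 0 <= `|x| * normal_pdf 0 s x by rewrite mulr_ge0 ?normal_pdf_ge0.
  have h1 := @derivable_under_integral _ _ _ mu _ _ measurableT a _ _ Ia intf der1 _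
    G0 (integrable_normal_moment s0) Gub.
  have h2 := @differentiation_under_integral _ _ _ mu _ _ measurableT a _ _ Ia intf der1 _
    G0 (integrable_normal_moment s0) Gub.
  apply: DeriveDef; first exact: h1.
  rewrite -derive1E h2.
  transitivity (\int[mu]_x (- x * sin (a * x + th) * normal_pdf 0 s x)).
    by apply: eq_Rintegral => x _; rewrite partial1of2E derive_val.
  have := normal_pdf_by_parts a th s0.
  have i1 : mu.-integrable setT
      (EFin \o (fun x => s ^+ 2 * a * (cos (a * x + th) * normal_pdf 0 s x))).
    rewrite /comp; under eq_fun do rewrite EFinM.
    by apply: integrableZl => //; exact: (intf a).
  have i2 : mu.-integrable setT
      (EFin \o (fun x => x * sin (a * x + th) * normal_pdf 0 s x)).
    apply: le_integrable (integrable_normal_moment s0) => //.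
      apply/measurable_EFinP/measurable_funM; last exact: measurable_normal_pdf.
      by apply: measurable_funM => //; exact: (measurable_sin_comp (mlin a)).
    move=> x _; rewrite !lee_fin !normrM normr_id ler_wpM2r// ler_piMr//.
    exact: norm_sin_le1.
  under eq_Rintegral do rewrite -[_ * cos _ * _]mulrA.
  rewrite RintegralB// RintegralZl//; last exact: (intf a).
  move/eqP; rewrite subr_eq0 => /eqP hh.
  rewrite mulNr /I hh.
  transitivity (\int[mu]_x (-1 * (x * sin (a * x + th) * normal_pdf 0 s x))).
    by apply: eq_Rintegral => x _; ring.
  by rewrite RintegralZl// mulN1r.
pose E (t : R) := I t * expR ((s * t) ^+ 2 / 2).
have dE (a : R) : is_derive a 1 E 0.
  have ? := dI a.
  by apply: is_derive_eq; rewrite /GRing.scale/=; field.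
have := @is_derive_0_is_cst R E 0 t dE.
rewrite /E mulr0 expr0n/= mul0r expR0 mulr1 => E0.
rewrite Rintegral_normal_prob; last exact: (bounded_mfun_cos (mlin t)).
rewrite -/(I t).
have -> : I t = I 0 * expR (- (s * t) ^+ 2 / 2).
  by rewrite E0 -mulrA -expRD mulNr addrC addNr expR0 mulr1.
rewrite mulrC; congr (_ * _).
rewrite /I; under eq_Rintegral do rewrite mul0r add0r.
rewrite RintegralZl//; last exact: integrable_normal_pdf.
by rewrite /Rintegral integral_normal_pdf/= mulr1.
Qed.

End normal_characteristic.

(** * Smoothing inequality *)

Lemma continuous_Rintegral_cos {d} {T : measurableType d} {R : realType}
    (P : probability T R) (X : T -> R) : measurable_fun setT X ->
  continuous (fun s : R => \int[P]_w cos (s * X w)).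
Proof.
move=> mX s.
have ms (r : R) : measurable_fun setT (fun w => r * X w) by exact: measurable_funM.
apply: (@continuity_under_integral R _ T P (fun (s : R) w => cos (s * X w)) setT measurableT
  (s - 1) (s + 1) _ _ (cst 1)).
- by move=> r _; apply: bounded_mfun_integrable; exact: (bounded_mfun_cos (ms r)).
- apply: aeW => w _ r _; apply: differentiable_continuous; exact/derivable1_diffP.
- by apply: bounded_mfun_integrable; exact: bounded_mfun_cst.
- by move=> r _; apply: aeW => w _; exact: norm_cos_le1.
- by rewrite inE/= in_itv/=; lra.
Qed.

Lemma Rintegral_uniform_cos {R : realType} (a b : R) (ab : a < b) (s : R) : s != 0 ->
  \int[uniform_prob ab]_t cos (s * t) = (sin (s * b) - sin (s * a)) / (s * (b - a)).
Proof.
move=> s0.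
have ba0 : b - a != 0 by rewrite subr_eq0 gt_eqF.
have ms : measurable_fun setT (fun t : R => s * t) by exact: measurable_funM.
have bc := bounded_mfun_cos ms.
(* Adding 1 makes the integrand nonnegative, as [integral_uniform] requires. *)
suff : \int[uniform_prob ab]_t (1 + cos (s * t)) =
    1 + (sin (s * b) - sin (s * a)) / (s * (b - a)).
  rewrite bounded_RintegralD//; last exact: bounded_mfun_cst.
  by rewrite Rintegral_prob_cst => /addrI.
rewrite /Rintegral integral_uniform; last first.
- by move=> t; rewrite lee_fin -lerBlDl sub0r cos_geN1.
- by apply/measurable_EFinP/measurable_funD => //; case: bc.
pose H t := t + sin (s * t) / s.
have dH (t : R) : is_derive t 1 H (1 + cos (s * t)).
  apply: is_derive_eq; rewrite /GRing.scale/=; field.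
  exact: s0.
have cH : continuous H.
  by move=> t; apply: differentiable_continuous; apply/derivable1_diffP.
rewrite (@continuous_FTC2 _ _ H)//.
- by rewrite -EFinB -EFinM/= /H; field; rewrite ba0 s0.
- apply: continuous_subspaceT => t; apply: differentiable_continuous; exact/derivable1_diffP.
- split => //; first by apply: cvg_at_right_filter; exact: cH.
  by apply: cvg_at_left_filter; exact: cH.
- by move=> t _; rewrite derive1E; exact: derive_val.
Qed.

Section smoothing.
Context {R : realType}.
Notation mu := (@lebesgue_measure R).

(* The normal density of deviation e is itself a multiple of an average of cosines over
   normal frequencies of deviation e^-1; this replaces Fourier inversion. *)
Lemma normal_prob_itvE (z e a b : R) (ab : a < b) : 0 < e ->
  fine (normal_prob z e `[a, b]) =
  (b - a) * normal_peak e *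
    \int[uniform_prob ab]_t \int[normal_prob 0 e^-1]_s cos (s * (t - z)).
Proof.
move=> e0; have e0' : e != 0 by rewrite gt_eqF.
have ba0 : b - a != 0 by rewrite subr_eq0 gt_eqF.
have pk := normal_peak_gt0 e0'.
have E t : \int[normal_prob 0 e^-1]_s cos (s * (t - z)) =
    (normal_peak e)^-1 * normal_pdf z e t.
  rewrite normal_pdfE// mulKf ?gt_eqF//.
  have := @Rintegral_cos_normal _ e^-1 (t - z) 0; rewrite invr_gt0 => /(_ e0).
  rewrite cos0 mulr1 /normal_fun => h.
  transitivity (expR (- (e^-1 * (t - z)) ^+ 2 / 2)).
    by rewrite -h; apply: eq_Rintegral => s _; rewrite addr0 mulrC.
  by congr expR; rewrite -[_ *+ 2]mulr_natr; field.
under eq_Rintegral do rewrite E.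
have mp : measurable_fun setT (normal_pdf z e) by exact: measurable_normal_pdf.
have bp : bounded_mfun (normal_pdf z e).
  split => //; exists (normal_peak e) => x.
  by rewrite ger0_norm ?normal_pdf_ge0// normal_pdf_ub.
rewrite bounded_RintegralZl// /Rintegral integral_uniform; last first.
- by move=> t; rewrite lee_fin normal_pdf_ge0.
- exact/measurable_EFinP.
have : (\int[mu]_(x in `[a, b]) (normal_pdf z e x)%:E)%E \is a fin_num.
  apply: integrable_fin_num => //.
  by apply: integrableS (integrable_normal_pdf z e).
rewrite /normal_prob; set I := (\int[_]_(x in _) _)%E => finI.
rewrite fineM//=; move: (fine I) => y.
move: ba0 (normal_peak e) (gt_eqF pk) => + p p0; move: (b - a) => l l0.
by field; rewrite l0 p0.
Qed.

(** Markov's inequality. Multiplying the density by |t - z| / r >= 1 on A and applying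
    [normal_pdf_moment_le] leaves a density of total mass 1; the ratio of the peaks turns the
    constant into sqrt 2 * e. *)
Lemma normal_prob_far (z e r : R) (A : set R) : 0 < e -> 0 < r -> measurable A ->
  (forall t, A t -> r <= `|t - z|) ->
  (normal_prob z e A <= (Num.sqrt 2 * e / r)%:E)%E.
Proof.
move=> e0 r0 mA Ar; have e0' : e != 0 by rewrite gt_eqF.
have q0 : Num.sqrt 2 * e != 0 by rewrite mulf_neq0 ?gt_eqF// sqrtr_gt0.
pose k := Num.sqrt 2 * e / r.
have k0 : 0 <= k by rewrite divr_ge0 ?mulr_ge0// ltW.
have kE : e * normal_peak e / normal_peak (Num.sqrt 2 * e) = Num.sqrt 2 * e.
  rewrite /normal_peak.
  have -> : (Num.sqrt 2 * e) ^+ 2 * pi *+ 2 = 2 * (e ^+ 2 * pi *+ 2).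
    by rewrite exprMn sqr_sqrtr// mulrnAr mulrA.
  rewrite sqrtrM// invrK; have := sqrtr_gt0 (e ^+ 2 * pi *+ 2).
  rewrite mulrn_wgt0 ?mulr_gt0 ?exprn_gt0 ?pi_gt0// => h.
  by field; rewrite gt_eqF.
apply: (@le_trans _ _ (\int[mu]_(t in A) (k * normal_pdf z (Num.sqrt 2 * e) t)%:E)%E).
  apply: ge0_le_integral => //.
  - by move=> t _; rewrite lee_fin normal_pdf_ge0.
  - by apply/measurable_EFinP/measurable_funTS; exact: measurable_normal_pdf.
  - apply/measurable_EFinP/measurable_funTS; apply: measurable_funM => //.
    exact: measurable_normal_pdf.
  - move=> t /Ar rt; rewrite lee_fin.
    have c s : s != 0 -> normal_pdf z s t = normal_pdf 0 s (t - z).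
      by move=> s0; rewrite !normal_pdfE// /normal_fun subr0.
    rewrite !c// /k mulrAC ler_pdivlMr// mulrC.
    have := normal_pdf_moment_le (t - z) e0; rewrite kE; apply: le_trans.
    by rewrite ler_wpM2r ?normal_pdf_ge0.
apply: (@le_trans _ _ (\int[mu]_t (k * normal_pdf z (Num.sqrt 2 * e) t)%:E)%E).
  apply: ge0_subset_integral => //.
    by apply/measurable_EFinP/measurable_funM => //; exact: measurable_normal_pdf.
  by move=> t _; rewrite lee_fin mulr_ge0 ?normal_pdf_ge0.
under eq_integral do rewrite EFinM.
rewrite integralZl//; last exact: integrable_normal_pdf.
by rewrite integral_normal_pdf mule1.
Qed.


Lemma measurable_cdf_set {d} {T : measurableType d} (X : T -> R) (x : R) :
  measurable_fun setT X -> measurable [set w | X w <= x].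
Proof.
move=> mX; rewrite (_ : [set _ | _] = X @^-1` `]-oo, x]).
  by rewrite -[X in measurable X]setTI; exact: mX.
by apply/seteqP; split => w /=; rewrite in_itv.
Qed.

(** The deviation (n+1)^-2 is much smaller than the margin (n+1)^-1 added to the right of x, so
    convergence holds at z = x too: by [normal_prob_far] the error is at most sqrt 2 / (n+1) for
    large n. *)
Lemma normal_prob_itv_cvg (x z : R) :
  fine (normal_prob z (n.+1%:R ^- 2) `[- n.+1%:R, x + n.+1%:R^-1]) @[n --> \oo]
  --> ((z <= x)%R%:R : R).
Proof.
apply/cvgrPdist_le => /= e e0.
have key : \forall n \near \oo, Num.sqrt 2 * n.+1%:R^-1 <= e.
  have h : (Num.sqrt 2 * n.+1%:R^-1 : R) @[n --> \oo] --> (Num.sqrt 2 * 0 : R).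
    by apply: cvgMr; exact: cvg_harmonic.
  by rewrite mulr0 in h; move/cvgr_le : h => /(_ _ e0).
have far (n : nat) (A : set R) : measurable A ->
    (forall t, A t -> n.+1%:R^-1 <= `|t - z|) ->
    fine (normal_prob z (n.+1%:R ^- 2) A) <= Num.sqrt 2 * n.+1%:R^-1.
  move=> mA Ar; have n0 : (0 : R) < n.+1%:R by [].
  have h := @normal_prob_far z (n.+1%:R ^- 2) (n.+1%:R^-1) A.
  rewrite -lee_fin fineK; last exact: fin_num_measure.
  have e1 : (0 : R) < n.+1%:R ^- 2 by rewrite invr_gt0 exprn_gt0.
  have e2 : (0 : R) < n.+1%:R^-1 by rewrite invr_gt0.
  apply: (le_trans (h e1 e2 mA Ar)).
  by rewrite lee_fin -mulrA expr2 invfM mulfK// invr_neq0.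
have [zx|xz] := leP z x.
  near=> n.
  have n0 : (0 : R) < n.+1%:R by [].
  have zn : - n.+1%:R <= z - n.+1%:R^-1.
    have h1 : n.+1%:R^-1 <= 1 :> R by rewrite invf_le1// ler1n.
    have h2 : - z + 1 <= n.+1%:R :> R.
      near: n; exists (Num.truncn (`|z| + 1)) => // n /= zn.
      rewrite (@le_trans _ _ (`|z| + 1))//; first by rewrite lerD2r -normrN ler_norm.
      by rewrite (le_trans (ltW (Num.Theory.truncnS_gt _)))// ler_nat.
    move: h1 h2; set p := n.+1%:R; set q := p^-1; lra.
  set I := `[- n.+1%:R, x + n.+1%:R^-1]%classic.
  have mI : measurable I by exact: measurable_itv.
  have -> : (1 - fine (normal_prob z (n.+1%:R ^- 2) I)) =
      fine (normal_prob z (n.+1%:R ^- 2) (~` I)).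
    by rewrite probability_setC// [RHS]fineB ?fin_num_measure//.
  rewrite ger0_norm ?fine_ge0//.
  apply: (@le_trans _ _ (Num.sqrt 2 * n.+1%:R^-1)); last by near: n.
  apply: far; first exact: measurableC.
  move=> t /= /negP; rewrite in_itv/= negb_and -!ltNge => /orP[h|h].
    by rewrite ler_normr; apply/orP; right; have := zn; have := h;
      set p := n.+1%:R; set q := p^-1; lra.
  by rewrite ler_normr; apply/orP; left; have := zx; have := zn; have := h;
    set p := n.+1%:R; set q := p^-1; lra.
near=> n.
rewrite sub0r normrN ger0_norm ?fine_ge0//.
apply: (@le_trans _ _ (Num.sqrt 2 * n.+1%:R^-1)); last by near: n.
have h : n.+1%:R^-1 <= (z - x) / 2.
  near: n.
  have d0 : 0 < (z - x) / 2 by rewrite divr_gt0// subr_gt0.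
  have := @cvg_harmonic R; move/cvgr_le => /(_ _ d0).
  by [].
apply: far; first exact: measurable_itv.
move=> t /=; rewrite in_itv/= => /andP[_ tx].
by rewrite ler_normr; apply/orP; right; have := xz; have := tx; have := h;
  set q := n.+1%:R^-1; lra.
Unshelve. all: by end_near. Qed.

Section charfun.
Context {d} {T : measurableType d} (P : probability T R).

(** Fubini brings the expectation innermost, where the hypothesis on phi applies with phase - (s
    t). *)
Lemma Rintegral_normal_prob_itv (X : T -> R) (phi : R -> R) (e a b : R) (ab : a < b) :
  measurable_fun setT X -> 0 < e ->
  (forall s th, \int[P]_w cos (s * X w + th) = phi s * cos th) ->
  \int[P]_w fine (normal_prob (X w) e `[a, b]) =
  (b - a) * normal_peak e *
    \int[normal_prob 0 e^-1]_s (phi s * \int[uniform_prob ab]_t cos (s * t)).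
Proof.
move=> mX e0 hphi.
under eq_Rintegral do rewrite (normal_prob_itvE _ ab e0).
have b1 (z : R) : bounded_mfun (fun p : R * R => cos (p.2 * (p.1 - z))).
  apply: bounded_mfun_cos; apply: measurable_funM => //.
  exact: measurable_funB.
have b2 : bounded_mfun (fun p : (T * R) * R => cos (p.1.2 * (p.2 - X p.1.1))).
  apply: bounded_mfun_cos; apply: measurable_funM => //.
    by apply: measurableT_comp => //; exact: measurableT_comp.
  apply: measurable_funB => //; apply: measurableT_comp => //.
  by apply: measurableT_comp.
have b3 : bounded_mfun
    (fun p : T * R => \int[uniform_prob ab]_t cos (p.2 * (t - X p.1))).
  exact: (bounded_mfun_fubini1 (P \x normal_prob 0 e^-1)%E (uniform_prob ab) b2).
have Esw z : \int[uniform_prob ab]_t \int[normal_prob 0 e^-1]_s cos (s * (t - z)) =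
    \int[normal_prob 0 e^-1]_s \int[uniform_prob ab]_t cos (s * (t - z)).
  by rewrite (bounded_Fubini (uniform_prob ab) (normal_prob 0 e^-1) (b1 z)).
under eq_Rintegral do rewrite Esw.
have b4 : bounded_mfun (fun w => \int[normal_prob 0 e^-1]_s
    \int[uniform_prob ab]_t cos (s * (t - X w))).
  exact: (bounded_mfun_fubini1 P (normal_prob 0 e^-1) b3).
rewrite bounded_RintegralZl//; congr (_ * _).
rewrite (bounded_Fubini P (normal_prob 0 e^-1) b3)/=.
apply: eq_Rintegral => s _.
have b5 : bounded_mfun (fun p : T * R => cos (s * (p.2 - X p.1))).
  apply: bounded_mfun_cos; apply: measurable_funM => //.
  by apply: measurable_funB => //; exact: measurableT_comp.
rewrite (bounded_Fubini P (uniform_prob ab) b5)/=.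
have -> : (fun t => \int[P]_w cos (s * (t - X w))) = (fun t => phi s * cos (s * t)).
  apply/funext => t; rewrite -[cos (s * t)]cosN -hphi.
  by apply: eq_Rintegral => w _; rewrite -cosN; congr cos; ring.
by rewrite bounded_RintegralZl//; apply: bounded_mfun_cos; exact: measurable_funM.
Qed.

Variables (X Y : T -> R) (phi psi B : R -> R) (M : R).
Hypotheses (mX : measurable_fun setT X) (mY : measurable_fun setT Y).
(* The identity for all phases th says that the characteristic function is real. *)
Hypothesis phiE : forall s th, \int[P]_w cos (s * X w + th) = phi s * cos th.
Hypothesis psiE : forall s th, \int[P]_w cos (s * Y w + th) = psi s * cos th.
Hypothesis mB : measurable_fun (`[0, +oo[%classic : set R) B.
Hypothesis B0 : forall s, 0 <= s -> 0 <= B s.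
Hypothesis phiB : forall s, 0 < s -> `|phi s - psi s| <= s * B s.
Hypothesis BM : ((2 / pi)%:E * \int[mu]_(s in `[0%R, +oo[) (B s)%:E <= M%:E)%E.

Let charE (Z : T -> R) (chi : R -> R) :
  (forall s th, \int[P]_w cos (s * Z w + th) = chi s * cos th) ->
  chi = (fun s => \int[P]_w cos (s * Z w)).
Proof.
move=> h; apply/funext => s; have := h s 0; rewrite cos0 mulr1 => <-.
by apply: eq_Rintegral => w _; rewrite addr0.
Qed.

Let norm_charE (Z : T -> R) (chi : R -> R) : measurable_fun setT Z ->
  (forall s th, \int[P]_w cos (s * Z w + th) = chi s * cos th) ->
  [/\ continuous chi, bounded_mfun chi, chi 0 = 1 & forall s, chi (- s) = chi s].
Proof.
move=> mZ /charE ->.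
have c := @continuous_Rintegral_cos _ _ _ P Z mZ; split => //.
- split; first exact: continuous_measurable_fun.
  exists 1 => s; apply: norm_Rintegral_le => [|w]; last exact: norm_cos_le1.
  by apply: measurable_cos_comp; exact: measurable_funM.
- under eq_Rintegral do rewrite mul0r cos0.
  exact: Rintegral_prob_cst.
- by move=> s; apply: eq_Rintegral => w _; rewrite mulNr cosN.
Qed.

(** The bound is independent of a, b and e: the prefactor (b - a) cancels against the decay 2/(s (b
    - a)) of the averaged cosine, and the frequency density is bounded by its peak. *)
Let normal_test_le (e a b : R) (ab : a < b) : 0 < e ->
  `|\int[P]_w fine (normal_prob (X w) e `[a, b]) -
    \int[P]_w fine (normal_prob (Y w) e `[a, b])| <= M.
Proof.
move=> e0; rewrite (Rintegral_normal_prob_itv ab mX e0 phiE).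
rewrite (Rintegral_normal_prob_itv ab mY e0 psiE) -mulrBr.
have e0' : e != 0 by rewrite gt_eqF.
have ie0 : e^-1 != 0 by rewrite invr_neq0.
have ba0 : 0 < b - a by rewrite subr_gt0.
have pk := normal_peak_gt0 e0'; have pki := normal_peak_gt0 ie0.
have ba1 := ltW ba0; have pk1 := ltW pk; have pki1 := ltW pki.
pose K (s : R) := \int[uniform_prob ab]_t cos (s * t).
have [cphi bphi phi01 phiN] := norm_charE mX phiE.
have [cpsi bpsi psi01 psiN] := norm_charE mY psiE.
have cK : continuous K.
  apply: (@continuous_Rintegral_cos _ _ _ (uniform_prob ab) (fun t => t)).
  exact: measurable_id.
have mK : measurable_fun setT K by exact: continuous_measurable_fun.
have bK : bounded_mfun K.
  split => //; exists 1 => s; apply: norm_Rintegral_le => [|w]; last exact: norm_cos_le1.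
  by apply: measurable_cos_comp; exact: measurable_funM.
have KN s : K (- s) = K s by apply: eq_Rintegral => w _; rewrite mulNr cosN.
rewrite -bounded_RintegralB; [|exact: bounded_mfunM|exact: bounded_mfunM].
pose D s := `|(phi s - psi s) * K s|.
have D0 s : 0 <= D s by exact: normr_ge0.
have cD : continuous D.
  move=> s; apply: cvg_norm; apply: cvgM; last exact: cK.
  by apply: cvgB; [exact: cphi|exact: cpsi].
have bDK : bounded_mfun (fun s => (phi s - psi s) * K s).
  by apply: bounded_mfunM => //; exact: bounded_mfunB.
have bD : bounded_mfun D.
  split; first exact: continuous_measurable_fun.
  by have [_ [L DL]] := bDK; exists L => s; rewrite normr_id.
rewrite normrM [ `|_ * normal_peak e|]gtr0_norm ?mulr_gt0//.
apply: (@le_trans _ _ ((b - a) * normal_peak e * \int[normal_prob 0 e^-1]_s D s)).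
  rewrite ler_wpM2l ?mulr_ge0//.
  under eq_Rintegral do rewrite -mulrBl.
    rewrite [leRHS](_ : _ = \int[normal_prob 0 e^-1]_s `|(phi s - psi s) * K s|)//.
  apply: le_normr_Rintegral => //.
  exact: (bounded_mfun_integrable (normal_prob 0 e^-1) bDK).
rewrite Rintegral_normal_prob// -lee_fin; apply: le_trans BM.
have intD := integrable_bounded_normal_pdf e^-1 bD.
rewrite EFinM /Rintegral fineK; last exact: integrable_fin_num.
(* Both characteristic functions and the kernel [K] are even, so the integral is twice the one over
   the half-line. *)
rewrite (@ge0_symfun_integralT _ (fun s => D s * normal_pdf 0 e^-1 s)); last first.
- move=> s; rewrite /= /D KN phiN psiN !normal_pdf0E//.
  by rewrite sqrrN.
- move=> s; apply: cvgM; [exact: cD|exact: continuous_normal_pdf].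
- by move=> s; rewrite mulr_ge0 ?normal_pdf_ge0.
rewrite -set_itvcy.
(* [k] joins the bound 2/(s (b - a)) of the kernel to the peak of the frequency density; its 1/s
   absorbs the factor s of [phiB]. *)
pose k := 2 / (b - a) * normal_peak e^-1.
apply: (@le_trans _ _ (((b - a) * normal_peak e)%:E *
    (2%:E * \int[mu]_(s in `[0%R, +oo[) (k * B s)%:E)))%E.
  rewrite lee_wpmul2l ?lee_fin ?mulr_ge0// lee_wpmul2l ?lee_fin//.
  apply: ge0_le_integral => //.
  - by move=> s _; rewrite lee_fin mulr_ge0 ?normal_pdf_ge0.
  - apply/measurable_EFinP/measurable_funTS; apply: measurable_funM => //.
      by case: bD.
    exact: measurable_normal_pdf.
  - by apply/measurable_EFinP; exact: measurable_funM.
  (* At s = 0, which [phiB] does not cover, both characteristic functions equal 1 and [D]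
     vanishes. *)
  - move=> s; rewrite /= in_itv/= andbT le_eqVlt => /predU1P[<-|s0].
      rewrite lee_fin /D phi01 psi01 subrr mul0r normr0 mul0r mulr_ge0 ?B0//.
      by rewrite mulr_ge0 ?divr_ge0.
    rewrite lee_fin /k mulrAC ler_pM ?normal_pdf_ge0 ?normal_pdf_ub//.
    rewrite /D normrM /K Rintegral_uniform_cos ?gt_eqF//.
    apply: (@le_trans _ _ ((s * B s) * (2 / (s * (b - a))))).
      have s0' := ltW s0.
      rewrite ler_pM ?phiB// normrM normfV.
      rewrite [ `|s * _|]ger0_norm ?mulr_ge0//.
      rewrite ler_pM2r ?invr_gt0 ?mulr_gt0//.
      rewrite (le_trans (ler_normB _ _))// -[leRHS](mulr1 2) mulr2n mulrDl mul1r.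
      by rewrite lerD// norm_sin_le1.
    rewrite le_eqVlt; apply/orP; left; apply/eqP.
    by field; rewrite !gt_eqF.
under eq_integral do rewrite EFinM.
have k0 : 0 <= k by rewrite mulr_ge0 ?divr_ge0.
rewrite ge0_integralZl//; last 2 first.
- exact/measurable_EFinP.
- by move=> s; rewrite /= in_itv/= andbT lee_fin => /B0.
rewrite !muleA -!EFinM lee_wpmul2r//.
  by apply: integral_ge0 => s; rewrite /= in_itv/= andbT lee_fin => /B0.
(* The peaks for the deviations e and e^-1 multiply to 1/(2 pi); what remains is 4/(2 pi) = 2/pi. *)
rewrite lee_fin /k /normal_peak le_eqVlt; apply/orP; left; apply/eqP.
have q0 : Num.sqrt (e ^+ 2 * pi *+ 2) = e * Num.sqrt (pi *+ 2).
  by rewrite -mulrnAr sqrtrM ?sqr_ge0// sqrtr_sqr gtr0_norm.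
have q1 : Num.sqrt (e^-1 ^+ 2 * pi *+ 2) = e^-1 * Num.sqrt (pi *+ 2).
  by rewrite -mulrnAr sqrtrM ?sqr_ge0// sqrtr_sqr gtr0_norm// invr_gt0.
have p2 : 0 < pi *+ 2 :> R by rewrite mulrn_wgt0// pi_gt0.
have := sqr_sqrtr (ltW p2); rewrite q0 q1.
have : Num.sqrt (pi *+ 2 : R) != 0 by rewrite gt_eqF// sqrtr_gt0.
move: (Num.sqrt _) => q qn0 qq.
have pi0 : pi != 0 :> R by rewrite gt_eqF// pi_gt0.
have -> : 2 / pi = 4 / q ^+ 2.
  by rewrite qq; move: (pi : R) pi0 => p p0; rewrite -[p *+ 2]mulr_natr; field.
by field; rewrite e0' qn0 gt_eqF.
Qed.

Lemma smoothing_inequality (x : R) :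
  (`| P [set w | (X w <= x)%R] - P [set w | (Y w <= x)%R] | <= M%:E)%E.
Proof.
have mT (Z : T -> R) e a b : measurable_fun setT Z -> a < b -> 0 < e ->
    measurable_fun setT (fun w => fine (normal_prob (Z w) e `[a, b])).
  move=> mZ ab e0.
  have -> : (fun w => fine (normal_prob (Z w) e `[a, b])) =
    (fun w => (b - a) * normal_peak e *
      \int[uniform_prob ab]_t \int[normal_prob 0 e^-1]_s cos (s * (t - Z w))).
    by apply/funext => w; rewrite normal_prob_itvE.
  apply: measurable_funM => //.
  have b2 : bounded_mfun (fun p : (T * R) * R => cos (p.2 * (p.1.2 - Z p.1.1))).
    apply: bounded_mfun_cos; apply: measurable_funM => //.
    apply: measurable_funB => //; first exact: measurableT_comp.
    by apply: measurableT_comp => //; exact: measurableT_comp.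
  have b3 : bounded_mfun
      (fun p : T * R => \int[normal_prob 0 e^-1]_s cos (s * (p.2 - Z p.1))).
    exact: (bounded_mfun_fubini1 (P \x uniform_prob ab)%E (normal_prob 0 e^-1) b2).
  by have [] := bounded_mfun_fubini1 P (uniform_prob ab) b3.
(* Shifting the index by the integer part of |x| makes the interval nondegenerate already for n =
   0. *)
have ab n : - (n + Num.truncn `|x|).+1%:R < x + (n + Num.truncn `|x|).+1%:R^-1 :> R.
  have hN (N : R) : `|x| < N -> - N < x + N^-1.
    move=> xN; have N0 : 0 < N by rewrite (le_lt_trans _ xN).
    have iN : 0 < N^-1 by rewrite invr_gt0.
    by move: xN; rewrite ltr_norml => /andP[? _]; lra.
  apply: hN.
  by rewrite (lt_le_trans (Num.Theory.truncnS_gt _))// ler_nat ltnS leq_addl.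
have cvgZ (Z : T -> R) : measurable_fun setT Z ->
    \int[P]_w fine (normal_prob (Z w) ((n + Num.truncn `|x|).+1%:R ^- 2)
      `[- (n + Num.truncn `|x|).+1%:R, x + (n + Num.truncn `|x|).+1%:R^-1]) @[n --> \oo]
    --> fine (P [set w | Z w <= x]).
  move=> mZ.
  rewrite -(Rintegral_indic P (measurable_cdf_set x mZ)).
  apply: (@bounded_cvg_Rintegral _ _ _ P _ _ 1).
  - by move=> n; apply: mT.
  - by apply: measurable_indic; exact: measurable_cdf_set.
  - move=> n w; rewrite ger0_norm ?fine_ge0// -lee_fin fineK ?fin_num_measure//.
    exact: probability_le1.
  - apply: aeW => w; rewrite indicE mem_setE/=.
    have := @normal_prob_itv_cvg x (Z w).
    by rewrite -(cvg_shiftn (Num.truncn `|x|)).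
have fX : P [set w | X w <= x] \is a fin_num.
  by rewrite fin_num_measure//; exact: measurable_cdf_set.
have fY : P [set w | Y w <= x] \is a fin_num.
  by rewrite fin_num_measure//; exact: measurable_cdf_set.
rewrite -(fineK fX) -(fineK fY) -EFinB abse_EFin lee_fin.
apply: (cvgr_to_le (cvg_norm (cvgB (cvgZ _ mX) (cvgZ _ mY)))); apply: nearW => n.
by apply: (normal_test_le (ab n)).
Qed.

End charfun.

End smoothing.

(** * Gaussian mixtures *)

Section independent_Fubini.
Context {d d1 d2} {T : measurableType d} {T1 : measurableType d1}
  {T2 : measurableType d2} {R : realType}.
Variables (P : probability T R) (Q : probability T2 R) (Z : T -> T1) (V : T -> T2).
Hypotheses (mZ : measurable_fun setT Z) (mV : measurable_fun setT V).
Hypothesis indepZV : forall A B, measurable A -> measurable B ->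
  P ((Z @^-1` A) `&` (V @^-1` B)) = (P (Z @^-1` A) * Q B)%E.

(** [indepZV] says at once that V has law Q and is independent of Z; the joint law is then the
    product because it agrees with it on rectangles. The target of Z is arbitrary: below it is the
    sample space itself with a smaller sigma-algebra. *)
Lemma independent_Rintegral (f : T1 * T2 -> R) : bounded_mfun f ->
  \int[P]_w f (Z w, V w) = \int[P]_w \int[Q]_v f (Z w, v).
Proof.
move=> bf; have [mf _] := bf.
have mZV : measurable_fun setT (fun w => (Z w, V w)) by exact: measurable_fun_pair.
pose Z' : {RV P >-> T1} := mfun_Sub (mem_set mZ).
pose ZV' : {RV P >-> (T1 * T2)%type} := mfun_Sub (mem_set mZV).
pose PZ := distribution P Z'.
have bfZ : bounded_mfun (fun z => \int[Q]_v f (z, v)).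
  exact: (bounded_mfun_fubini1 PZ Q bf).
have int1 : P.-integrable setT ((EFin \o f) \o (fun w => (Z w, V w))).
  by apply: (bounded_mfun_integrable P (bounded_mfun_comp bf mZV)).
have int2 : P.-integrable setT ((EFin \o (fun z => \int[Q]_v f (z, v))) \o Z).
  by apply: (bounded_mfun_integrable P (bounded_mfun_comp bfZ mZ)).
have mf' : measurable_fun setT (EFin \o f) by exact/measurable_EFinP.
transitivity (\int[distribution P ZV']_z f z).
  by congr fine; rewrite (integral_distribution (X := ZV') mf' int1).
transitivity (\int[(PZ \x Q)%E]_z f z).
  congr fine; apply: eq_measure_integral => A mA _; apply/esym.
  exact: product_measure_unique.
rewrite -bounded_Fubini1//.
have mfZ : measurable_fun setT (EFin \o (fun z => \int[Q]_v f (z, v))).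
  by apply/measurable_EFinP; case: bfZ.
by congr fine; rewrite (integral_distribution (X := Z') mfZ int2).
Qed.

End independent_Fubini.

Section normal_mixture.
Context {d} {T : measurableType d} {R : realType} (P : probability T R).
Variables (W G : nat -> {RV P >-> R}) (sigma : R).
Hypothesis sigma0 : 0 < sigma.
Hypothesis W_indep : mutually_independent P W.
Hypothesis W_normal : forall j A, measurable A ->
  distribution P (W j) A = normal_prob 0 sigma A.
Hypothesis WG_indep : independent_families P W G.

Notation sigmaW := (g_sigma_algebraType (\bigcup_i preimage_set_system setT (W i) measurable)).
Notation sigmaG := (g_sigma_algebraType (\bigcup_i preimage_set_system setT (G i) measurable)).

Let Wcap n (B : nat -> set R) := \bigcap_(i in `I_n) (W i @^-1` B i).

(** A pi-system generating the sigma-algebra of all the arrival times and of the marks of index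
    below n. *)
Definition past n : set (set T) := [set E | exists (B : nat -> set R) (A : set T),
  [/\ forall i, measurable (B i), sigma_of_family G A & E = A `&` Wcap n B]].

Let mWi i (B : set R) : measurable B -> measurable (W i @^-1` B).
Proof. by move=> mB; rewrite -[X in measurable X]setTI; exact: measurable_funP. Qed.

Let mGA A : sigma_of_family G A -> measurable A.
Proof.
apply: smallest_sub; first exact: sigma_algebra_measurable.
by move=> _ [i _ [B mB <-]]; exact: measurable_funP.
Qed.

Let mWcap n B : (forall i, measurable (B i)) -> measurable (Wcap n B).
Proof. by move=> mB; apply: bigcap_measurableType => i _; exact: mWi. Qed.

Let sWcap n B : (forall i, measurable (B i)) -> sigma_of_family W (Wcap n B).
Proof.
move=> mB; elim: n => [|n ih].
  rewrite /Wcap II0 bigcap_set0; exact: (@measurableT _ sigmaW).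
rewrite /Wcap IIS bigcap_setU bigcap_set1; apply: (@measurableI _ sigmaW) => //.
by apply: sub_sigma_algebra; exists n => //; exists (B n) => //; rewrite setTI.
Qed.

Let PWcapS n B : (forall i, measurable (B i)) ->
  P (Wcap n.+1 B) = (P (W n @^-1` B n) * P (Wcap n B))%E.
Proof.
move=> mB.
have E m : Wcap m B = \bigcap_(i in [set` fset_set `I_m]) (W i @^-1` B i).
  by rewrite fset_setK.
rewrite !E !W_indep//.
have nI : n \notin fset_set `I_n by rewrite in_fset_set// notin_setE/= ltnn.
have -> : fset_set `I_n.+1 = (n |` fset_set `I_n)%fset.
  by rewrite IIS setUC fset_setU1.
by rewrite big_fsetU1.
Qed.

Let past_setI n : setI_closed (past n).
Proof.
move=> _ _ [B1 [A1 [mB1 sA1 ->]]] [B2 [A2 [mB2 sA2 ->]]].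
exists (fun i => B1 i `&` B2 i), (A1 `&` A2); split.
- by move=> i; exact: measurableI.
- exact: (@measurableI _ sigmaG).
- by rewrite setIACA /Wcap -bigcapI.
Qed.

(** Pi-lambda argument: the events that factor with [C] form a lambda system, and it contains
    [past n]. *)
Lemma independent_past n (E B : set _) : <<s past n >> E -> measurable B ->
  P (E `&` (W n @^-1` B)) = (P E * normal_prob 0 sigma B)%E.
Proof.
move=> + mB; pose C := W n @^-1` B.
have mC : measurable C by exact: mWi.
have PC : P C = normal_prob 0 sigma B by rewrite -(W_normal n mB).
pose H := [set E | measurable E /\ P (E `&` C) = (P E * P C)%E].
suff : <<s past n >> `<=` H by move=> h /h[_]; rewrite PC.
apply: lambda_system_subset => //.
- apply/dynkin_lambda_system; split.
  + by split => //; rewrite setTI probability_setT mul1e.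
  + move=> A [mA PA]; split; first exact: measurableC.
    rewrite setIC -setDE measureD//; last first.
      by rewrite (le_lt_trans (probability_le1 _ _))// ltry.
    rewrite setIC; transitivity (P C - P A * P C)%E.
      by congr (_ - _)%E; exact: PA.
    rewrite probability_setC// -[X in (X - _)%E]mul1e.
    by rewrite muleBl// ?fin_num_measure// fin_num_adde_defl// fin_num_measure.
  + move=> F tF HF; split; first by apply: bigcup_measurable => k _; case: (HF k).
    have mF k : measurable (F k) by case: (HF k).
    rewrite setI_bigcupl measure_bigcup//; last 2 first.
      by move=> k _; exact: measurableI.
      exact: trivIset_setIr.
    rewrite measure_bigcup//.
    have fC : P C \is a fin_num by exact: fin_num_measure.
    rewrite muleC -(fineK fC) -nneseriesZl//.
    by apply: eq_eseriesr => k _; rewrite fineK// muleC; case: (HF k).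
- move=> _ [D [A [mD sA ->]]]; have mA := mGA sA; split.
    by apply: measurableI => //; exact: mWcap.
  (* [D'] adds the constraint on W n to those on the earlier marks. The event is then a mark event
     intersected with an arrival event, which [WG_indep] separates before [PWcapS] splits off W
     n. *)
  pose D' i := if (i == n)%N then B else D i.
  have mD' i : measurable (D' i) by rewrite /D'; case: ifP.
  have D'E m : (m <= n)%N -> Wcap m D' = Wcap m D.
    move=> mn; apply: eq_bigcapr => i /= im; rewrite /D' ifF//.
    by apply/negbTE; rewrite neq_ltn (leq_trans im mn).
  have -> : A `&` Wcap n D `&` C = Wcap n.+1 D' `&` A.
    rewrite /Wcap IIS bigcap_setU bigcap_set1 -/(Wcap n D') D'E// /D' eqxx.
    by rewrite -setIA setIC.
  rewrite [A `&` _]setIC [LHS]WG_indep//; last exact: sWcap.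
  rewrite [P (Wcap n D `&` A)]WG_indep//; last exact: sWcap.
  rewrite PWcapS// D'E// /D' eqxx.
  by rewrite -/C -muleA muleC.
Qed.

Notation pastT n := (g_sigma_algebraType (past n)).

Let measurable_sigmaG_past n (f : T -> R) :
  measurable_fun (setT : set sigmaG) (f : sigmaG -> R) ->
  measurable_fun (setT : set (pastT n)) (f : pastT n -> R).
Proof.
move=> mf _ B mB; apply: sub_sigma_algebra.
exists (fun=> setT), (setT `&` f @^-1` B); split => //; first exact: mf.
by rewrite setTI; apply/seteqP; split => w //= -[].
Qed.

Let measurable_W_past n i : (i < n)%N ->
  measurable_fun (setT : set (pastT n)) (W i : pastT n -> R).
Proof.
move=> ni _ B mB; apply: sub_sigma_algebra.
exists (fun j => if j == i then B else setT), setT; split => //.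
- by move=> j; case: ifP.
- exact: (@measurableT _ sigmaG).
- congr (_ `&` _); rewrite /Wcap; apply/seteqP; split => w /=.
    by move=> BW j _ /=; case: ifP => // /eqP ->.
  by move=> /(_ i ni)/=; rewrite eqxx.
Qed.

Let measurable_pastT n (f : T -> R) :
  measurable_fun (setT : set (pastT n)) (f : pastT n -> R) ->
  measurable_fun setT f.
Proof.
move=> mf _ B mB; have := mf measurableT B mB.
apply: smallest_sub; first exact: sigma_algebra_measurable.
move=> _ [D [A [mD sA ->]]]; apply: measurableI; first exact: mGA.
exact: mWcap.
Qed.

Let measurable_sigmaG (f : T -> R) :
  measurable_fun (setT : set sigmaG) (f : sigmaG -> R) ->
  measurable_fun setT f.
Proof.
move=> mf; apply: (measurable_pastT (n := 0%N)); exact: measurable_sigmaG_past.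
Qed.

(** Induction on the number of marks: given the past, the last one is integrated out as a normal
    variable, the earlier terms acting as a phase. The resulting factor depends on the arrivals only
    and is absorbed in the weight, which is why H is general. *)
Lemma Rintegral_cos_mixture n (H : T -> R) (a : nat -> T -> R) (th : R) :
  (exists M, forall w, `|H w| <= M) ->
  measurable_fun (setT : set sigmaG) (H : sigmaG -> R) ->
  (forall j, measurable_fun (setT : set sigmaG) (a j : sigmaG -> R)) ->
  \int[P]_w (H w * cos (\sum_(j < n) a j w * W j w + th)) =
  (\int[P]_w (H w * expR (- (sigma ^+ 2 / 2) * \sum_(j < n) a j w ^+ 2))) * cos th.
Proof.
move=> + + ma; elim: n H => [H [M HM] mH|n ih H [M HM] mH].
  under eq_Rintegral do rewrite big_ord0 add0r.
  under [in RHS]eq_Rintegral do rewrite big_ord0 mulr0 expR0 mulr1.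
  rewrite [RHS]mulrC -bounded_RintegralZl//.
    by apply: eq_Rintegral => w _; rewrite mulrC.
  by split; [exact: measurable_sigmaG|exists M].
(* The identity, with the sigma-algebra of the past on its target, is the variable on which W n is
   conditioned. *)
have mZ : measurable_fun setT (id : T -> pastT n).
  move=> _ B mB; rewrite setTI; move: mB.
  apply: smallest_sub; first exact: sigma_algebra_measurable.
  move=> _ [D [A [mD sA ->]]]; apply: measurableI; first exact: mGA.
  exact: mWcap.
have indep A B : measurable (A : set (pastT n)) -> measurable B ->
    P ((id : T -> pastT n) @^-1` A `&` W n @^-1` B) =
    (P ((id : T -> pastT n) @^-1` A) * normal_prob 0 sigma B)%E.
  by move=> mA mB; exact: independent_past.
pose th' w := \sum_(j < n) a j w * W j w + th.
have mth' : measurable_fun (setT : set (pastT n)) (th' : pastT n -> R).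
  apply: measurable_funD => //; apply: measurable_sum => j.
  apply: measurable_funM; first exact: measurable_sigmaG_past.
  exact: measurable_W_past.
pose f (p : pastT n * R) := H p.1 * cos (a n p.1 * p.2 + th' p.1).
have bf : bounded_mfun f.
  apply: bounded_mfunM.
    split; last by exists M => p; exact: HM.
    by apply: measurableT_comp => //; exact: (measurable_sigmaG_past (n := n) mH).
  apply: bounded_mfun_cos; apply: measurable_funD.
    apply: measurable_funM => //.
    by apply: measurableT_comp => //; exact: (measurable_sigmaG_past (n := n) (ma n)).
  by apply: measurableT_comp => //; exact: mth'.
have /= key := @independent_Rintegral _ _ _ _ _ _ _ P (normal_prob 0 sigma) _ _ mZ
  (measurable_funPT (W n)) indep f bf.
transitivity (\int[P]_w f (w, W n w)).
  by apply: eq_Rintegral => w _; rewrite /f big_ord_recr/= /th' -addrA addrCA addrA.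
rewrite key.
pose H' w := H w * expR (- (sigma ^+ 2 / 2) * a n w ^+ 2).
transitivity (\int[P]_w (H' w * cos (th' w))).
  apply: eq_Rintegral => w _; rewrite /f/= bounded_RintegralZl.
    rewrite Rintegral_cos_normal// mulrA /H'; congr (_ * expR _ * _).
    by rewrite exprMn; field.
  by apply: bounded_mfun_cos; apply: measurable_funD => //; exact: measurable_funM.
rewrite /th' ih.
- congr (_ * _); apply: eq_Rintegral => w _.
  by rewrite /H' big_ord_recr/= -mulrA -expRD -mulrDr [in RHS]addrC.
- exists M => w; rewrite normrM -[M]mulr1 ler_pM//.
  rewrite ger0_norm ?expR_ge0// -expR0 ler_expR mulNr oppr_le0.
  by rewrite mulr_ge0 ?sqr_ge0// divr_ge0 ?sqr_ge0.
- apply: measurable_funM => //; apply: measurableT_comp => //.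
  by apply: measurable_funM => //; exact: measurable_funX.
Qed.

End normal_mixture.

(** * Laplace functional of the Poisson arrivals *)

Section finite_products.
Context {d} {T : measurableType d} {R : realType} (P : probability T R).

Lemma Rintegral_sum (I : Type) (r : seq I) (f : I -> T -> R) :
  (forall i, bounded_mfun (f i)) ->
  bounded_mfun (fun w => \sum_(i <- r) f i w) /\
  \int[P]_w (\sum_(i <- r) f i w) = \sum_(i <- r) \int[P]_w f i w.
Proof.
move=> bf; elim: r => [|i r [b ih]].
  split.
    under eq_fun do rewrite big_nil.
    exact: bounded_mfun_cst.
  rewrite big_nil; under eq_Rintegral do rewrite big_nil.
  exact: Rintegral_prob_cst.
split.
  under eq_fun do rewrite big_cons.
  exact: bounded_mfunD.
rewrite big_cons; under eq_Rintegral do rewrite big_cons.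
by rewrite bounded_RintegralD// ih.
Qed.

Lemma prod_indic m (A : 'I_m -> set T) w :
  \prod_k (\1_(A k) w : R) = \1_(\bigcap_k A k) w.
Proof.
rewrite indicE; have [/set_mem h|/negP h] := boolP (w \in _).
  by rewrite big1// => k _; rewrite indicE mem_set//; exact: h.
have [k Ak] : exists k, ~ A k w.
  by apply/existsNP => hA; apply: h; rewrite inE => k _; exact: hA.
by rewrite (bigD1 k)//= indicE memNset// mul0r.
Qed.

(** Expanding the product of sums over all choice functions phi leaves indicators of intersections,
    whose probabilities factor by hypothesis. *)
Lemma Rintegral_prod_simple m L (A : 'I_m -> 'I_L -> set T) (c : 'I_m -> 'I_L -> R) :
  (forall k n, measurable (A k n)) ->
  (forall phi : {ffun 'I_m -> 'I_L}, fine (P (\bigcap_k A k (phi k))) =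
    \prod_k fine (P (A k (phi k)))) ->
  \int[P]_w (\prod_k \sum_n c k n * \1_(A k n) w) =
  \prod_k \sum_n c k n * fine (P (A k n)).
Proof.
move=> mA hP; under eq_Rintegral do rewrite bigA_distr_bigA.
have mI (phi : {ffun 'I_m -> 'I_L}) : measurable (\bigcap_k A k (phi k)).
  apply: fin_bigcap_measurable => // k _; exact: mA.
have E (phi : {ffun 'I_m -> 'I_L}) w :
    \prod_i (c i (phi i) * \1_(A i (phi i)) w) =
    \prod_i c i (phi i) * \1_(\bigcap_k A k (phi k)) w.
  by rewrite big_split/= prod_indic.
have b1 (phi : {ffun 'I_m -> 'I_L}) : bounded_mfun (\1_(\bigcap_k A k (phi k)) : T -> R).
  split; first exact: measurable_indic.
  by exists 1 => w; rewrite indicE; case: (_ \in _); rewrite ?normr1// normr0.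
under eq_Rintegral do (under eq_bigr do rewrite E).
have b2 (phi : {ffun 'I_m -> 'I_L}) :
    bounded_mfun (fun w => \prod_i c i (phi i) * \1_(\bigcap_k A k (phi k)) w).
  by apply: bounded_mfunM => //; exact: bounded_mfun_cst.
rewrite (proj2 (Rintegral_sum _ b2)) [RHS]bigA_distr_bigA.
apply: eq_bigr => phi _.
by rewrite bounded_RintegralZl// Rintegral_indic// hP big_split.
Qed.

End finite_products.

Section poisson_counts.
Context {d} {T : measurableType d} {R : realType} (P : probability T R).
Variable G : nat -> {RV P >-> R}.
Hypothesis G_poisson : unit_poisson_arrivals P G.

Local Notation cnt := (arrival_count (G : nat -> T -> R)).

Definition partial_count n (s t : R) (w : T) : R := \sum_(j < n) (s < G j w <= t)%R%:R.

Lemma arrival_countE s t w :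
  cnt s t w = (\sum_(0 <= j <oo) ((s < G j w <= t)%R%:R)%:E)%E.
Proof.
rewrite /arrival_count counting_dirac; apply: eq_eseriesr => j _.
rewrite /dirac indicE; congr ((nat_of_bool _)%:R%:E); apply/idP/idP => [/set_mem//|h].
by rewrite inE.
Qed.

Lemma partial_count_le n s t w : ((partial_count n s t w)%:E <= cnt s t w)%E.
Proof.
rewrite arrival_countE; apply: le_trans (nneseries_lim_ge n _).
  by rewrite big_mkord sumEFin.
by move=> j _ _; rewrite lee_fin.
Qed.

Lemma arrival_count_cvg s t w :
  (partial_count n s t w)%:E @[n --> \oo] --> cnt s t w.
Proof.
rewrite arrival_countE.
have := @is_cvg_nneseries R (fun j => ((s < G j w <= t)%R%:R)%:E) xpredT 0%N.
move=> /(_ _)/cvg_ex[|l hl]; first by move=> j _ _; rewrite lee_fin.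
have -> : (\sum_(0 <= j <oo) ((s < G j w <= t)%R%:R)%:E = l)%E by exact: cvg_lim.
by under eq_cvg do rewrite /partial_count -sumEFin -(big_mkord xpredT (fun j => ((s < G j w <= t)%R%:R)%:E)).
Qed.

Lemma measurable_arrival_count s t : measurable_fun setT (cnt s t).
Proof.
rewrite (_ : cnt s t = fun w => \sum_(0 <= j <oo) ((s < G j w <= t)%R%:R)%:E)%E; last first.
  by apply/funext => w; exact: arrival_countE.
apply: ge0_emeasurable_sum => [k w _ _|k _]; first by rewrite lee_fin.
apply/measurable_EFinP.
have -> : (fun w => (s < G k w <= t)%R%:R) = \1_(G k @^-1` `]s, t]) :> (T -> R).
  apply/funext => w; rewrite indicE; congr ((nat_of_bool _)%:R).
    apply/idP/idP => [h|/set_mem]; last by rewrite /= in_itv.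
    by apply/mem_set; rewrite /= in_itv.
apply: measurable_indic; rewrite -[X in measurable X]setTI; exact: measurable_funP.
Qed.

Lemma arrival_count_nat s t w :
  cnt s t w = +oo%E \/ exists n : nat, cnt s t w = n%:R%:E.
Proof. by rewrite /arrival_count /counting; case: ifPn => _; [right; eexists|left]. Qed.

(** The value 0 at +oo is kept even for b = 0, so that [count_factor 0] is the indicator of a finite
    count. *)
Definition count_factor (b : R) (x : \bar R) : R :=
  if x is r%:E then expR (- (b * r)) else 0.

Lemma measurable_count_eq s t (n : nat) : measurable [set w | cnt s t w = n%:R%:E].
Proof.
rewrite (_ : [set _ | _] = setT `&` cnt s t @^-1` [set n%:R%:E]); last by rewrite setTI.
exact: measurable_arrival_count.
Qed.

Lemma count_factor_cvg b s t w :
  \sum_(n < L) expR (- (b * n%:R)) * \1_[set w | cnt s t w = n%:R%:E] w @[L --> \oo]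
  --> count_factor b (cnt s t w).
Proof.
have [h|[n0 h]] := arrival_count_nat s t w; rewrite h/=.
  apply: cvg_near_cst; apply: nearW => L /=; rewrite big1// => n _.
  by rewrite indicE memNset ?mulr0//= h.
apply: cvg_near_cst; exists n0.+1 => // L /= n0L.
rewrite (bigD1 (Ordinal n0L))//= indicE mem_set//= mulr1 big1 ?addr0// => n nn0.
rewrite indicE memNset ?mulr0//= h => -[/eqP]; rewrite eqr_nat => /eqP n0n.
by move/eqP : nn0; apply; apply: val_inj.
Qed.

Lemma poisson_exp_cvg b (del : R) : 0 < del ->
  \sum_(n < L) expR (- (b * n%:R)) * poisson_pmf del n @[L --> \oo]
  --> expR (- (del * (1 - expR (- b)))).
Proof.
move=> d0.
have E L : \sum_(n < L) expR (- (b * n%:R)) * poisson_pmf del n =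
    expR (- del) * series (exp_coeff (del * expR (- b))) L.
  rewrite /series/= big_mkord big_distrr/=; apply: eq_bigr => n _.
  rewrite /poisson_pmf d0 /exp_coeff/= exprMn -expRM_natl.
  by rewrite mulrN [n%:R * b]mulrC; field.
under eq_cvg do rewrite E.
rewrite mulrBr mulr1 opprB addrC expRD.
apply: cvgMr; exact: is_cvg_series_exp_coeff.
Qed.

Lemma prod_count_eq m (t : nat -> R) : 0 <= t 0%N -> (forall k, t k < t k.+1) ->
  forall phi : nat -> nat,
  fine (P (\bigcap_(k in `I_m) [set w | cnt (t k) (t k.+1) w = (phi k)%:R%:E])) =
  \prod_(k < m) poisson_pmf (t k.+1 - t k) (phi k).
Proof.
move=> t0 tS phi.
have t_ge0 k : 0 <= t k by elim: k => // k /le_trans; apply; exact: ltW.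
have [_ pmfE indep] := G_poisson.
have tle k : t k <= t k.+1 by exact: ltW.
have mB k : measurable [set (phi k)%:R%:E : \bar R] by [].
have := indep t t0 tle (fset_set `I_m) (fun k => [set (phi k)%:R%:E]) mB.
rewrite fset_setK// => h.
transitivity (fine (\prod_(k <- fset_set `I_m) P [set w | cnt (t k) (t k.+1) w = (phi k)%:R%:E])%E).
  by rewrite -h.
elim: m {h} => [|m ih].
  by rewrite II0 fset_set0 big_seq_fset0 big_ord0.
have mI : m \notin fset_set `I_m by rewrite in_fset_set// notin_setE/= ltnn.
rewrite IIS setUC fset_setU1// big_fsetU1// big_ord_recr/= mulrC pmfE//.
rewrite fineM//; first by rewrite ih.
elim/big_ind : _ => // [x y|k _]; first exact: fin_numM.
by rewrite pmfE.
Qed.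

Lemma count_factor_ge0 b x : 0 <= count_factor b x.
Proof. by rewrite /count_factor; case: x => // r; exact: expR_ge0. Qed.

Lemma count_factor_le1 b s t w : 0 <= b -> count_factor b (cnt s t w) <= 1.
Proof.
move=> b0; have [->//|[n ->]] := arrival_count_nat s t w.
by rewrite /= -expR0 ler_expR oppr_le0 mulr_ge0.
Qed.

Lemma measurable_count_factor b s t :
  measurable_fun setT (fun w => count_factor b (cnt s t w)).
Proof.
apply: (measurable_fun_cvg (h := fun L w =>
  \sum_(n < L) expR (- (b * n%:R)) * \1_[set w | cnt s t w = n%:R%:E] w)).
- move=> L; apply: measurable_sum => n; apply: measurable_funM => //.
  exact/measurable_indic/measurable_count_eq.
- by move=> w _; exact: count_factor_cvg.
Qed.

(** Joint Laplace transform of independent Poisson counts. Counts below L give simple functions;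
    these stay in [0, 1], since at most one indicator per factor is nonzero, so L can tend to
    infinity on both sides. *)
Lemma Rintegral_prod_count m (t b : nat -> R) :
  0 <= t 0%N -> (forall k, t k < t k.+1) -> (forall k, 0 <= b k) ->
  \int[P]_w (\prod_(k < m) count_factor (b k) (cnt (t k) (t k.+1) w)) =
  expR (- \sum_(k < m) (t k.+1 - t k) * (1 - expR (- b k))).
Proof.
move=> t0 tS b0.
have mulc : continuous (fun x : R * R => x.1 * x.2) by exact: mul_continuous.
pose f L w := \prod_(k < m) \sum_(n < L)
    expR (- (b k * n%:R)) * \1_[set w | cnt (t k) (t k.+1) w = n%:R%:E] w : R.
have fE L : \int[P]_w f L w =
    \prod_(k < m) \sum_(n < L) expR (- (b k * n%:R)) * poisson_pmf (t k.+1 - t k) n.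
  rewrite (@Rintegral_prod_simple _ _ _ P m L
    (fun k n => [set w | cnt (t k) (t k.+1) w = n%:R%:E])).
  - apply: eq_bigr => k _; apply: eq_bigr => n _; congr (_ * _).
    have [_ pmfE _] := G_poisson.
    rewrite pmfE//; elim: (k : nat) => // j /le_trans; apply; exact: ltW.
  - by move=> k n; exact: measurable_count_eq.
  - move=> phi.
    have [_ pmfE _] := G_poisson.
    (* [prod_count_eq] takes a function on all naturals; the values outside 'I_m are irrelevant. *)
    pose phi' k := if insub k is Some i then phi i : nat else 0%N.
    have phiE (k : 'I_m) : phi' k = phi k by rewrite /phi' valK.
    transitivity (\prod_(k < m) poisson_pmf (t k.+1 - t k) (phi' k)).
      rewrite -prod_count_eq//; congr (fine (P _)); apply/seteqP; split => w /= h.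
        by move=> k /= km; have := h (Ordinal km) Logic.I; rewrite -phiE.
      by move=> k _ /=; rewrite -phiE; exact: (h k (ltn_ord k)).
    apply: eq_bigr => k _; rewrite -phiE pmfE//=.
    by elim: (k : nat) => // j /le_trans; apply; exact: ltW.
have lim1 : \int[P]_w f L w @[L --> \oo] -->
    \int[P]_w (\prod_(k < m) count_factor (b k) (cnt (t k) (t k.+1) w)).
  apply: (@bounded_cvg_Rintegral _ _ _ P _ _ 1).
  - move=> L; apply: measurable_prod => k _; apply: measurable_sum => n.
    by apply: measurable_funM => //; exact/measurable_indic/measurable_count_eq.
  - by apply: measurable_prod => k _; exact: measurable_count_factor.
  - move=> L w; rewrite ger0_norm; last first.
      by apply: prodr_ge0 => k _; apply: sumr_ge0 => n _; rewrite mulr_ge0 ?expR_ge0.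
    rewrite [leRHS](_ : 1 = \prod_(k < m) 1 :> R); last by rewrite big1_eq.
    apply: ler_prod => k _; apply/andP; split.
      by apply: sumr_ge0 => n _; rewrite mulr_ge0 ?expR_ge0.
    have [h|[n0 h]] := arrival_count_nat (t k) (t k.+1) w.
      by rewrite big1// => n _; rewrite indicE memNset ?mulr0//= h.
    have [n0L|n0L] := ltnP n0 L.
      rewrite (bigD1 (Ordinal n0L))//= indicE mem_set//= mulr1 big1 ?addr0// => [|n nn0].
        by rewrite -expR0 ler_expR oppr_le0 mulr_ge0.
      rewrite indicE memNset ?mulr0//= h => -[/eqP]; rewrite eqr_nat => /eqP n0n.
      by move/eqP : nn0; apply; apply: val_inj.
    rewrite big1// => n _; rewrite indicE memNset ?mulr0//= h => -[/eqP].
    by rewrite eqr_nat => /eqP n0n; have := ltn_ord n; rewrite -n0n ltnNge n0L.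
  - apply: aeW => w; apply: cvg_big => // k _; exact: count_factor_cvg.
have lim2 : \int[P]_w f L w @[L --> \oo] -->
    \prod_(k < m) expR (- ((t k.+1 - t k) * (1 - expR (- b k)))).
  under eq_cvg do rewrite fE.
  apply: cvg_big => // k _; apply: poisson_exp_cvg.
  by rewrite subr_gt0.
rewrite -(cvg_lim (@Rhausdorff R) lim1) (cvg_lim (@Rhausdorff R) lim2).
by rewrite -expR_sum -sumrN.
Qed.

(** The Laplace transform at b = 0 equals 1, and by the convention in [count_factor] it is the
    probability of a finite count. *)
Lemma ae_arrival_count_fin s t : 0 <= s -> s < t ->
  {ae P, forall w, cnt s t w \is a fin_num}.
Proof.
move=> s0 st.
(* An infinite increasing sequence starting with s and t, the form in which [Rintegral_prod_count]
   takes its times. *)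
pose tt (k : nat) := s + k%:R * (t - s).
have d0 : 0 < t - s by rewrite subr_gt0.
have tS k : tt k < tt k.+1 by rewrite /tt ltrD2l ltr_pM2r// ltr_nat.
have tt0 : 0 <= tt 0%N by rewrite /tt mul0r addr0.
have := @Rintegral_prod_count 1 tt (fun=> 0) tt0 tS (fun=> lexx 0).
rewrite big_ord1 oppr0 expR0 subrr mulr0 oppr0 expR0.
under eq_Rintegral do rewrite big_ord1.
have -> : tt (@ord0 0) = s by rewrite /tt mul0r addr0.
have -> : tt (@ord0 0).+1 = t by rewrite /tt mul1r subrKC.
have mI : measurable [set w | cnt s t w = +oo%E].
  rewrite (_ : [set _ | _] = setT `&` cnt s t @^-1` [set +oo%E]); last by rewrite setTI.
  exact: measurable_arrival_count.
have -> : (fun w => count_factor 0 (cnt s t w)) = \1_(~` [set w | cnt s t w = +oo%E]).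
  apply/funext => w; rewrite indicE.
  have [h|[n h]] := arrival_count_nat s t w; rewrite h/=.
    by rewrite memNset//= => /(_ h).
  by rewrite mem_set/= ?h// mul0r oppr0 expR0.
rewrite Rintegral_indic; last exact: measurableC.
rewrite probability_setC// fineB//; last exact: fin_num_measure.
move=> /= h.
exists [set w | cnt s t w = +oo%E]; split => //.
  rewrite -[LHS]fineK; last exact: fin_num_measure.
  by congr (_%:E); lra.
move=> w /= h1; have [//|[n h2]] := arrival_count_nat s t w.
by exfalso; apply: h1; rewrite h2.
Qed.

End poisson_counts.

Lemma itv_indicE {R : realType} (a b x : R) : (a <= x <= b)%R%:R = \1_`[a, b] x :> R.
Proof.
rewrite indicE; congr ((nat_of_bool _)%:R); apply/idP/idP => [h|/set_mem].
  by apply/mem_set; rewrite /= in_itv.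
by rewrite /= in_itv.
Qed.

Lemma itvoc_indicE {R : realType} (a b x : R) : (a < x <= b)%R%:R = \1_`]a, b] x :> R.
Proof.
rewrite indicE; congr ((nat_of_bool _)%:R); apply/idP/idP => [h|/set_mem].
  by apply/mem_set; rewrite /= in_itv.
by rewrite /= in_itv.
Qed.

(** * Lower step functions and Riemann sums on a grid *)

Section grid.
Context {R : realType}.
Variables (f F : R -> R) (C : R).
Hypothesis C0 : 0 < C.
Hypothesis f0 : forall x, 0 <= f x.
Hypothesis f_ni : forall x y : R, 0 < x -> x <= y -> f y <= f x.
Hypothesis f_cont : forall x : R, 0 < x -> {for x, continuous f}.
(* With F0, this makes F x the integral of 1 - expR (- f) over ]0, x], the exponent of
   the Laplace functional; no integral is needed. *)
Hypothesis dF : forall x : R, 0 < x -> is_derive x 1 F (1 - expR (- f x)).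
Hypothesis F0 : F x @[x --> 0^'+] --> (0 : R).

Let r x := 1 - expR (- f x).

Lemma grid_MVT (x y : R) : 0 < x -> x < y -> (y - x) * r y <= F y - F x <= (y - x) * r x.
Proof.
move=> x0 xy.
have dF' z : z \in `]x, y[ -> is_derive z 1 F (r z).
  by rewrite in_itv/= => /andP[xz _]; apply: dF; rewrite (lt_trans x0).
have cF : {within `[x, y], continuous F}.
  apply: derivable_within_continuous => z; rewrite in_itv/= => /andP[xz _].
  by have [] := dF (lt_le_trans x0 xz).
have [z zxy ->] := MVT xy dF' cF.
move: zxy; rewrite in_itv/= => /andP[xz zy].
rewrite [r z * _]mulrC !ler_pM2l ?subr_gt0//.
rewrite /r !lerD2l !lerN2 !ler_expR !lerN2; apply/andP; split.
  by apply: f_ni; rewrite ?(lt_trans x0)// ltW.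
by apply: f_ni => //; rewrite ltW.
Qed.

Let r_ge0 x : 0 <= r x.
Proof. by rewrite /r subr_ge0 -expR0 ler_expR oppr_le0. Qed.

Lemma grid_F_nd (x y : R) : 0 < x -> x <= y -> F x <= F y.
Proof.
move=> x0; rewrite le_eqVlt => /predU1P[->//|xy].
have /andP[+ _] := grid_MVT x0 xy; rewrite -(subr_ge0 (F x)); apply: le_trans.
by apply: mulr_ge0 => //; rewrite subr_ge0 ltW.
Qed.

(** On the first cell f may blow up at 0 and F is only differentiable to the right of it, so the
    estimate on [x, y] is passed to the limit x -> 0+ by means of [F0]. *)
Lemma grid_F_first (y : R) : 0 < y -> y * r y <= F y.
Proof.
move=> y0.
have h : (y - x) * r y + F x @[x --> 0^'+] --> (y - 0) * r y + 0.
  apply: cvgD => //; apply: cvgMl; apply: cvgB; first exact: cvg_cst.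
  exact/cvg_at_right_filter/cvg_id.
rewrite -[y in y * _]subr0 -[leLHS]addr0.
apply: (cvgr_to_le h); near=> x.
have x0 : 0 < x by near: x; exact: nbhs_right_gt.
have xy : x < y by near: x; exact: nbhs_right_lt.
by rewrite -lerBrDr; have /andP[] := grid_MVT x0 xy.
Unshelve. all: by end_near. Qed.

Variable m : nat.
Definition grid_mesh := C / m.+1%:R.
Definition grid (k : nat) := grid_mesh * k%:R.

Lemma grid_mesh_gt0 : 0 < grid_mesh. Proof. by rewrite divr_gt0. Qed.

Lemma gridS_gt0 k : 0 < grid k.+1.
Proof. by rewrite mulr_gt0 ?grid_mesh_gt0. Qed.

Lemma grid_lt k l : (grid k < grid l) = (k < l)%N.
Proof. by rewrite /grid ltr_pM2l ?grid_mesh_gt0// ltr_nat. Qed.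

Lemma grid_le k l : (grid k <= grid l) = (k <= l)%N.
Proof. by rewrite /grid ler_pM2l ?grid_mesh_gt0// ler_nat. Qed.

Lemma grid_ltS k : grid k < grid k.+1. Proof. by rewrite grid_lt. Qed.

Lemma gridB k : grid k.+1 - grid k = grid_mesh.
Proof. by rewrite /grid -mulrBr -natrB// subSnn mulr1. Qed.

Lemma grid0 : grid 0 = 0. Proof. by rewrite /grid mulr0. Qed.

Lemma grid_last : grid m.+1 = C. Proof. by rewrite /grid divfK. Qed.

Lemma grid_sum_le i : \sum_(k < i.+1) grid_mesh * r (grid k.+1) <= F (grid i.+1).
Proof.
elim: i => [|i ih].
  rewrite big_ord1/=; have := grid_F_first (gridS_gt0 0); rewrite {1}/grid mulr1.
  by [].
rewrite big_ord_recr/= (le_trans (lerD ih (lexx _)))//.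
have /andP[+ _] := grid_MVT (gridS_gt0 i) (grid_ltS i.+1).
by rewrite gridB lerBrDl.
Qed.

(** Read as left-endpoint values, the summands dominate the increments of F one cell later; this is
    why the increment over the first cell is lost. *)
Lemma grid_sum_ge i :
  F (grid i.+1) - F (grid 1) <= \sum_(k < i) grid_mesh * r (grid k.+1).
Proof.
elim: i => [|i ih]; first by rewrite big_ord0 subrr.
rewrite big_ord_recr/= (le_trans _ (lerD ih (lexx _)))//.
have /andP[_] := grid_MVT (gridS_gt0 i) (grid_ltS i.+1).
by rewrite gridB => h; lra.
Qed.

(* Right endpoints make the step function a lower bound of the nonincreasing f. *)
Definition grid_fun x := \sum_(k < m.+1) f (grid k.+1) * (grid k < x <= grid k.+1)%R%:R.

Lemma grid_funE x : 0 < x <= C ->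
  exists2 k, grid k < x <= grid k.+1 & grid_fun x = f (grid k.+1).
Proof.
move=> /andP[x0 xC].
have ex : exists k, x <= grid k.+1 by exists m; rewrite grid_last.
case: (ex_minnP ex) => k xk kmin.
have kx : grid k < x.
  case: k {xk} kmin => [_|k kmin]; first by rewrite grid0.
  by rewrite ltNge; apply/negP => /kmin; rewrite ltnn.
have km : (k < m.+1)%N by rewrite ltnS; apply: kmin; rewrite grid_last.
exists k; first by rewrite kx.
rewrite /grid_fun (bigD1 (Ordinal km))//= kx xk mulr1 big1 ?addr0// => i ik.
case: (boolP (_ < _ <= _)) => [/andP[ix xi]|]; last by rewrite mulr0.
have h1 : (k < i.+1)%N by rewrite -grid_lt (lt_le_trans kx).
have h2 : (i < k.+1)%N by rewrite -grid_lt (lt_le_trans ix).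
move/eqP : ik; case; apply: val_inj; apply/eqP; rewrite /= eqn_leq.
by rewrite ltnS in h1; rewrite ltnS in h2; rewrite h1 h2.
Qed.

Lemma grid_fun_out x : ~~ (0 < x <= C) -> grid_fun x = 0.
Proof.
move=> h; apply: big1 => k _; case: (boolP (_ < _ <= _)) => [/andP[kx xk]|]; last by rewrite mulr0.
exfalso; move/negP : h; apply; apply/andP; split.
  by rewrite (le_lt_trans _ kx)// -grid0 grid_le.
by rewrite (le_trans xk)// -grid_last grid_le.
Qed.

Lemma grid_fun_ge0 x : 0 <= grid_fun x.
Proof. by apply: sumr_ge0 => k _; rewrite mulr_ge0. Qed.

Lemma grid_fun_le x : grid_fun x <= f x * (0 <= x <= C)%R%:R.
Proof.
have [h|h] := boolP (0 < x <= C); last by rewrite grid_fun_out// mulr_ge0.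
have [k /andP[kx xk] ->] := grid_funE h; have /andP[x0 xC] := h.
by rewrite (ltW x0) xC mulr1; exact: f_ni.
Qed.

End grid.

Lemma grid_fun_cvg {R : realType} (f : R -> R) (C x : R) : 0 < C ->
  (forall x : R, 0 < x -> {for x, continuous f}) -> 0 < x ->
  grid_fun f C m x @[m --> \oo] --> f x * (0 <= x <= C)%R%:R.
Proof.
move=> C0 f_cont x0; rewrite (ltW x0)/=.
have [xC|Cx] := leP x C; last first.
  rewrite mulr0; apply: cvg_near_cst; apply: nearW => m.
  by rewrite grid_fun_out// negb_and -!ltNge Cx orbT.
rewrite mulr1; apply/cvgrPdist_le => e e0.
have /cvgrPdist_le/(_ _ e0)[/= eta eta0 feta] := f_cont _ x0.
near=> m.
have xx : 0 < x <= C by rewrite x0.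
have [k /andP[kx xk] ->] := grid_funE f C0 m xx.
apply: feta => /=; rewrite distrC ger0_norm ?subr_ge0//.
have := gridB C m k => gB.
have : grid_mesh C m < eta.
  near: m.
  have h : (C * m.+1%:R^-1 : R) @[m --> \oo] --> (C * 0 : R).
    by apply: cvgMr; exact: cvg_harmonic.
  by rewrite mulr0 in h; move/cvgr_lt : h => /(_ _ eta0).
by move: kx gB; set p := grid _ _ _; set q := grid _ _ _; lra.
Unshelve. all: by end_near. Qed.

(** * Laplace functional over a bounded horizon *)

Section poisson_laplace.
Context {d} {T : measurableType d} {R : realType} (P : probability T R).
Variable G : nat -> {RV P >-> R}.
Hypothesis G_poisson : unit_poisson_arrivals P G.
Variables (f F : R -> R).
Hypothesis f0 : forall x, 0 <= f x.
Hypothesis f_ni : forall x y : R, 0 < x -> x <= y -> f y <= f x.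
Hypothesis f_cont : forall x : R, 0 < x -> {for x, continuous f}.
Hypothesis mf : measurable_fun setT f.
Hypothesis dF : forall x : R, 0 < x -> is_derive x 1 F (1 - expR (- f x)).
Hypothesis F0 : F x @[x --> 0^'+] --> (0 : R).

Lemma bounded_expR_sumN (I : Type) (s : seq I) (h : I -> R -> R) (k : I -> nat) :
  (forall i, measurable_fun setT (h i)) -> (forall i x, 0 <= h i x) ->
  bounded_mfun (fun w => expR (- \sum_(i <- s) h i (G (k i) w))).
Proof.
move=> mh h0; apply: bounded_mfun_expR.
  apply: measurable_funN; apply: measurable_sum => i; exact: measurableT_comp.
by move=> w; rewrite oppr_le0 sumr_ge0.
Qed.

Lemma norm_expRN_le1 (x : R) : 0 <= x -> `|expR (- x)| <= 1.
Proof. by move=> x0; rewrite ger0_norm ?expR_ge0// -expR0 ler_expR oppr_le0. Qed.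

Let ae_G_gt0 : {ae P, forall w, forall j, 0 < G j w}.
Proof.
have [+ _ _] := G_poisson; apply: filterS => w [w0 wS].
by elim => // j /lt_trans; apply; exact: wS.
Qed.

(** For a step function the sum over arrivals is a combination of counts, so [S m n] tends to e^(-I
    m) from above as n grows. Since the steps lie below f, Q n <= S m n; letting m grow in S m n >=
    e^(-I m) >= e^(-F C) gives Q n >= e^(-F C). As I m is close to F C for a fine mesh, Q n is
    enclosed. *)
Lemma poisson_laplace_horizon (C : R) : 0 < C ->
  \int[P]_w expR (- \sum_(j < n) f (G j w) * (0 <= G j w <= C)%R%:R) @[n --> \oo]
  --> expR (- F C).
Proof.
move=> C0.
pose fC x : R := f x * (0 <= x <= C)%R%:R.
pose fm m x : R := grid_fun f C m x.
have mfC : measurable_fun setT fC.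
  apply: measurable_funM => //; rewrite (_ : (fun _ => _) = \1_`[0, C]).
    exact: measurable_indic.
  by apply/funext => x; exact: itv_indicE.
have mfm m : measurable_fun setT (fm m).
  apply: measurable_sum => k; apply: measurable_funM => //.
  rewrite (_ : (fun _ => _) = \1_`]grid C m k, grid C m k.+1]).
    exact: measurable_indic.
  by apply/funext => x; exact: itvoc_indicE.
have fC0 x : 0 <= fC x by rewrite mulr_ge0.
have fm0 m x : 0 <= fm m x by exact: grid_fun_ge0.
pose Q n := \int[P]_w expR (- \sum_(j < n) fC (G j w)).
pose S m n := \int[P]_w expR (- \sum_(j < n) fm m (G j w)).
pose I m := \sum_(k < m.+1) grid_mesh C m * (1 - expR (- f (grid C m k.+1))).
have bQ n : bounded_mfun (fun w => expR (- \sum_(j < n) fC (G j w))).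
  exact: (bounded_expR_sumN _ (h := fun _ => fC)).
have bS m n : bounded_mfun (fun w => expR (- \sum_(j < n) fm m (G j w))).
  exact: (bounded_expR_sumN _ (h := fun _ => fm m)).
pose cf m w := \prod_(k < m.+1) count_factor (f (grid C m k.+1))
  (arrival_count (G : nat -> T -> R) (grid C m k) (grid C m k.+1) w).
have gS m k : grid C m k < grid C m k.+1 by exact: grid_ltS.
have g0 m : 0 <= grid C m 0 by rewrite grid0.
have cfE m : \int[P]_w cf m w = expR (- I m).
  rewrite (Rintegral_prod_count G_poisson _ (g0 m) (gS m) (b := fun k => f (grid C m k.+1)))//.
  by congr (expR (- _)); apply: eq_bigr => k _; rewrite gridB.
have bcf m : bounded_mfun (cf m).
  split; first by apply: measurable_prod => k _; exact: measurable_count_factor.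
  exists 1 => w; rewrite ger0_norm; last by apply: prodr_ge0 => k _; exact: count_factor_ge0.
  rewrite [leRHS](_ : 1 = \prod_(k < m.+1) 1 :> R); last by rewrite big1_eq.
  by apply: ler_prod => k _; rewrite count_factor_ge0 count_factor_le1.
have SE m n w : expR (- \sum_(j < n) fm m (G j w)) =
    \prod_(k < m.+1) expR (- (f (grid C m k.+1) *
      partial_count G n (grid C m k) (grid C m k.+1) w)).
  rewrite -expR_sum sumrN; congr (expR (- _)).
  rewrite exchange_big/=; apply: eq_bigr => k _.
  by rewrite /partial_count big_distrr.
have S_ge m n : expR (- I m) <= S m n.
  rewrite -cfE; apply: bounded_Rintegral_le => // w.
  rewrite SE; apply: ler_prod => k _; rewrite count_factor_ge0/=.
  have := partial_count_le G n (grid C m k) (grid C m k.+1) w.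
  have [->|[i ->]] := arrival_count_nat G (grid C m k) (grid C m k.+1) w.
    by move=> _; exact: expR_ge0.
  by rewrite lee_fin/= ler_expR lerN2 => h; rewrite ler_wpM2l.
have S_cvg m : S m n @[n --> \oo] --> expR (- I m).
  rewrite -cfE; apply: (@bounded_cvg_Rintegral _ _ _ P _ _ 1).
  - by move=> n; case: (bS m n).
  - by case: (bcf m).
  - by move=> n w; apply: norm_expRN_le1; exact: sumr_ge0.
  (* Finiteness matters: at an infinite count with zero weight the partial factors may stay at 1
     whereas [count_factor] is 0. *)
  - have : {ae P, forall w, forall k,
        arrival_count (G : nat -> T -> R) (grid C m k) (grid C m k.+1) w \is a fin_num}.
      apply: ae_foralln => k; apply: ae_arrival_count_fin => //.
      by rewrite (le_trans (g0 m))// grid_le.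
    apply: filterS => w hfin.
    under eq_cvg do rewrite SE.
    apply: cvg_big; first exact: mul_continuous.
    move=> k _; have := @arrival_count_cvg _ _ _ P G (grid C m k) (grid C m k.+1) w.
    rewrite -(fineK (hfin k)) => /fine_cvg/= h.
    apply: (cvg_comp _ expR); last exact: continuous_expR.
    by apply: cvgN; exact: cvgMr.
have I_le m : I m <= F C.
  rewrite -[in leRHS](grid_last C m).
  exact: (grid_sum_le C0 f_ni dF F0).
have I_ge m : F C - F (grid C m 1) <= I m.
  apply: le_trans (grid_sum_ge C0 f_ni dF m m.+1).
  rewrite lerD2r -[in leLHS](grid_last C m).
  by apply: (grid_F_nd f0 f_ni dF); rewrite ?gridS_gt0// grid_le.
have Q_ge n : expR (- F C) <= Q n.
  have h : S m n @[m --> \oo] --> Q n.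
    apply: (@bounded_cvg_Rintegral _ _ _ P _ _ 1).
    - by move=> m; case: (bS m n).
    - by case: (bQ n).
    - by move=> m w; apply: norm_expRN_le1; exact: sumr_ge0.
    - apply: filterS ae_G_gt0 => w Gw.
      apply: (cvg_comp _ expR); last exact: continuous_expR.
      apply: cvgN; apply: cvg_big => [|j _]; first exact: add_continuous.
      exact: grid_fun_cvg.
  apply: (cvgr_to_ge h); apply: nearW => m.
  by rewrite (le_trans _ (S_ge m n))// ler_expR lerN2.
have Q_le m n : Q n <= S m n.
  apply: bounded_Rintegral_le => // w; rewrite ler_expR lerN2; apply: ler_sum => j _.
  exact: grid_fun_le.
apply/cvgrPdist_le => e e0.
have e20 : 0 < e / 2 by rewrite divr_gt0.
(* The mesh is fixed first, and n grows afterwards. The gap between I m and F C is at most F at the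
   first grid point, which tends to 0 by [F0]. *)
have [m hm] : exists m, expR (- I m) <= expR (- F C) + e / 2.
  have h : expR (- (F C - F (grid C m 1))) @[m --> \oo] --> expR (- (F C - 0)).
    apply: (cvg_comp _ expR); last exact: continuous_expR.
    apply: cvgN; apply: cvgB; first exact: cvg_cst.
    apply: (cvg_at_rightP F 0 0).1 => //; split; first by move=> m; exact: gridS_gt0.
    rewrite -[X in _ --> X](mulr0 C) /grid/grid_mesh.
    under eq_cvg do rewrite mulr1.
    by apply: cvgMr; exact: cvg_harmonic.
  rewrite subr0 in h.
  have : expR (- F C) < expR (- F C) + e / 2 by rewrite ltrDl.
  move=> lt1; move/cvgr_le : h => /(_ _ lt1)[N _ hN]; exists N.
  by apply: le_trans (hN N (leqnn N)); rewrite ler_expR lerN2.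
have := S_cvg m; move/cvgrPdist_le => /(_ _ e20) hS.
near=> n.
have hn : `|expR (- I m) - S m n| <= e / 2 by near: n.
rewrite distrC ger0_norm; last by rewrite subr_ge0 -/(Q n).
rewrite -/(Q n) lerBlDr.
have h1 := Q_le m n; have h2 := S_ge m n.
move: hn; rewrite distrC ger0_norm ?subr_ge0// => hn.
lra.
Unshelve. all: by end_near. Qed.

End poisson_laplace.

(** * Laplace functional over the whole half-line *)

Section poisson_laplace_line.
Context {d} {T : measurableType d} {R : realType} (P : probability T R).
Variable G : nat -> {RV P >-> R}.
Hypothesis G_poisson : unit_poisson_arrivals P G.
Variables (f F : R -> R) (Fy : R).
Hypothesis f0 : forall x, 0 <= f x.
Hypothesis f_ni : forall x y : R, 0 < x -> x <= y -> f y <= f x.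
Hypothesis f_cont : forall x : R, 0 < x -> {for x, continuous f}.
Hypothesis mf : measurable_fun setT f.
Hypothesis dF : forall x : R, 0 < x -> is_derive x 1 F (1 - expR (- f x)).
Hypothesis F0 : F x @[x --> 0^'+] --> (0 : R).
Hypothesis FFy : F x @[x --> +oo%R] --> Fy.

(** The enclosure of [poisson_laplace_horizon] again, with the horizon l + 1 in the role of the
    mesh. At fixed n the truncation has no effect once l exceeds the first n arrival times. *)
Lemma poisson_laplace_line :
  \int[P]_w expR (- \sum_(j < n) f (G j w)) @[n --> \oo] --> expR (- Fy).
Proof.
pose g (l : nat) (x : R) : R := f x * (0 <= x <= l.+1%:R)%R%:R.
have mg l : measurable_fun setT (g l).
  apply: measurable_funM => //; rewrite (_ : (fun _ => _) = \1_`[0, l.+1%:R]).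
    exact: measurable_indic.
  by apply/funext => x; exact: itv_indicE.
have g0 l x : 0 <= g l x by rewrite mulr_ge0.
have gf l x : g l x <= f x by rewrite /g ler_piMr// lern1; case: (_ <= _ <= _).
pose Q n := \int[P]_w expR (- \sum_(j < n) f (G j w)).
pose q l n := \int[P]_w expR (- \sum_(j < n) g l (G j w)).
have bQ n : bounded_mfun (fun w => expR (- \sum_(j < n) f (G j w))).
  exact: (bounded_expR_sumN G _ (h := fun _ => f)).
have bq l n : bounded_mfun (fun w => expR (- \sum_(j < n) g l (G j w))).
  exact: (bounded_expR_sumN G _ (h := fun _ => g l)).
have q_cvg l : q l n @[n --> \oo] --> expR (- F l.+1%:R).
  exact: (poisson_laplace_horizon G_poisson f0 f_ni f_cont mf dF F0).
have q_ge l n : expR (- F l.+1%:R) <= q l n.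
  have ni : nonincreasing_seq (q l).
    apply/nonincreasing_seqP => k; apply: bounded_Rintegral_le => // w.
    by rewrite ler_expR lerN2 big_ord_recr/= lerDl.
  rewrite -(cvg_lim (@Rhausdorff R) (q_cvg l)).
  by apply: nonincreasing_cvgn_ge => //; apply/cvg_ex; eexists; exact: q_cvg.
have F_cvg : expR (- F l.+1%:R) @[l --> \oo] --> expR (- Fy).
  apply: (cvg_comp _ expR); last exact: continuous_expR.
  apply: cvgN; apply: (cvg_pinftyP F Fy).1 => //.
  apply/cvgryPge => r; exists (Num.truncn r) => // l /= rl.
  by rewrite (le_trans (ltW (Num.Theory.truncnS_gt _)))// ler_nat ltnS.
have Q_ge n : expR (- Fy) <= Q n.
  have h : q l n @[l --> \oo] --> Q n.
    apply: (@bounded_cvg_Rintegral _ _ _ P _ _ 1).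
    - by move=> l; case: (bq l n).
    - by case: (bQ n).
    - by move=> l w; apply: norm_expRN_le1; exact: sumr_ge0.
    - have [+ _ _] := G_poisson; apply: filterS => w [w0 wS].
      have Gw j : 0 < G j w by elim: j => // j /lt_trans; apply; exact: wS.
      apply: (cvg_comp _ expR); last exact: continuous_expR.
      apply: cvgN; apply: cvg_big => [|j _]; first exact: add_continuous.
      apply: cvg_near_cst; exists (Num.truncn (G j w)) => // l /= jl.
      rewrite /g ltW//= (_ : G j w <= _ = true) ?mulr1//.
      by rewrite (le_trans (ltW (Num.Theory.truncnS_gt _)))// ler_nat ltnS.
  by apply: (ler_cvg_to F_cvg h); apply: nearW.
have Q_le l n : Q n <= q l n.
  apply: bounded_Rintegral_le => // w; rewrite ler_expR lerN2; apply: ler_sum => j _.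
  exact: gf.
apply/cvgrPdist_le => e e0.
have e20 : 0 < e / 2 by rewrite divr_gt0.
have [l hl] : exists l, expR (- F l.+1%:R) <= expR (- Fy) + e / 2.
  have lt1 : expR (- Fy) < expR (- Fy) + e / 2 by rewrite ltrDl.
  by move/cvgr_le : F_cvg => /(_ _ lt1)[N _ hN]; exists N; exact: (hN N (leqnn N)).
have := q_cvg l; move/cvgrPdist_le => /(_ _ e20) hS.
near=> n.
have hn : `|expR (- F l.+1%:R) - q l n| <= e / 2 by near: n.
rewrite distrC ger0_norm; last by rewrite subr_ge0 -/(Q n).
rewrite -/(Q n) lerBlDr.
have h1 := Q_le l n; have h2 := q_ge l n.
move: hn; rewrite distrC ger0_norm ?subr_ge0// => hn.
lra.
Unshelve. all: by end_near. Qed.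

End poisson_laplace_line.

(** * The head of the series as a limit of partial sums *)

Lemma finite_set_nat_bounded (A : set nat) : finite_set A ->
  exists N, forall j, A j -> (j < N)%N.
Proof.
move=> fA; exists (\max_(j <- fset_set A) j).+1 => j Aj; rewrite ltnS.
by apply: (leq_bigmax_seq j (F := id)) => //; rewrite in_fset_set// mem_set.
Qed.

Lemma fsbig_sum_cvg {R : realType} (A : set nat) (f : nat -> R) N :
  (forall j, (N <= j)%N -> A j -> f j = 0) ->
  \sum_(j < n) f j * ((j : nat) \in A)%:R @[n --> \oo] --> \sum_(j \in A) f j.
Proof.
move=> h; apply: cvg_near_cst; exists N => // n /= Nn.
rewrite [RHS]fsbig_mkcond -(@fsbig_widen _ _ _ _ `I_n setT)//.
  rewrite -fsbig_ord; apply: eq_bigr => j _; rewrite patchE.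
  by case: ifPn => _; rewrite ?mulr1// mulr0.
move=> j [_ /= /negP]; rewrite -leqNgt => nj; rewrite patchE; case: ifPn => // /set_mem.
by apply: h; exact: leq_trans nj.
Qed.

Section lepage.
Context {d} {T : measurableType d} {R : realType} (P : probability T R).
Variables (alpha sigma c : R) (W G : nat -> {RV P >-> R}).
Hypothesis G_poisson : unit_poisson_arrivals P G.

Local Notation term w j := (lepage_term alpha (W : nat -> T -> R) (G : nat -> T -> R) w j).
Local Notation head := (lepage_head alpha c (W : nat -> T -> R) (G : nat -> T -> R)).

Let Z j w : R := term w j * (0 <= G j w <= c)%R%:R.

Let ZE j w : Z j w = term w j * (j \in [set j | 0 <= G j w <= c])%:R.
Proof.
rewrite /Z; congr (_ * (nat_of_bool _)%:R); apply/idP/idP => [h|/set_mem//].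
exact/mem_set.
Qed.

Let mZ j : measurable_fun setT (Z j).
Proof.
apply: measurable_funM.
  by apply: measurable_funM => //; exact: (measurableT_comp (measurable_powR _)).
have -> : (fun w => (0 <= G j w <= c)%R%:R) = (\1_`[0, c] \o G j) :> (T -> R).
  by apply/funext => w; exact: itv_indicE.
by apply: measurableT_comp => //; exact: measurable_indic.
Qed.

Let finZ : set T := \bigcup_N \bigcap_(j in [set j | (N <= j)%N]) [set w | Z j w = 0].

Let mfinZ : measurable finZ.
Proof.
apply: bigcupT_measurable => N; apply: bigcap_measurableType => j _.
rewrite (_ : [set _ | _] = setT `&` Z j @^-1` [set 0]); last by rewrite setTI.
exact: mZ.
Qed.

Let head_cvg w : finZ w -> \sum_(j < n) Z j w @[n --> \oo] --> head w.
Proof.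
move=> [N _ hN].
under eq_cvg do under eq_bigr do rewrite ZE.
apply: (fsbig_sum_cvg (N := N)) => j Nj Aj.
by have := hN j Nj; rewrite /= ZE mem_set// mulr1.
Qed.

Let head_out w : ~ finZ w -> head w = 0.
Proof.
move=> hw; apply: fsbig_dflt => /finite_set_nat_bounded[N hN]; apply: hw.
exists N => // j /= Nj; rewrite /Z.
have [->|/eqP tn0] := eqVneq (term w j) 0; first by rewrite mul0r.
case: (boolP (_ <= _ <= _)) => [h|]; last by rewrite mulr0.
by have := hN j (conj h tn0); rewrite ltnNge Nj.
Qed.

(** Off the event [finZ] that the terms eventually vanish, the head is 0 by the convention for sums
    of infinite support. Partial sums times the indicator of [finZ] therefore converge to it
    everywhere. *)
Lemma measurable_lepage_head : measurable_fun setT head.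
Proof.
apply: (measurable_fun_cvg (h := fun n w => (\sum_(j < n) Z j w) * \1_finZ w)).
  move=> n; apply: measurable_funM; last exact: measurable_indic.
  exact: measurable_sum.
move=> w _; have [hw|hw] := pselect (finZ w).
  by rewrite indicE mem_set//; under eq_cvg do rewrite mulr1; exact: head_cvg.
rewrite indicE memNset// head_out//; under eq_cvg do rewrite mulr0; exact: cvg_cst.
Qed.

Hypothesis c0 : 0 < c.

(** The head sums over [0, c] while counts refer to ]0, c]; almost sure positivity of the arrivals
    reconciles the two. *)
Lemma ae_lepage_head_cvg :
  {ae P, forall w, \sum_(j < n) Z j w @[n --> \oo] --> head w}.
Proof.
have [h1 _ _] := G_poisson.
have h2 := ae_arrival_count_fin G_poisson (lexx 0) c0.
apply: (filterS2 _ _ h1 h2) => w [w0 wS] wfin; apply: head_cvg.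
have Gw j : 0 < G j w by elim: j => // j /lt_trans; apply; exact: wS.
have [N hN] : exists N, forall j, 0 < G j w <= c -> (j < N)%N.
  apply: (@finite_set_nat_bounded [set j | 0 < G j w <= c]).
  by move: wfin; rewrite /arrival_count /counting; case: ifPn => // /asboolP.
exists N => // j /= Nj; rewrite /Z; case: (boolP (_ <= _ <= _)) => [/andP[_ h]|].
  by have := hN j; rewrite Gw h => /(_ isT); rewrite ltnNge Nj.
by rewrite mulr0.
Qed.

End lepage.

(** * Characteristic functions of the series and of its head *)

Lemma measurable_sigma_family {d} {T : measurableType d} {R : realType}
    (P : probability T R) (G : nat -> {RV P >-> R}) j :
  measurable_fun
    (setT : set (g_sigma_algebraType (\bigcup_i preimage_set_system setT (G i) measurable)))
    (G j : g_sigma_algebraType (\bigcup_i preimage_set_system setT (G i) measurable) -> R).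
Proof.
move=> _ B mB; apply: sub_sigma_algebra; exists j => //; exists B => //.
Qed.

Section characteristic_functions.
Context {d} {T : measurableType d} {R : realType} (P : probability T R).
Variables (alpha sigma c s : R) (W G : nat -> {RV P >-> R}).
Hypothesis alpha0 : 0 < alpha.
Hypothesis sigma0 : 0 < sigma.
Hypothesis c0 : 0 < c.
Hypothesis G_poisson : unit_poisson_arrivals P G.
Hypothesis W_indep : mutually_independent P W.
Hypothesis W_normal : forall j A, measurable A ->
  distribution P (W j) A = normal_prob 0 sigma A.
Hypothesis WG_indep : independent_families P W G.

Local Notation head := (lepage_head alpha c (W : nat -> T -> R) (G : nat -> T -> R)).

(** Minus the logarithm of the characteristic function, at s, of a mark scaled by x^(-1/alpha). *)
Let f (x : R) : R := (sigma * s) ^+ 2 / 2 * (x `^ (- alpha^-1)) ^+ 2.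

Variables (F : R -> R) (Fy : R).
Hypothesis dF : forall x : R, 0 < x -> is_derive x 1 F (1 - expR (- f x)).
Hypothesis F0 : F x @[x --> 0^'+] --> (0 : R).
Hypothesis FFy : F x @[x --> +oo%R] --> Fy.

Let f0 x : 0 <= f x.
Proof. by rewrite mulr_ge0 ?sqr_ge0// divr_ge0 ?sqr_ge0. Qed.

Let f_ni x y : 0 < x -> x <= y -> f y <= f x.
Proof.
move=> x0 xy; rewrite ler_wpM2l ?divr_ge0 ?sqr_ge0//.
rewrite lerXn2r ?nnegrE ?powR_ge0// !powRN lef_pV2 ?posrE ?powR_gt0// ?(lt_le_trans x0)//.
by rewrite ge0_ler_powR ?invr_ge0 ?nnegrE// ltW// (lt_le_trans x0).
Qed.

Let f_cont x : 0 < x -> {for x, continuous f}.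
Proof.
move=> x0; apply: cvgMr; rewrite expr2.
have : {for x, continuous (fun x : R => x `^ (- alpha^-1))}.
  apply: differentiable_continuous; apply/derivable1_diffP.
  by apply: derivable_powR; rewrite in_itv/= andbT.
by move=> h; apply: cvgM.
Qed.

Let mf : measurable_fun setT f.
Proof. by apply: measurable_funM => //; apply: measurable_funX; exact: measurable_powR. Qed.

(** The weight h serves both sums: it is the indicator of [0, c] for the head and 1 for the full
    series. *)
Let charfun_partial (h : R -> R) n th : measurable_fun setT h ->
  \int[P]_w cos (s * (\sum_(j < n)
    (lepage_term alpha (W : nat -> T -> R) (G : nat -> T -> R) w j * h (G j w))) + th)
  = (\int[P]_w expR (- \sum_(j < n) f (G j w) * h (G j w) ^+ 2)) * cos th.
Proof.
move=> mh.
pose a (j : nat) (w : T) := s * (G j w `^ (- alpha^-1) * h (G j w)).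
transitivity (\int[P]_w (cst 1 w * cos (\sum_(j < n) a j w * W j w + th))).
  apply: eq_Rintegral => w _; rewrite mul1r big_distrr/=; congr (cos (_ + _)).
  by apply: eq_bigr => j _; rewrite /a /lepage_term; ring.
have ma j : measurable_fun (setT : set (g_sigma_algebraType
    (\bigcup_i preimage_set_system setT (G i) measurable))) (a j).
  apply: measurable_funM => //.
  have mG := @measurable_sigma_family _ _ _ P G j.
  by apply: measurable_funM; [exact: (measurableT_comp (measurable_powR _) mG)
    |exact: (measurableT_comp mh mG)].
have b1 : exists M : R, forall w : T, `|cst (1 : R) w| <= M by exists 1 => w; rewrite normr1.
rewrite (Rintegral_cos_mixture sigma0 W_indep W_normal WG_indep n th b1 _ ma)//.
congr (_ * _); apply: eq_Rintegral => w _; rewrite mul1r mulNr big_distrr/=.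
by congr (expR (- _)); apply: eq_bigr => j _; rewrite /a /f; field.
Qed.

Lemma charfun_head th :
  \int[P]_w cos (s * head w + th) = expR (- F c) * cos th.
Proof.
have mi : measurable_fun setT (fun x : R => (0 <= x <= c)%R%:R : R).
  rewrite (_ : (fun _ => _) = \1_`[0, c]); first exact: measurable_indic.
  by apply/funext => x; exact: itv_indicE.
have mh := measurable_lepage_head alpha c W G.
pose S n w := \sum_(j < n) (lepage_term alpha (W : nat -> T -> R) (G : nat -> T -> R) w j
  * (0 <= G j w <= c)%R%:R).
have mS n : measurable_fun setT (S n).
  apply: measurable_sum => j; apply: measurable_funM.
    by apply: measurable_funM => //; exact: (measurableT_comp (measurable_powR _)).
  exact: (measurableT_comp mi).
have lim1 : \int[P]_w cos (s * S n w + th) @[n --> \oo] -->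
    \int[P]_w cos (s * head w + th).
  apply: (@bounded_cvg_Rintegral _ _ _ P _ _ 1).
  - move=> n; apply: measurable_cos_comp; apply: measurable_funD => //.
    exact: measurable_funM.
  - apply: measurable_cos_comp; apply: measurable_funD => //.
    exact: measurable_funM.
  - by move=> n w; exact: norm_cos_le1.
  - apply: filterS (ae_lepage_head_cvg alpha W G_poisson c0) => w hw.
    apply: (cvg_comp _ cos); last exact: continuous_cos.
    by apply: cvgD; [exact: cvgMr|exact: cvg_cst].
have sqb (b : bool) : (b%:R : R) ^+ 2 = b%:R by case: b; rewrite ?expr1n ?expr0n.
have lim2 : \int[P]_w cos (s * S n w + th) @[n --> \oo] --> expR (- F c) * cos th.
  under eq_cvg do rewrite (charfun_partial _ _ mi).
  apply: cvgMl.
  under eq_cvg do under eq_Rintegral do under eq_bigr do rewrite sqb.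
  exact: (poisson_laplace_horizon G_poisson f0 f_ni f_cont mf dF F0).
by rewrite -(cvg_lim (@Rhausdorff R) lim1) (cvg_lim (@Rhausdorff R) lim2).
Qed.

Lemma charfun_series (X : {RV P >-> R}) th :
  {ae P, forall w, series (lepage_term alpha (W : nat -> T -> R) (G : nat -> T -> R) w) @ \oo --> X w} ->
  \int[P]_w cos (s * X w + th) = expR (- Fy) * cos th.
Proof.
move=> hX.
pose S n w := \sum_(j < n) (lepage_term alpha (W : nat -> T -> R) (G : nat -> T -> R) w j * 1).
have mS n : measurable_fun setT (S n).
  apply: measurable_sum => j; apply: measurable_funM => //.
  by apply: measurable_funM => //; exact: (measurableT_comp (measurable_powR _)).
have lim1 : \int[P]_w cos (s * S n w + th) @[n --> \oo] -->
    \int[P]_w cos (s * X w + th).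
  apply: (@bounded_cvg_Rintegral _ _ _ P _ _ 1).
  - move=> n; apply: measurable_cos_comp; apply: measurable_funD => //.
    exact: measurable_funM.
  - apply: measurable_cos_comp; apply: measurable_funD => //.
    exact: measurable_funM.
  - by move=> n w; exact: norm_cos_le1.
  - apply: filterS hX => w hw.
    apply: (cvg_comp _ cos); last exact: continuous_cos.
    apply: cvgD; last exact: cvg_cst.
    apply: cvgMr; move: hw; rewrite /series/= /S.
    by under [X in _ -> X]eq_cvg do (under eq_bigr do rewrite mulr1; rewrite -(big_mkord xpredT)).
have lim2 : \int[P]_w cos (s * S n w + th) @[n --> \oo] --> expR (- Fy) * cos th.
  under eq_cvg do rewrite (charfun_partial (h := cst 1))//.
  apply: cvgMl.
  under eq_cvg do under eq_Rintegral do under eq_bigr do rewrite /= expr1n mulr1.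
  exact: (poisson_laplace_line G_poisson f0 f_ni f_cont mf dF F0 FFy).
by rewrite -(cvg_lim (@Rhausdorff R) lim1) (cvg_lim (@Rhausdorff R) lim2).
Qed.

(** Given Z, the quantity s Z + th is a phase for V, and integrating V leaves a factor free of Z. *)
Lemma charfun_add_normal (Z : T -> R) (V : {RV P >-> R}) (tau phi th : R) : 0 < tau ->
  measurable_fun setT Z ->
  (forall A, measurable A -> distribution P V A = normal_prob 0 tau A) ->
  independent2 P Z V ->
  (forall th, \int[P]_w cos (s * Z w + th) = phi * cos th) ->
  \int[P]_w cos (s * (Z w + V w) + th) = phi * expR (- (tau * s) ^+ 2 / 2) * cos th.
Proof.
move=> tau0 mZ Vn ind hphi.
pose g (p : R * R) := cos (s * p.1 + (s * p.2 + th)).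
have bg : bounded_mfun g.
  apply: bounded_mfun_cos; apply: measurable_funD; first exact: measurable_funM.
  by apply: measurable_funD => //; exact: measurable_funM.
have ind' A B : measurable A -> measurable B ->
    P (Z @^-1` A `&` V @^-1` B) = (P (Z @^-1` A) * normal_prob 0 tau B)%E.
  by move=> mA mB; rewrite ind// -Vn.
have key := @independent_Rintegral _ _ _ _ _ _ _ P (normal_prob 0 tau) _ _ mZ
  (measurable_funPT V) ind' g bg.
transitivity (\int[P]_w g (Z w, V w)).
  by apply: eq_Rintegral => w _; rewrite /g/= mulrDr addrA.
rewrite key.
transitivity (\int[P]_w (expR (- (tau * s) ^+ 2 / 2) * cos (s * Z w + th))).
  apply: eq_Rintegral => w _; rewrite -Rintegral_cos_normal//.
  by apply: eq_Rintegral => v _; rewrite /g/= addrCA.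
rewrite bounded_RintegralZl ?hphi; last first.
  by apply: bounded_mfun_cos; apply: measurable_funD => //; exact: measurable_funM.
by ring.
Qed.

End characteristic_functions.

(** * Incomplete gamma functions *)

Section incomplete_gamma.
Context {R : realType}.
Notation mu := (@lebesgue_measure R).
Variable s : R.
Hypothesis s0 : 0 < s.

Definition gamma_fun (t : R) := t `^ (s - 1) * expR (- t).

Lemma gamma_fun_ge0 t : 0 <= gamma_fun t.
Proof. by rewrite mulr_ge0 ?powR_ge0 ?expR_ge0. Qed.

Lemma measurable_gamma_fun : measurable_fun setT gamma_fun.
Proof.
apply: measurable_funM; first exact: measurable_powR.
by apply: measurableT_comp => //; exact: measurable_funN.
Qed.

Lemma continuous_gamma_fun t : 0 < t -> {for t, continuous gamma_fun}.
Proof.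
move=> t0; apply: differentiable_continuous; apply/derivable1_diffP.
rewrite /gamma_fun; have ? := is_derive1_powR (s - 1) t0.
by [].
Qed.

(** With n the integer part of s, t^(s-1) <= t^(n+1), and e^(t/2) >= (t/2)^(n+1)/(n+1)! yields the
    constant. *)
Lemma gamma_fun_le_expR : exists C : R, forall t, 1 <= t -> gamma_fun t <= C * expR (- (t / 2)).
Proof.
pose n := Num.truncn s.
exists (n.+1`!%:R * 2 ^+ n.+1) => t t1.
have t0 : 0 < t by rewrite (lt_le_trans _ t1).
have h1 : t `^ (s - 1) <= t ^+ n.+1.
  rewrite -powR_mulrn ?(ltW t0)// ler_powR//.
  have := Num.Theory.truncnS_gt s; rewrite -/n => h; apply: ltW.
  by rewrite (lt_trans _ h)// ltrBlDr ltrDl.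
have h2 : t ^+ n.+1 <= n.+1`!%:R * 2 ^+ n.+1 * expR (t / 2).
  have := @expR_ge1Dxn _ (t / 2) n; rewrite divr_ge0 ?(ltW t0)// => /(_ isT) h.
  have f0 : (0 : R) < n.+1`!%:R by rewrite ltr0n fact_gt0.
  rewrite -ler_pdivrMl ?mulr_gt0 ?exprn_gt0//; apply: le_trans h.
  rewrite expr_div_n ler_wpDl// le_eqVlt; apply/orP; left; apply/eqP.
  by field; rewrite !gt_eqF ?exprn_gt0.
apply: (@le_trans _ _ (n.+1`!%:R * 2 ^+ n.+1 * expR (t / 2) * expR (- t))).
  by rewrite ler_wpM2r ?expR_ge0// (le_trans h1).
by rewrite -mulrA -expRD; have -> : t / 2 - t = - (t / 2) by field.
Qed.

Lemma integral_expR_half (C x : R) : 0 <= C ->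
  (\int[mu]_(t in `[x, +oo[) (C * expR (- (t / 2)))%:E = (C * 2 * expR (- (x / 2)))%:E)%E.
Proof.
move=> C0.
pose H (t : R) := - (C * 2 * expR (- (t / 2))).
have dH (t : R) : is_derive t 1 H (C * expR (- (t / 2))).
  by apply: is_derive_eq; rewrite /GRing.scale/=; field.
have cH : continuous H.
  by move=> t; apply: differentiable_continuous; apply/derivable1_diffP.
rewrite (@ge0_continuous_FTC2y _ _ H x 0).
- by rewrite -EFinB sub0r opprK.
- by move=> t _; rewrite mulr_ge0 ?expR_ge0.
- apply: continuous_subspaceT => t; apply: differentiable_continuous; exact/derivable1_diffP.
- rewrite /H -[X in _ --> X]oppr0; apply: cvgN.
  rewrite -[X in _ --> X](mulr0 (C * 2)); apply: cvgMr.
  apply: (cvg_comp (fun t : R => t / 2) (fun t => expR (- t))); last exact: cvgr_expR.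
  by apply/gt0_cvgMly => //; exact: cvg_id.
- by [].
- by apply: cvg_at_right_filter; exact: cH.
- by move=> t _; rewrite derive1E; exact: derive_val.
Qed.

(** For s < 1 the integrand is singular at 0, so ]0, 1] is exhausted by the intervals [1/(n+1), 1],
    on each of which t^s / s is a regular antiderivative. *)
Lemma integral_powR01 :
  (\int[mu]_(t in `]0%R, 1%R]) (t `^ (s - 1))%:E <= s^-1%:E)%E.
Proof.
pose Fs (n : nat) : set R := `[n.+1%:R^-1, 1]%classic.
have U : \bigcup_n Fs n = `]0, 1]%classic.
  apply/seteqP; split => [t [n _]|t].
    by rewrite /Fs /= !in_itv/= => /andP[nt ->]; rewrite (lt_le_trans _ nt).
  rewrite /= in_itv/= => /andP[t0 t1]; exists (Num.truncn t^-1) => //.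
  rewrite /Fs /= in_itv/= t1 andbT invf_ple ?posrE//.
  exact: ltW (Num.Theory.truncnS_gt _).
have nd : nondecreasing_seq Fs.
  apply/nondecreasing_seqP => n; rewrite subsetEset => t.
  rewrite /Fs /= !in_itv/= => /andP[h ->]; rewrite andbT (le_trans _ h)//.
  by rewrite lef_pV2 ?posrE// ler_nat.
have mp : measurable_fun setT (fun t : R => (t `^ (s - 1))%:E).
  by apply/measurable_EFinP; exact: measurable_powR.
have h : (\int[mu]_(t in Fs n) (t `^ (s - 1))%:E)%E @[n --> \oo] -->
    (\int[mu]_(t in \bigcup_n Fs n) (t `^ (s - 1))%:E)%E.
  apply: ge0_nondecreasing_set_cvg_integral => //.
  - by move=> n; exact: measurable_itv.
  - by move=> n; exact: measurable_funTS.
  - by move=> n t _; rewrite lee_fin powR_ge0.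
rewrite -U; apply: (cvge_to_le h); apply: nearW => n.
(* For n = 0 the interval is the single point 1, which the fundamental theorem excludes. *)
have [n0|n1] := eqVneq n 0%N.
  rewrite /Fs n0 invr1 set_itv1 integral_set1 lee_fin invr_ge0; exact: ltW.
have n11 : n.+1%:R^-1 < 1 :> R by rewrite invf_lt1// ltr1n ltnS lt0n.
have ni : (0 : R) < n.+1%:R^-1 by rewrite invr_gt0.
pose H (t : R) := s^-1 * t `^ s.
have dH (t : R) : 0 < t -> is_derive t 1 H (t `^ (s - 1)).
  move=> t0; have ? := is_derive1_powR s t0.
  by apply: is_derive_eq; rewrite /GRing.scale/=; field; rewrite gt_eqF.
have cH t : 0 < t -> {for t, continuous H}.
  by move=> t0; apply: differentiable_continuous; apply/derivable1_diffP; case: (dH _ t0).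
rewrite (@continuous_FTC2 _ _ H)//.
- rewrite -EFinB lee_fin /H powR1 mulr1 gerBl mulr_ge0 ?powR_ge0// invr_ge0; exact: ltW.
- apply: derivable_within_continuous => t; rewrite in_itv/= => /andP[nt _].
  by apply: derivable_powR; rewrite in_itv/= andbT (lt_le_trans ni).
- split.
  + by move=> t; rewrite in_itv/= => /andP[nt _]; case: (dH t (lt_trans ni nt)).
  + by apply: cvg_at_right_filter; exact: cH.
  + by apply: cvg_at_left_filter; exact: cH.
- move=> t; rewrite in_itv/= => /andP[nt _]; rewrite derive1E.
  by have ? := dH t (lt_trans ni nt); exact: derive_val.
Qed.

Lemma gamma_fun_integrable : mu.-integrable `[0, +oo[ (EFin \o gamma_fun).
Proof.
have mg D : measurable_fun D (EFin \o gamma_fun).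
  by apply: measurable_funTS; apply/measurable_EFinP; exact: measurable_gamma_fun.
apply/integrableP; split; first exact: mg.
under eq_integral do rewrite /= ger0_norm ?gamma_fun_ge0//.
rewrite -integral_itv_obnd_cbnd//.
rewrite (@itv_bndbnd_setU _ _ _ (BRight 1))//; last by rewrite bnd_simp.
have disj : [disjoint (`]0, 1] : set R) & `]1, +oo[ ].
  apply/disj_setPS => t [/=]; rewrite !in_itv/= => /andP[_ t1] /andP[].
  by rewrite ltNge t1.
rewrite ge0_integral_setU//=; [|exact: mg|by move=> t _; rewrite lee_fin gamma_fun_ge0].
have [C hC] := gamma_fun_le_expR.
have C0 : 0 <= C.
  have := hC 1 (lexx 1); rewrite -(pmulr_lge0 _ (expR_gt0 (- (1 / 2)))) => h.
  by rewrite (le_trans _ h)// gamma_fun_ge0.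
apply: lte_add_pinfty.
  apply: (@le_lt_trans _ _ (s^-1%:E)); last by rewrite ltry.
  apply: le_trans integral_powR01; apply: ge0_le_integral => //.
  - by move=> t _; rewrite lee_fin gamma_fun_ge0.
  - exact: mg.
  - by apply/measurable_EFinP; apply: measurable_funTS; exact: measurable_powR.
  - move=> t; rewrite /= in_itv/= => /andP[t0 _]; rewrite lee_fin /gamma_fun.
    by rewrite ler_piMr ?powR_ge0// -expR0 ler_expR oppr_le0 ltW.
rewrite integral_itv_obnd_cbnd//.
apply: (@le_lt_trans _ _ (\int[mu]_(t in `[1%R, +oo[) (C * expR (- (t / 2)))%:E)%E); last first.
  by rewrite integral_expR_half// ltry.
apply: ge0_le_integral => //.
- by move=> t _; rewrite lee_fin gamma_fun_ge0.
- exact: mg.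
- apply/measurable_EFinP; apply: measurable_funTS; apply: measurable_funM => //.
  by apply: measurableT_comp => //; apply: measurable_funN; exact: measurable_funM.
- by move=> t; rewrite /= in_itv/= andbT => t1; rewrite lee_fin hC.
Qed.

Let gamma_int (D : set R) : measurable D -> D `<=` `[0, +oo[ ->
  mu.-integrable D (EFin \o gamma_fun).
Proof. by move=> mD D0; apply: integrableS gamma_fun_integrable. Qed.

(** [upper_gamma s 0] is the complete gamma function and stands for it below. *)
Lemma lower_gammaD x : 0 <= x -> lower_gamma s x + upper_gamma s x = upper_gamma s 0.
Proof.
move=> x0.
have h := @Rintegral_itvB R gamma_fun (BLeft 0) (BInfty _ false) x gamma_fun_integrable.
have := h; rewrite !bnd_simp => /(_ x0 isT).
rewrite Rintegral_itv_obnd_cbnd; last first.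
  apply: gamma_int; first exact: measurable_itv.
  by move=> t; rewrite /= !in_itv/= !andbT => xt; rewrite (le_trans x0)// ltW.
move=> e; have e' : upper_gamma s 0 - lower_gamma s x = upper_gamma s x by exact: e.
by rewrite -e' addrC subrK.
Qed.

Lemma lower_gamma_ge0 x : 0 <= lower_gamma s x.
Proof. by apply: Rintegral_ge0 => t _; exact: gamma_fun_ge0. Qed.

Lemma upper_gamma_ge0 x : 0 <= upper_gamma s x.
Proof. by apply: Rintegral_ge0 => t _; exact: gamma_fun_ge0. Qed.

Lemma is_derive_lower_gamma (x : R) : 0 < x ->
  is_derive x 1 (lower_gamma s) (gamma_fun x).
Proof.
move=> x0.
have i : mu.-integrable `[0, x + 1] (EFin \o gamma_fun).
  apply: gamma_int; first exact: measurable_itv.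
  by move=> t; rewrite /= !in_itv/= => /andP[->].
have x1 : x < x + 1 by rewrite ltrDl.
have [h1 h2] := continuous_FTC1_closed x1 i x0 (continuous_gamma_fun x0).
apply: DeriveDef; first exact: h1.
by rewrite -derive1E; exact: h2.
Qed.

Lemma is_derive_upper_gamma (x : R) : 0 < x ->
  is_derive x 1 (upper_gamma s) (- gamma_fun x).
Proof.
move=> x0; have h := is_derive_lower_gamma x0.
have h2 : is_derive x 1 (fun y => upper_gamma s 0 - lower_gamma s y) (- gamma_fun x).
  rewrite -[- _]sub0r; apply: (@is_deriveB _ _ _ (cst _)).
apply: near_eq_is_derive h2 => //.
near=> y.
have y0 : 0 <= y.
  by apply: ltW; near: y; exact: lt_nbhsr.
by rewrite -(lower_gammaD y0) addrAC subrr add0r.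
Unshelve. all: by end_near. Qed.

Lemma lower_gamma_cvg0 : lower_gamma s x @[x --> 0^'+] --> (0 : R).
Proof.
have i : mu.-integrable `[0, 1] (EFin \o gamma_fun).
  apply: gamma_int; first exact: measurable_itv.
  by move=> t; rewrite /= !in_itv/= => /andP[->].
apply: cvg_at_right_filter.
exact: (@parameterized_integral_cvg_left R 0 1 gamma_fun ltr01 i).
Qed.

Lemma upper_gamma_cvg0 : upper_gamma s x @[x --> 0^'+] --> upper_gamma s 0.
Proof.
have h : upper_gamma s 0 - lower_gamma s x @[x --> 0^'+] --> upper_gamma s 0 - 0.
  by apply: cvgB; [exact: cvg_cst|exact: lower_gamma_cvg0].
rewrite subr0 in h; apply: cvg_trans h; apply: near_eq_cvg; near=> x.
have x0 : 0 < x by near: x; exact: nbhs_right_gt.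
by rewrite -(lower_gammaD (ltW x0)) addrAC subrr add0r.
Unshelve. all: by end_near. Qed.

Lemma upper_gamma_cvgy : upper_gamma s x @[x --> +oo%R] --> (0 : R).
Proof.
have [C hC] := gamma_fun_le_expR.
have C0 : 0 <= C.
  have := hC 1 (lexx 1); rewrite -(pmulr_lge0 _ (expR_gt0 (- (1 / 2)))) => h.
  by rewrite (le_trans _ h)// gamma_fun_ge0.
apply: (@squeeze_cvgr _ _ _ _ (cst 0) (fun x => C * 2 * expR (- (x / 2)))).
- near=> x; rewrite upper_gamma_ge0/=.
  have x1 : 1 <= x by near: x; exact: nbhs_pinfty_ge.
  rewrite -lee_fin -integral_expR_half// /upper_gamma /Rintegral.
  have gi : mu.-integrable `[x, +oo[ (EFin \o gamma_fun).
    apply: gamma_int; first exact: measurable_itv.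
    by move=> t; rewrite /= !in_itv/= !andbT => xt; rewrite (le_trans _ xt)// (le_trans _ x1).
  rewrite fineK; last exact: (integrable_fin_num _ gi).
  apply: ge0_le_integral => //.
  + by move=> t _; rewrite lee_fin gamma_fun_ge0.
  + by case/integrableP : gi.
  + apply/measurable_EFinP; apply: measurable_funTS; apply: measurable_funM => //.
    by apply: measurableT_comp => //; apply: measurable_funN; exact: measurable_funM.
  + by move=> t; rewrite /= in_itv/= andbT => t1; rewrite lee_fin hC// (le_trans x1).
- exact: cvg_cst.
- rewrite -[X in _ --> X](mulr0 (C * 2)); apply: cvgMr.
  apply: (cvg_comp (fun t : R => t / 2) (fun t => expR (- t))); last exact: cvgr_expR.
  by apply/gt0_cvgMly => //; exact: cvg_id.
Unshelve. all: by end_near. Qed.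

End incomplete_gamma.

Lemma powRD_gt0 {R : realType} (x p q : R) : 0 < x -> x `^ (p + q) = x `^ p * x `^ q.
Proof. by move=> x0; rewrite powRD// (gt_eqF x0) implybT. Qed.

(** * Inequalities from the sign and the monotonicity of derivatives *)

Section calculus.
Context {R : realType}.
Implicit Types (h dh : R -> R) (x y u : R).

Lemma ge0_is_derive_le h dh x y : x <= y ->
  (forall z : R, x < z < y -> is_derive z 1 h (dh z)) ->
  {within `[x, y], continuous h} ->
  (forall z : R, x < z < y -> 0 <= dh z) -> h x <= h y.
Proof.
rewrite le_eqVlt => /predU1P[->//|xy] dhP ch dh0.
have dhP' z : z \in `]x, y[ -> is_derive z 1 h (dh z) by rewrite in_itv; exact: dhP.
have [z zxy E] := MVT xy dhP' ch.
by rewrite -subr_ge0 E mulr_ge0 ?subr_ge0 ?(ltW xy)//; apply: dh0; rewrite in_itv in zxy.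
Qed.

Lemma ge0_is_derive_oo_le h dh x y : 0 < x -> x <= y ->
  (forall z : R, 0 < z -> is_derive z 1 h (dh z)) ->
  (forall z : R, 0 < z -> 0 <= dh z) -> h x <= h y.
Proof.
move=> x0 xy dhP dh0; apply: (ge0_is_derive_le (dh := dh)) => //.
- by move=> z /andP[xz _]; apply: dhP; rewrite (lt_trans x0).
- apply: derivable_within_continuous => z; rewrite in_itv/= => /andP[xz _].
  by have [] := dhP _ (lt_le_trans x0 xz).
- by move=> z /andP[xz _]; apply: dh0; rewrite (lt_trans x0).
Qed.

(** Pattern of most estimates below: powers need not be differentiable at 0, so comparison starts
    from a right limit at 0 rather than from a value. *)
Lemma ge0_is_derive_cvg0_le h dh l u : 0 < u ->
  (forall z : R, 0 < z -> is_derive z 1 h (dh z)) ->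
  (forall z : R, 0 < z -> 0 <= dh z) -> h x @[x --> 0^'+] --> l -> l <= h u.
Proof.
move=> u0 dhP dh0 hl; apply: (cvgr_to_le hl); near=> x.
have x0 : 0 < x by near: x; exact: nbhs_right_gt.
have xu : x <= u by near: x; exact: nbhs_right_le.
exact: (ge0_is_derive_oo_le x0 xu dhP dh0).
Unshelve. all: by end_near. Qed.

(** The mean value theorem on either side of u gives two slopes, the left one being the larger. *)
Lemma concave_chord h dh x y u : x < y ->
  (forall z : R, x < z < y -> is_derive z 1 h (dh z)) ->
  {within `[x, y], continuous h} ->
  (forall z w : R, x < z -> z <= w -> w < y -> dh w <= dh z) ->
  x <= u <= y ->
  h x + (h y - h x) / (y - x) * (u - x) <= h u.
Proof.
move=> xy dhP ch dni /andP[].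
have yx0 : y - x != 0 by rewrite subr_eq0 gt_eqF.
rewrite le_eqVlt => /predU1P[<- _|xu]; first by rewrite subrr mulr0 addr0.
rewrite le_eqVlt => /predU1P[->|uy]; first by rewrite divfK// addrC subrK.
have [z1 z1P E1] : exists2 z, z \in `]x, u[ & h u - h x = dh z * (u - x).
  apply: MVT => //.
    by move=> z; rewrite in_itv/= => /andP[xz zu]; apply: dhP; rewrite xz (lt_trans zu).
  apply: continuous_subspaceW ch; apply: subset_itvl; rewrite bnd_simp; exact: ltW.
have [z2 z2P E2] : exists2 z, z \in `]u, y[ & h y - h u = dh z * (y - u).
  apply: MVT => //.
    by move=> z; rewrite in_itv/= => /andP[uz zy]; apply: dhP; rewrite zy (lt_trans _ uz).
  apply: continuous_subspaceW ch; apply: subset_itvr; rewrite bnd_simp; exact: ltW.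
move: z1P z2P; rewrite !in_itv/= => /andP[xz1 z1u] /andP[uz2 z2y].
have d12 : dh z2 <= dh z1 by apply: dni => //; rewrite ltW// (lt_trans z1u).
rewrite -lerBrDl mulrAC ler_pdivrMr ?subr_gt0//.
have -> : h y - h x = (h y - h u) + (h u - h x) by ring.
rewrite E1 E2 -subr_ge0.
have -> : dh z1 * (u - x) * (y - x) - (dh z2 * (y - u) + dh z1 * (u - x)) * (u - x)
  = (dh z1 - dh z2) * (y - u) * (u - x) by ring.
by rewrite !mulr_ge0// subr_ge0// ltW.
Qed.

End calculus.

(** * The exponent of the head and the function g *)

Section head_exponent.
Context {R : realType}.
Variable a : R.
Hypotheses (a0 : 0 < a) (a1 : a < 1).

Let s0 : 0 < 1 - a. Proof. by rewrite subr_gt0. Qed.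

(** With it, ln (omega_head c a u) is - c times [head_exponent u]. *)
Definition head_exponent (u : R) := 1 - expR (- u) + u `^ a * upper_gamma (1 - a) u.

Let powRaK u : 0 < u -> u `^ a * u `^ (- a) = 1.
Proof. by move=> u0; rewrite -powRD_gt0// subrr powRr0. Qed.

Let gamma_funE u : gamma_fun (1 - a) u = u `^ (- a) * expR (- u).
Proof. by rewrite /gamma_fun addrAC subrr add0r. Qed.

(** Differentiating the incomplete gamma function gives - u^a u^(-a) e^(-u) = - e^(-u), which
    cancels the derivative of 1 - e^(-u); [is_derive_gfun] rests on the same cancellation. *)
Lemma is_derive_head_exponent (u : R) : 0 < u ->
  is_derive u 1 head_exponent (a * u `^ (a - 1) * upper_gamma (1 - a) u).
Proof.
move=> u0.
have d1 := is_derive1_powR a u0; have d2 := is_derive_upper_gamma s0 u0.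
apply: is_derive_eq; rewrite /GRing.scale/= gamma_funE.
have := powRaK u0; set p := u `^ a; set q := u `^ (- a) => pq.
have -> : p * - (q * expR (- u)) = - (p * q) * expR (- u) by ring.
by rewrite pq; ring.
Qed.

Lemma is_derive_gfun (u : R) : 0 < u ->
  is_derive u 1 (gfun a) (- (a * u `^ (a - 1) * lower_gamma (1 - a) u)).
Proof.
move=> u0.
have d1 := is_derive1_powR a u0; have d2 := is_derive_lower_gamma s0 u0.
apply: is_derive_eq; rewrite /GRing.scale/= gamma_funE.
have := powRaK u0; set p := u `^ a; set q := u `^ (- a) => pq.
have -> : p * (q * expR (- u)) = (p * q) * expR (- u) by ring.
by rewrite pq; ring.
Qed.

(** The difference is a pure power: for u proportional to s^2 it is the stable exponent, of order
    |s|^alpha. *)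
Lemma head_exponent_gfun u : 0 <= u ->
  head_exponent u - gfun a u = u `^ a * upper_gamma (1 - a) 0.
Proof. by move=> u0; rewrite -(lower_gammaD s0 u0) /head_exponent /gfun; ring. Qed.

Let cvg_expN : 1 - expR (- x) @[x --> (0 : R)^'+] --> (0 : R).
Proof.
rewrite -[X in _ --> X](subrr 1); apply: cvgB; first exact: cvg_cst.
rewrite -expR0 -[X in expR X]oppr0; apply: (cvg_comp _ expR); last exact: continuous_expR.
by apply: cvgN; apply: cvg_at_right_filter; exact: cvg_id.
Qed.

Lemma head_exponent_cvg0 : head_exponent x @[x --> 0^'+] --> (0 : R).
Proof.
have h : 1 - expR (- x) + x `^ a * upper_gamma (1 - a) x @[x --> 0^'+] -->
    0 + 0 * upper_gamma (1 - a) 0.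
  by apply: cvgD => //; apply: cvgM; [exact: powR_cvg0|exact: upper_gamma_cvg0].
by rewrite mul0r addr0 in h.
Qed.

Lemma gfun_cvg0 : gfun a x @[x --> 0^'+] --> (0 : R).
Proof.
have h : 1 - expR (- x) - x `^ a * lower_gamma (1 - a) x @[x --> 0^'+] --> (0 - 0 * 0 : R).
  by apply: cvgB => //; apply: cvgM; [exact: powR_cvg0|exact: lower_gamma_cvg0].
by rewrite mul0r subr0 in h.
Qed.

Lemma head_exponent0 : head_exponent 0 = 0.
Proof. by rewrite /head_exponent oppr0 expR0 subrr powR0 ?mul0r ?addr0// gt_eqF. Qed.

Lemma gfun0 : gfun a 0 = 0.
Proof. by rewrite /gfun oppr0 expR0 subrr powR0 ?mul0r ?subr0// gt_eqF. Qed.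

Lemma le_upper_gamma x y : 0 < x -> x <= y -> upper_gamma (1 - a) y <= upper_gamma (1 - a) x.
Proof.
move=> x0 xy; rewrite -lerN2.
apply: (ge0_is_derive_oo_le (h := fun z => - upper_gamma (1 - a) z)
  (dh := gamma_fun (1 - a)) x0 xy).
  move=> z z0; have d := is_derive_upper_gamma s0 z0.
  by rewrite -[gamma_fun _ _]opprK; apply: is_deriveN.
by move=> z _; exact: gamma_fun_ge0.
Qed.

Lemma le_lower_gamma x y : 0 < x -> x <= y -> lower_gamma (1 - a) x <= lower_gamma (1 - a) y.
Proof.
move=> x0 xy; apply: (ge0_is_derive_oo_le (dh := gamma_fun (1 - a)) x0 xy).
  by move=> z z0; exact: is_derive_lower_gamma.
by move=> z _; exact: gamma_fun_ge0.
Qed.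

Lemma le_head_exponent x y : 0 <= x -> x <= y -> head_exponent x <= head_exponent y.
Proof.
have dge0 z : 0 < z -> 0 <= a * z `^ (a - 1) * upper_gamma (1 - a) z.
  by move=> z0; rewrite !mulr_ge0 ?powR_ge0 ?upper_gamma_ge0// ltW.
rewrite le_eqVlt => /predU1P[<-|x0 xy].
  rewrite head_exponent0 le_eqVlt => /predU1P[<-|y0]; first by rewrite head_exponent0.
  exact: (ge0_is_derive_cvg0_le y0 is_derive_head_exponent dge0 head_exponent_cvg0).
exact: (ge0_is_derive_oo_le x0 xy is_derive_head_exponent dge0).
Qed.

Let le_powRa1 x y : 0 < x -> x <= y -> y `^ (a - 1) <= x `^ (a - 1).
Proof.
move=> x0 xy; rewrite -[a - 1]opprB !powRN lef_pV2 ?posrE ?powR_gt0// ?(lt_le_trans x0)//.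
by rewrite ge0_ler_powR ?nnegrE// ltW// (lt_le_trans x0).
Qed.

Lemma within_continuous0 (h dh : R -> R) (x y : R) : 0 <= x -> x < y ->
  (forall z : R, 0 < z -> is_derive z 1 h (dh z)) -> h z @[z --> 0^'+] --> h 0 ->
  {within `[x, y], continuous h}.
Proof.
move=> x0 xy dhP h0.
have ch z : 0 < z -> {for z, continuous h}.
  by move=> /dhP[? _]; apply: differentiable_continuous; exact/derivable1_diffP.
apply/(continuous_within_itvP _ xy); split.
- by move=> z; rewrite in_itv/= => /andP[xz _]; apply: ch; exact: le_lt_trans xz.
- move: x0; rewrite le_eqVlt => /predU1P[<-//|x0].
  by apply: cvg_at_right_filter; exact: ch.
- by apply: cvg_at_left_filter; apply: ch; exact: le_lt_trans xy.
Qed.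

(** Concavity: the derivative is a product of two nonnegative nonincreasing functions, u^(a-1) and
    the upper incomplete gamma function. *)
Lemma head_exponent_chord x y u : 0 <= x -> x < y -> x <= u <= y ->
  head_exponent x + (head_exponent y - head_exponent x) / (y - x) * (u - x)
  <= head_exponent u.
Proof.
move=> x0 xy xuy.
apply: (concave_chord (dh := fun u => a * u `^ (a - 1) * upper_gamma (1 - a) u) xy); last exact: xuy.
- by move=> z /andP[xz _]; apply: is_derive_head_exponent; exact: le_lt_trans xz.
- apply: (within_continuous0 x0 xy is_derive_head_exponent).
  by rewrite head_exponent0; exact: head_exponent_cvg0.
- move=> z w xz zw _; have z0 := le_lt_trans x0 xz.
  rewrite ler_pM ?mulr_ge0 ?powR_ge0 ?upper_gamma_ge0// ?(ltW a0)//.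
    by rewrite ler_wpM2l ?(ltW a0)// le_powRa1.
  exact: le_upper_gamma.
Qed.

Let d_pow (p z : R) : 0 < z -> p != 0 -> is_derive z 1 (fun u => u `^ p / p) (z `^ (p - 1)).
Proof.
move=> z0 p0; have d := is_derive1_powR p z0.
by apply: is_derive_eq; rewrite /GRing.scale/=; field.
Qed.

Let pow_cvg0 (p : R) : 0 < p -> x `^ p / p @[x --> (0 : R)^'+] --> (0 : R).
Proof.
move=> p0; rewrite -[X in _ --> X](mul0r p^-1); apply: cvgMl; exact: powR_cvg0.
Qed.

Lemma lower_gamma_le u : 0 < u -> lower_gamma (1 - a) u <= u `^ (1 - a) / (1 - a).
Proof.
move=> u0; rewrite -subr_ge0.
apply: (ge0_is_derive_cvg0_le (h := fun u => u `^ (1 - a) / (1 - a) - lower_gamma (1 - a) u)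
  (dh := fun z => z `^ (1 - a - 1) - gamma_fun (1 - a) z) u0).
- move=> z z0; apply: is_deriveB; first by apply: d_pow => //; rewrite gt_eqF.
  exact: is_derive_lower_gamma.
- move=> z z0; rewrite subr_ge0 /gamma_fun ler_piMr ?powR_ge0//.
  by rewrite -expR0 ler_expR oppr_le0 ltW.
- rewrite -[X in _ --> X](subrr 0); apply: cvgB; first exact: pow_cvg0.
  exact: lower_gamma_cvg0.
Qed.

Lemma lower_gamma_ge u : 0 < u ->
  u `^ (1 - a) / (1 - a) - u `^ (2 - a) / (2 - a) <= lower_gamma (1 - a) u.
Proof.
have sa : 0 < 2 - a by rewrite subr_gt0 (lt_trans a1)// ltr1n.
move=> u0; rewrite -subr_ge0.
apply: (ge0_is_derive_cvg0_le (h := fun u => lower_gamma (1 - a) u -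
    (u `^ (1 - a) / (1 - a) - u `^ (2 - a) / (2 - a)))
  (dh := fun z => gamma_fun (1 - a) z - (z `^ (1 - a - 1) - z `^ (2 - a - 1))) u0).
- move=> z z0; apply: is_deriveB; first exact: is_derive_lower_gamma.
  by apply: is_deriveB; apply: d_pow => //; rewrite gt_eqF.
- move=> z z0; rewrite /gamma_fun.
  have -> : z `^ (2 - a - 1) = z `^ (1 - a - 1) * z.
    by rewrite -{3}(powRr1 (ltW z0)) -powRD_gt0//; congr (_ `^ _); ring.
  have -> : z `^ (1 - a - 1) * expR (- z) - (z `^ (1 - a - 1) - z `^ (1 - a - 1) * z) =
      z `^ (1 - a - 1) * (expR (- z) - (1 - z)) by ring.
  by rewrite mulr_ge0 ?powR_ge0// subr_ge0 expR_ge1Dx.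
- have h : lower_gamma (1 - a) u - (u `^ (1 - a) / (1 - a) - u `^ (2 - a) / (2 - a))
      @[u --> 0^'+] --> (0 - (0 - 0) : R).
    apply: cvgB; first exact: lower_gamma_cvg0.
    by apply: cvgB; exact: pow_cvg0.
  by rewrite !subr0 in h.
Qed.

(** This is e^(-t) >= e^(-u) for t <= u under the integral; it provides the sign needed for the
    convexity of g. *)
Lemma lower_gamma_ge_expR u : 0 < u ->
  expR (- u) * (u `^ (1 - a) / (1 - a)) <= lower_gamma (1 - a) u.
Proof.
move=> u0; rewrite -subr_ge0.
apply: (ge0_is_derive_cvg0_le
  (h := fun z => lower_gamma (1 - a) z - expR (- z) * (z `^ (1 - a) / (1 - a)))
  (dh := fun z => expR (- z) * (z `^ (1 - a) / (1 - a))) u0).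
- move=> z z0; have d1 := d_pow z0 (lt0r_neq0 s0); have d2 := is_derive_lower_gamma s0 z0.
  apply: is_derive_eq; rewrite /GRing.scale/= /gamma_fun; ring.
- by move=> z _; rewrite mulr_ge0 ?expR_ge0// divr_ge0 ?powR_ge0// ltW.
- have h : lower_gamma (1 - a) z - expR (- z) * (z `^ (1 - a) / (1 - a))
      @[z --> 0^'+] --> (0 - expR (- 0) * 0 : R).
    apply: cvgB; first exact: lower_gamma_cvg0.
    apply: cvgM; last exact: pow_cvg0.
    apply: (cvg_comp _ expR); last exact: continuous_expR.
    by apply: cvgN; apply: cvg_at_right_filter; exact: cvg_id.
  by rewrite mulr0 subr0 in h.
Qed.

Lemma eta_gt0 : 0 < Defs.eta a. Proof. by rewrite divr_gt0. Qed.

(** By [lower_gamma_le], g' = - a u^(a-1) gamma(1-a, u) is at least - a/(1-a) = - 1/eta. *)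
Lemma gfun_ge u : 0 <= u -> - (u / Defs.eta a) <= gfun a u.
Proof.
rewrite le_eqVlt => /predU1P[<-|u0]; first by rewrite gfun0 mul0r oppr0.
rewrite -subr_ge0 opprK.
apply: (ge0_is_derive_cvg0_le (h := fun z => gfun a z + z / Defs.eta a)
  (dh := fun z => - (a * z `^ (a - 1) * lower_gamma (1 - a) z) + (Defs.eta a)^-1) u0).
- move=> z z0; apply: is_deriveD; first exact: is_derive_gfun.
  by apply: is_derive_eq; rewrite /GRing.scale/=; ring.
- move=> z z0; rewrite addrC subr_ge0 /Defs.eta invf_div -mulrA ler_pM2l//.
  apply: (@le_trans _ _ (z `^ (a - 1) * (z `^ (1 - a) / (1 - a)))).
    by rewrite ler_wpM2l ?powR_ge0// lower_gamma_le.
  rewrite mulrA -powRD_gt0//.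
  by rewrite addrA subrK subrr powRr0 mul1r.
- have h : gfun a z + z / Defs.eta a @[z --> 0^'+] --> (0 + 0 / Defs.eta a : R).
    apply: cvgD; first exact: gfun_cvg0.
    by apply: cvgMl; apply: cvg_at_right_filter; exact: cvg_id.
  by rewrite mul0r addr0 in h.
Qed.

(** The bound e^(-t) >= 1 - t, through [lower_gamma_ge], gives g' <= - 1/eta + a u/(2-a);
    integrating produces the constant a/(2 (2-a)). *)
Lemma gfun_le u : 0 <= u -> gfun a u <= - (u / Defs.eta a) + a / (2 * (2 - a)) * u ^+ 2.
Proof.
have sa : 0 < 2 - a by rewrite subr_gt0 (lt_trans a1)// ltr1n.
rewrite le_eqVlt => /predU1P[<-|u0].
  by rewrite gfun0 mul0r oppr0 expr0n/= mulr0 addr0.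
rewrite -subr_ge0.
apply: (ge0_is_derive_cvg0_le
  (h := fun z => - (z / Defs.eta a) + a / (2 * (2 - a)) * z ^+ 2 - gfun a z)
  (dh := fun z => - (Defs.eta a)^-1 + a / (2 - a) * z + (a * z `^ (a - 1) * lower_gamma (1 - a) z)) u0).
- move=> z z0; have d := is_derive_gfun z0.
  apply: is_derive_eq; rewrite /GRing.scale/=; field.
  by rewrite (gt_eqF eta_gt0) (gt_eqF sa).
- move=> z z0; rewrite /Defs.eta invf_div.
  have h := lower_gamma_ge z0.
  have h2 : z `^ (a - 1) * (z `^ (1 - a) / (1 - a) - z `^ (2 - a) / (2 - a)) <=
      z `^ (a - 1) * lower_gamma (1 - a) z by rewrite ler_wpM2l ?powR_ge0.
  have e1 : z `^ (a - 1) * z `^ (1 - a) = 1.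
    by rewrite -powRD_gt0// addrA subrK subrr powRr0.
  have e2 : z `^ (a - 1) * z `^ (2 - a) = z.
    rewrite -powRD_gt0//; have -> : a - 1 + (2 - a) = 1 by ring.
    by rewrite powRr1// ltW.
  have h3 : (1 - a)^-1 - z / (2 - a) <= z `^ (a - 1) * lower_gamma (1 - a) z.
    apply: le_trans h2; rewrite mulrBr !mulrA e1 e2 mul1r.
    by [].
  have h4 : a * ((1 - a)^-1 - z / (2 - a)) <= a * (z `^ (a - 1) * lower_gamma (1 - a) z).
    by rewrite ler_pM2l.
  rewrite -subr_ge0 in h4; apply: le_trans h4 _.
  by rewrite le_eqVlt; apply/orP; left; apply/eqP; ring.
- have h : - (z / Defs.eta a) + a / (2 * (2 - a)) * z ^+ 2 - gfun a z
      @[z --> 0^'+] --> (- (0 / Defs.eta a) + a / (2 * (2 - a)) * 0 ^+ 2 - 0 : R).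
    have idc : z @[z --> (0 : R)^'+] --> (0 : R) by apply: cvg_at_right_filter; exact: cvg_id.
    apply: cvgB; last exact: gfun_cvg0.
    apply: cvgD; first by apply: cvgN; exact: cvgMl.
    by apply: cvgMr; rewrite expr2; apply: cvgM.
  by rewrite mul0r oppr0 expr0n/= mulr0 !addr0 in h.
Qed.

Lemma gbar_lt0 : gbar a < 0.
Proof.
have h := gfun_le ler01; apply: (le_lt_trans h).
have sa : 0 < 2 - a by rewrite subr_gt0 (lt_trans a1)// ltr1n.
rewrite expr1n mulr1 mul1r addrC subr_lt0 /Defs.eta invf_div ltr_pM2l//.
rewrite ltf_pV2 ?posrE ?mulr_gt0//; lra.
Qed.

(** Convexity of g, with g 0 = 0: - g has derivative a z^(a-1) gamma(1-a, z), and z^(a-1) gamma(1-a,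
    z) is the integral of v^(-a) e^(-z v) over v in [0, 1], which decreases in z. *)
Lemma gfun_chord u : 0 <= u <= 1 -> gfun a u <= u * gbar a.
Proof.
move=> u01; rewrite -lerN2 -mulrN.
pose h z := - gfun a z.
have dh (z : R) : 0 < z -> is_derive z 1 h (a * (z `^ (a - 1) * lower_gamma (1 - a) z)).
  move=> z0; rewrite mulrA -[X in is_derive _ _ _ X]opprK; apply: is_deriveN.
  exact: is_derive_gfun.
have h0 : h z @[z --> 0^'+] --> h 0.
  by rewrite /h gfun0; apply: cvgN; exact: gfun_cvg0.
have hz : h 0 = 0 by rewrite /h gfun0 oppr0.
have E (y v : R) : 0 + (y - 0) / (1 - 0) * (v - 0) = v * y.
  by rewrite !subr0 divr1 add0r mulrC.
have -> : u * - gbar a = h 0 + (h 1 - h 0) / (1 - 0) * (u - 0) by rewrite hz E.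
apply: (@concave_chord _ h (fun z => a * (z `^ (a - 1) * lower_gamma (1 - a) z))
  0 1 u ltr01); last exact: u01.
- by move=> z /andP[z0 _]; exact: dh.
- exact: (within_continuous0 (lexx 0) ltr01 dh h0).
move=> z w z0 zw _; rewrite ler_pM2l//.
(* That monotonicity is checked by differentiation, the sign coming from [lower_gamma_ge_expR]. *)
pose k z := - (z `^ (a - 1) * lower_gamma (1 - a) z).
rewrite -lerN2 -/(k z) -/(k w).
apply: (ge0_is_derive_oo_le (h := k)
  (dh := fun z => z `^ (a - 1 - 1) *
     ((1 - a) * (lower_gamma (1 - a) z - expR (- z) * (z `^ (1 - a) / (1 - a))))) z0 zw).
- move=> {z0 zw}z z0; have d1 := is_derive1_powR (a - 1) z0; have d2 := is_derive_lower_gamma s0 z0.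
  apply: is_derive_eq; rewrite /GRing.scale/= /gamma_fun.
  have e1 : z `^ (a - 1) * z `^ (1 - a - 1) = z `^ (a - 1 - 1) * z `^ (1 - a).
    by rewrite -!powRD_gt0//; congr (_ `^ _); ring.
  have -> : z `^ (a - 1) * (z `^ (1 - a - 1) * expR (- z)) =
     z `^ (a - 1 - 1) * z `^ (1 - a) * expR (- z) by rewrite mulrA e1.
  by field; rewrite gt_eqF.
- move=> {z0 zw}z z0; rewrite !mulr_ge0 ?powR_ge0//; first exact: ltW.
  by rewrite subr_ge0 lower_gamma_ge_expR.
Qed.

(** Freezing the terms one by one fails, since 1 - e^(-u) increases. Both sides agree at 1, however,
    and their difference has derivative a z^(a-1) (gamma(1-a, z) - gamma(1-a, 1)) >= 0. *)
Lemma gfun_tail u : 1 <= u -> gfun a u <= 1 - expR (- 1) - u `^ a * gammabar a.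
Proof.
move=> u1; rewrite -subr_ge0.
pose h z := 1 - expR (- 1) - z `^ a * gammabar a - gfun a z.
have h1 : h 1 = 0 by rewrite /h /gfun /gammabar; ring.
rewrite -[X in X <= _]h1 -/(h u).
have dh (z : R) : 0 < z -> is_derive z 1 h
    (a * z `^ (a - 1) * (lower_gamma (1 - a) z - gammabar a)).
  move=> z0; have d1 := is_derive1_powR a z0; have d2 := is_derive_gfun z0.
  by apply: is_derive_eq; rewrite /GRing.scale/=; ring.
apply: (ge0_is_derive_le (dh := fun z => a * z `^ (a - 1) * (lower_gamma (1 - a) z - gammabar a)) u1).
- by move=> z /andP[z1 _]; apply: dh; rewrite (lt_trans _ z1).
- apply: derivable_within_continuous => z; rewrite in_itv/= => /andP[z1 _].
  by have [] := dh z (lt_le_trans ltr01 z1).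
- move=> z /andP[z1 _]; rewrite !mulr_ge0 ?powR_ge0 ?(ltW a0)// subr_ge0.
  by apply: le_lower_gamma => //; exact: ltW.
Qed.

Lemma gammabar_gt0 : 0 < gammabar a.
Proof.
have := lower_gamma_ge_expR ltr01; apply: lt_le_trans.
by rewrite mulr_gt0 ?expR_gt0// divr_gt0// powR_gt0.
Qed.

End head_exponent.

(** * Closed form of the Laplace exponent of the arrivals *)

Section laplace_exponent.
Context {R : realType}.
Variables (alpha lam : R).
Hypotheses (alpha0 : 0 < alpha) (alpha2 : alpha < 2) (lam0 : 0 < lam).

Let a := alpha / 2.

Let a0 : 0 < a. Proof. by rewrite divr_gt0. Qed.
Let a1 : a < 1. Proof. by rewrite ltr_pdivrMr// mul1r. Qed.
Let s0 : 0 < 1 - a. Proof. by rewrite subr_gt0. Qed.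

Definition scale_fun (x : R) : R := lam * (x `^ (- alpha^-1)) ^+ 2.

(** Integration by parts of 1 - e^(-f) over ]0, x], with f = [scale_fun]: the remaining integral of
    y f'(y) e^(-f(y)) becomes an upper gamma function, because y = lam^a f(y)^(-a). *)
Definition laplace_exponent (x : R) : R :=
  x * (1 - expR (- scale_fun x)) + lam `^ a * upper_gamma (1 - a) (scale_fun x).

Lemma scale_funE x : 0 < x -> scale_fun x = lam * x `^ (- a^-1).
Proof.
move=> x0; rewrite /scale_fun expr2 -powRD_gt0//; congr (_ * _ `^ _).
by rewrite /a; field; rewrite gt_eqF.
Qed.

Lemma scale_fun_gt0 x : 0 < x -> 0 < scale_fun x.
Proof. by move=> x0; rewrite scale_funE// mulr_gt0// powR_gt0. Qed.

Lemma scale_fun_powRN x : 0 < x -> lam `^ a * scale_fun x `^ (- a) = x.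
Proof.
move=> x0; rewrite scale_funE// powRM ?powR_ge0 ?(ltW lam0)//.
rewrite mulrA -powRD_gt0// subrr powRr0 mul1r -powRrM.
by rewrite mulrNN mulVf ?powRr1 ?ltW// gt_eqF.
Qed.

Lemma scale_fun_powR x : 0 < x -> x * scale_fun x `^ a = lam `^ a.
Proof.
move=> x0; have q0 := scale_fun_gt0 x0; have E := scale_fun_powRN x0.
rewrite -[x in x * _]E -mulrA -powRD_gt0//.
by rewrite addrC subrr powRr0 mulr1.
Qed.

Lemma is_derive_laplace_exponent (x : R) : 0 < x ->
  is_derive x 1 laplace_exponent (1 - expR (- scale_fun x)).
Proof.
move=> x0.
have d1 := is_derive1_powR (- alpha^-1) x0.
have [d df] : exists d : R, is_derive x (1 : R) scale_fun d.
  exists ('D_1 scale_fun x); apply: derivableP.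
  have h : is_derive x (1 : R) scale_fun
      (lam * (x `^ (- alpha^-1) * (- alpha^-1 * x `^ (- alpha^-1 - 1)) *+ 2)).
    by apply: is_derive_eq; rewrite /GRing.scale/=; ring.
  by case: h.
have dU := is_derive_upper_gamma s0 (scale_fun_gt0 x0).
have dUf : is_derive x 1 (upper_gamma (1 - a) \o scale_fun)
    (- gamma_fun (1 - a) (scale_fun x) * d).
  exact: is_derive1_comp.
have -> : laplace_exponent = (fun x => x * (1 - expR (- scale_fun x)) +
    lam `^ a * (upper_gamma (1 - a) \o scale_fun) x) by [].
have gE y : gamma_fun (1 - a) y = y `^ (- a) * expR (- y).
  by rewrite /gamma_fun addrAC subrr add0r.
apply: is_derive_eq; rewrite /GRing.scale/= gE.
have := scale_fun_powRN x0.
set p := lam `^ a; set q := scale_fun x `^ (- a); set e := expR _ => pq.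
have -> : p * (- (q * e) * d) = - ((p * q) * e * d) by ring.
by rewrite pq; ring.
Qed.

Lemma scale_fun_cvgy : scale_fun x @[x --> 0^'+] --> +oo%R.
Proof.
apply/cvgryPge => r.
pose M := `|r| + 1.
have M0 : 0 < M by rewrite ltr_wpDl.
have d0 : 0 < (lam / M) `^ a by rewrite powR_gt0// divr_gt0.
near=> x.
have x0 : 0 < x by near: x; exact: nbhs_right_gt.
have xd : x <= (lam / M) `^ a by near: x; exact: nbhs_right_le.
apply: (@le_trans _ _ M); first by rewrite /M (le_trans (ler_norm r))// lerDl.
rewrite scale_funE// powRN ler_pdivlMr ?powR_gt0//.
rewrite mulrC -ler_pdivlMr//.
have := @ge0_ler_powR _ a^-1 _ x ((lam / M) `^ a).
rewrite invr_ge0 (ltW a0) !nnegrE (ltW x0) powR_ge0 => /(_ isT isT isT xd).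
by rewrite -powRrM mulfV ?gt_eqF// powRr1// divr_ge0 ?ltW.
Unshelve. all: by end_near. Qed.

Lemma laplace_exponent_cvg0 : laplace_exponent x @[x --> 0^'+] --> (0 : R).
Proof.
have idc : x @[x --> (0 : R)^'+] --> (0 : R) by apply: cvg_at_right_filter; exact: cvg_id.
have h : x * (1 - expR (- scale_fun x)) + lam `^ a * upper_gamma (1 - a) (scale_fun x)
    @[x --> (0 : R)^'+] --> (0 + lam `^ a * 0 : R).
  apply: cvgD; last first.
    apply: cvgMr; apply: (cvg_comp scale_fun (upper_gamma (1 - a))).
      exact: scale_fun_cvgy.
    exact: upper_gamma_cvgy.
  apply: (@squeeze_cvgr _ _ _ _ (cst 0) idfun) => //; last exact: cvg_cst.
  near=> x.
  have x0 : 0 < x by near: x; exact: nbhs_right_gt.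
  rewrite mulr_ge0 ?(ltW x0)//=.
    by rewrite ler_piMr ?(ltW x0)// gerBl expR_ge0.
  by rewrite subr_ge0 -expR0 ler_expR oppr_le0 ltW// scale_fun_gt0.
by rewrite mulr0 addr0 in h.
Unshelve. all: by end_near. Qed.

Lemma powRN_cvgy0 (q : R) : 0 < q -> x `^ (- q) @[x --> +oo%R] --> (0 : R).
Proof.
move=> q0; apply/cvgrPdist_le => e e0.
have d0 : 0 < e^-1 `^ q^-1 by rewrite powR_gt0// invr_gt0.
near=> x.
have xd : e^-1 `^ q^-1 <= x by near: x; exact: nbhs_pinfty_ge.
have x0 : 0 < x by exact: lt_le_trans xd.
rewrite sub0r normrN ger0_norm ?powR_ge0// powRN invf_ple ?posrE ?powR_gt0//.
have := @ge0_ler_powR _ q _ (e^-1 `^ q^-1) x.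
rewrite (ltW q0) !nnegrE (ltW x0) powR_ge0 => /(_ isT isT isT xd).
by rewrite -powRrM mulVf ?gt_eqF// powRr1// invr_ge0 ltW.
Unshelve. all: by end_near. Qed.

(** The first term is at most x * scale_fun x = lam x^(1 - 1/a), which vanishes because a < 1; in
    the second, [scale_fun] tends to 0 and the upper gamma function becomes complete. *)
Lemma laplace_exponent_cvgy :
  laplace_exponent x @[x --> +oo%R] --> lam `^ a * upper_gamma (1 - a) 0.
Proof.
have q0 : 0 < (1 - a) / a by rewrite divr_gt0.
have pc := powRN_cvgy0 q0.
have h1 : x * (1 - expR (- scale_fun x)) @[x --> +oo%R] --> (0 : R).
  apply: (@squeeze_cvgr _ _ _ _ (cst 0) (fun x => lam * x `^ (- ((1 - a) / a)))).
  - near=> x.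
    have x0 : 0 < x by near: x; exact: nbhs_pinfty_gt.
    rewrite mulr_ge0 ?(ltW x0)//=; last first.
      by rewrite subr_ge0 -expR0 ler_expR oppr_le0 ltW// scale_fun_gt0.
    apply: (@le_trans _ _ (x * scale_fun x)).
      rewrite ler_pM2l// lerBlDl -lerBlDr; have := expR_ge1Dx (- scale_fun x); lra.
    rewrite scale_funE// mulrCA -{1}(powRr1 (ltW x0)) -powRD_gt0//.
    rewrite le_eqVlt; apply/orP; left; apply/eqP; congr (_ * _ `^ _).
    by field; rewrite gt_eqF.
  - exact: cvg_cst.
  - by rewrite -[X in _ --> X](mulr0 lam); apply: cvgMr.
have h2 : lower_gamma (1 - a) (scale_fun x) @[x --> +oo%R] --> (0 : R).
  apply: (@squeeze_cvgr _ _ _ _ (cst 0)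
    (fun x => lam `^ (1 - a) / (1 - a) * x `^ (- ((1 - a) / a)))).
  - near=> x.
    have x0 : 0 < x by near: x; exact: nbhs_pinfty_gt.
    rewrite lower_gamma_ge0/= (le_trans (lower_gamma_le a1 (scale_fun_gt0 x0)))//.
    rewrite scale_funE// powRM ?powR_ge0 ?(ltW lam0)// -powRrM.
    have -> : - a^-1 * (1 - a) = - ((1 - a) / a) by field; rewrite gt_eqF.
    by rewrite mulrAC.
  - exact: cvg_cst.
  - rewrite -[X in _ --> X](mulr0 (lam `^ (1 - a) / (1 - a))); exact: cvgMr.
have h : x * (1 - expR (- scale_fun x)) +
    lam `^ a * (upper_gamma (1 - a) 0 - lower_gamma (1 - a) (scale_fun x))
    @[x --> +oo%R] --> 0 + lam `^ a * (upper_gamma (1 - a) 0 - 0).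
  apply: cvgD => //; apply: cvgMr; apply: cvgB => //; exact: cvg_cst.
rewrite add0r subr0 in h; apply: cvg_trans h; apply: near_eq_cvg; near=> x.
have x0 : 0 < x by near: x; exact: nbhs_pinfty_gt.
rewrite /laplace_exponent -(lower_gammaD s0 (ltW (scale_fun_gt0 x0))).
by rewrite addrAC subrr add0r.
Unshelve. all: by end_near. Qed.

Lemma laplace_exponentE x : 0 < x ->
  laplace_exponent x = x * head_exponent a (scale_fun x).
Proof.
move=> x0; rewrite /head_exponent mulrDr mulrA; congr (_ + _ * _).
by rewrite scale_fun_powR.
Qed.

(** The exponent of the full series is written relative to a cut x; at x = c it shares the term c *
    head_exponent with the exponent of the head. *)
Lemma laplace_exponent_infE x : 0 < x ->
  lam `^ a * upper_gamma (1 - a) 0 =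
  x * head_exponent a (scale_fun x) - x * gfun a (scale_fun x).
Proof.
move=> x0; rewrite -mulrBr head_exponent_gfun//; last exact: ltW (scale_fun_gt0 x0).
rewrite mulrA; congr (_ * _).
by rewrite scale_fun_powR.
Qed.

End laplace_exponent.

(** * Integrating the envelope *)

Section pointwise_bound.
Context {R : realType}.
Variables (a c : R).
Hypotheses (a0 : 0 < a) (a1 : a < 1) (c1 : 1 < c).

Let c0 : 0 < c. Proof. exact: lt_trans c1. Qed.
Let cm1 : 0 <= c - 1. Proof. by rewrite subr_ge0 ltW. Qed.

Definition envelope (v : R) := expR (- (c * head_exponent a v) + (c - 1) * gfun a v).

Lemma gfun_le0 u : 0 <= u -> gfun a u <= 0.
Proof.
rewrite le_eqVlt => /predU1P[<-|u0]; first by rewrite gfun0.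
rewrite -oppr_ge0.
apply: (ge0_is_derive_cvg0_le (h := fun z => - gfun a z)
  (dh := fun z => a * z `^ (a - 1) * lower_gamma (1 - a) z) u0).
- move=> z z0; rewrite -[X in is_derive _ _ _ X]opprK; apply: is_deriveN.
  exact: is_derive_gfun.
- by move=> z z0; rewrite !mulr_ge0 ?powR_ge0 ?lower_gamma_ge0// ltW.
- rewrite -[X in _ --> X]oppr0; apply: cvgN; exact: gfun_cvg0.
Qed.

(** Factoring out e^(c g) leaves 1 - e^(-c (g + u/eta)) <= c (g + u/eta), which [gfun_le] bounds by
    a multiple of u^2. Since g <= 0, e^(c g) is then relaxed to e^((c-1) g). *)
Lemma tail_gauss_le u : 0 <= u ->
  `|expR (- (c * head_exponent a u - c * gfun a u)) -
    expR (- (c * head_exponent a u)) * expR (- (c * u / Defs.eta a))| <=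
  c * (a / (2 * (2 - a))) * u ^+ 2 * envelope u.
Proof.
move=> u0; have gl := gfun_le a0 a1 u0; have gg := gfun_ge a0 a1 u0; have gn := gfun_le0 u0.
have K0 : 0 <= c * (a / (2 * (2 - a))) * u ^+ 2.
  have sa : 0 < 2 - a by rewrite subr_gt0 (lt_trans a1)// ltr1n.
  rewrite mulr_ge0 ?sqr_ge0// mulr_ge0 ?(ltW c0)// divr_ge0 ?(ltW a0)//.
  by rewrite mulr_ge0// ltW.
have -> : expR (- (c * head_exponent a u - c * gfun a u)) -
    expR (- (c * head_exponent a u)) * expR (- (c * u / Defs.eta a)) =
    expR (- (c * head_exponent a u)) * expR (c * gfun a u) *
     (1 - expR (- (c * (gfun a u + u / Defs.eta a)))).
  rewrite [RHS]mulrBr mulr1 -mulrA -!expRD; congr (expR _ - expR _); ring.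
have d0 : 0 <= gfun a u + u / Defs.eta a by rewrite -lerBlDr sub0r.
rewrite ger0_norm; last first.
  rewrite !mulr_ge0 ?expR_ge0// subr_ge0 -expR0 ler_expR oppr_le0.
  by rewrite mulr_ge0// ltW.
apply: (@le_trans _ _ (expR (- (c * head_exponent a u)) * expR (c * gfun a u) *
    (c * (a / (2 * (2 - a))) * u ^+ 2))).
  rewrite ler_wpM2l ?mulr_ge0 ?expR_ge0//.
  apply: (@le_trans _ _ (c * (gfun a u + u / Defs.eta a))).
    have := expR_ge1Dx (- (c * (gfun a u + u / Defs.eta a))); lra.
  rewrite -mulrA ler_pM2l//; lra.
rewrite mulrC ler_wpM2l// /envelope -expRD ler_expR lerD2l mulrBl mul1r.
by rewrite lerDl oppr_ge0.
Qed.

Lemma envelope_piece (x y u m : R) : 0 <= x -> x < y -> y <= 1 -> x <= u <= y ->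
  m = (- (c * head_exponent a y) - - (c * head_exponent a x)) / (y - x) ->
  envelope u <= expR (- m * x + - (c * head_exponent a x) +
    (m + (c - 1) * gbar a) * u).
Proof.
move=> x0 xy y1 xuy mE; rewrite ler_expR.
have h1 := head_exponent_chord a0 a1 x0 xy xuy.
have [xu uy] := andP xuy.
have h2 : gfun a u <= u * gbar a.
  by apply: gfun_chord => //; rewrite (le_trans x0)//= (le_trans uy).
have h3 : (c - 1) * gfun a u <= (c - 1) * (u * gbar a) by rewrite ler_wpM2l.
have h4 : c * (head_exponent a x +
    (head_exponent a y - head_exponent a x) / (y - x) * (u - x)) <= c * head_exponent a u.
  by rewrite ler_pM2l.
have E : - m * x + - (c * head_exponent a x) + (m + (c - 1) * gbar a) * u =
  - (c * (head_exponent a x + (head_exponent a y - head_exponent a x) / (y - x) * (u - x)))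
    + (c - 1) * (u * gbar a).
  by rewrite mE; field; rewrite subr_eq0 gt_eqF.
by rewrite E lerD// lerN2.
Qed.

(** The head exponent is replaced by its value at 1, being nondecreasing; all the decay comes from g
    through [gfun_tail]. *)
Lemma envelope_tail u : 1 <= u -> envelope u <= expR (kttail c a - lttail c a * u `^ a).
Proof.
move=> u1; rewrite ler_expR.
have h1 : c * head_exponent a 1 <= c * head_exponent a u.
  by rewrite ler_pM2l// le_head_exponent.
have h2 : (c - 1) * gfun a u <= (c - 1) * (1 - expR (- 1) - u `^ a * gammabar a).
  by rewrite ler_wpM2l// gfun_tail.
have E : kttail c a - lttail c a * u `^ a =
    - (c * head_exponent a 1) + (c - 1) * (1 - expR (- 1) - u `^ a * gammabar a).
  by rewrite /kttail /ktail /lttail /head_exponent powR1; ring.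
by rewrite E lerD// lerN2.
Qed.

Lemma continuous_envelope (u : R) : 0 < u -> {for u, continuous envelope}.
Proof.
move=> u0; apply: differentiable_continuous; apply/derivable1_diffP.
have d1 := is_derive_head_exponent a1 u0; have d2 := is_derive_gfun a1 u0.
by rewrite /envelope.
Qed.

End pointwise_bound.

(** * Explicit integrals of the majorants *)

Section antiderivatives.
Context {R : realType}.
Notation mu := (@lebesgue_measure R).

(** With y = k s^2 one has k^2 s^3 ds = y dy / 2, and [H] is the antiderivative of y e^(q + m y). *)
Lemma integral_piece (k q m sx sy : R) : m != 0 -> sx < sy ->
  let H u := expR q / m * (expR (m * u) * (u - m^-1)) in
  (\int[mu]_(s in `[sx, sy]) (k ^+ 2 * s ^+ 3 * expR (q + m * (k * s ^+ 2)))%:E =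
    ((H (k * sy ^+ 2) - H (k * sx ^+ 2)) / 2)%:E)%E.
Proof.
move=> m0 sxy H.
pose F (s : R) := H (k * s ^+ 2) / 2.
have dF (s : R) : is_derive s 1 F (k ^+ 2 * s ^+ 3 * expR (q + m * (k * s ^+ 2))).
  apply: is_derive_eq; rewrite /GRing.scale/= expRD.
  by field; rewrite m0.
have cF : continuous F.
  by move=> s; apply: differentiable_continuous; apply/derivable1_diffP.
rewrite (@continuous_FTC2 _ _ F)//.
- by rewrite -EFinB /F -mulrBl.
- by apply: continuous_subspaceT => s; apply: differentiable_continuous; exact/derivable1_diffP.
- split => //; first by apply: cvg_at_right_filter; exact: cF.
  by apply: cvg_at_left_filter; exact: cF.
- by move=> s _; rewrite derive1E; have ? := dF s; exact: derive_val.
Qed.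

(** With y = k s^2 and then w = l y^a, y e^(-l y^a) dy becomes w^(2/a - 1) e^(-w) dw / (a
    l^(2/a)). *)
Lemma integral_tail (a k kt l s1 : R) : 0 < a -> 0 < k -> 0 < l -> 0 < s1 ->
  (\int[mu]_(s in `[s1, +oo[) (k ^+ 2 * s ^+ 3 * expR (kt - l * (k * s ^+ 2) `^ a))%:E =
    (expR kt / (a * l `^ (2 / a)) * upper_gamma (2 / a) (l * (k * s1 ^+ 2) `^ a) / 2)%:E)%E.
Proof.
move=> a0 k0 l0 s10.
have a20 : 0 < 2 / a by rewrite divr_gt0.
pose C := expR kt / (a * l `^ (2 / a)).
pose w (s : R) := l * (k * s ^+ 2) `^ a.
pose F (s : R) := - (C / 2) * (upper_gamma (2 / a) \o w) s.
have y0 (s : R) : 0 < s -> 0 < k * s ^+ 2 by move=> s0; rewrite mulr_gt0// exprn_gt0.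
have w0 (s : R) : 0 < s -> 0 < w s by move=> s0; rewrite mulr_gt0// powR_gt0// y0.
have dw (s : R) : 0 < s -> is_derive s 1 w (l * (a * (k * s ^+ 2) `^ (a - 1) * (k * s *+ 2))).
  move=> s0.
  have d1 : is_derive s (1 : R) (fun s : R => k * s ^+ 2) (k * s *+ 2).
    by apply: is_derive_eq; rewrite /GRing.scale/=; ring.
  have d2 := @is_derive1_comp R (fun x : R => x `^ a) (fun s : R => k * s ^+ 2) s _ _
    (is_derive1_powR a (y0 s s0)) d1.
  have -> : w = (fun s => l * ((fun x : R => x `^ a) \o (fun s : R => k * s ^+ 2)) s) by [].
  by apply: is_derive_eq; rewrite /GRing.scale/=; ring.
pose f (s : R) := k ^+ 2 * s ^+ 3 * expR (kt - w s).
have dF (s : R) : 0 < s -> is_derive s 1 F (f s).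
  move=> s0.
  have d3 := @is_derive1_comp R (upper_gamma (2 / a)) w s _ _ (is_derive_upper_gamma a20 (w0 s s0)) (dw s s0).
  rewrite /F; apply: is_derive_eq; rewrite /GRing.scale/= /f /gamma_fun /C expRD.
  set y := k * s ^+ 2; have y1 : 0 < y by exact: y0.
  (* The Jacobian of this substitution: w^(2/a - 1) dw = a l^(2/a) y dy. *)
  have E1 : w s `^ (2 / a - 1) * l * y `^ (a - 1) = l `^ (2 / a) * y.
    rewrite /w -/y powRM ?powR_ge0 ?(ltW l0)// -powRrM.
    have -> : l `^ (2 / a - 1) * y `^ (a * (2 / a - 1)) * l * y `^ (a - 1) =
      (l `^ (2 / a - 1) * l) * (y `^ (a * (2 / a - 1)) * y `^ (a - 1)) by ring.
    rewrite -{2}(powRr1 (ltW l0)) -!powRD_gt0// subrK; congr (_ * _).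
    rewrite -[RHS](powRr1 (ltW y1)); congr (_ `^ _); field.
    by rewrite gt_eqF.
  have l1 : l `^ (2 / a) != 0 by rewrite gt_eqF// powR_gt0.
  have a0' : a != 0 by rewrite gt_eqF.
  move: E1 l1; set p := w s `^ _; set r := y `^ _; set t := l `^ _ => E1 l1.
  have -> : - (expR kt / (a * t) / 2) * (- (p * expR (- w s)) * (l * (a * r * (k * s *+ 2)))) =
     expR kt / t * expR (- w s) * (p * l * r) * (k * s).
    by field; rewrite l1 a0'.
  rewrite E1 /y; field; exact: l1.
have cF (s : R) : 0 < s -> {for s, continuous F}.
  by move=> s0; have [? _] := dF s s0; apply: differentiable_continuous; apply/derivable1_diffP.
have cf (s : R) : 0 < s -> {for s, continuous f}.
  move=> s0; apply: differentiable_continuous; apply/derivable1_diffP.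
  by have ? := dw s s0; rewrite /f.
rewrite (@ge0_continuous_FTC2y _ f F s1 0).
- by rewrite -EFinB sub0r /F mulNr opprK mulrAC.
- move=> s s1s; have sp : 0 <= s by apply: ltW; exact: lt_le_trans s1s.
  by rewrite /f mulr_ge0 ?expR_ge0// mulr_ge0 ?sqr_ge0// exprn_ge0.
- apply/continuous_within_itvcyP; split.
    move=> s; rewrite in_itv/= andbT => s1s; apply: cf; exact: lt_trans s1s.
  by apply: cvg_at_right_filter; exact: cf.
- rewrite /F -[X in _ --> X](mulr0 (- (C / 2))); apply: cvgMr.
  apply: (cvg_comp w (upper_gamma (2 / a))); last exact: upper_gamma_cvgy.
  apply/cvgryPge => r.
  pose M := `|r| + 1.
  have M0 : 0 < M by rewrite ltr_wpDl.
  near=> s.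
  have s1' : 1 <= s by near: s; apply: nbhs_pinfty_ge; rewrite ?num_real.
  have s2 : (M / l) `^ a^-1 / k <= s by near: s; apply: nbhs_pinfty_ge; rewrite ?num_real.
  have s0 : 0 < s by exact: lt_le_trans s1'.
  apply: (@le_trans _ _ M); first by rewrite /M (le_trans (ler_norm r))// lerDl.
  rewrite /w mulrC -ler_pdivrMr//.
  have h : (M / l) `^ a^-1 <= k * s ^+ 2.
    rewrite ler_pdivrMr// in s2; rewrite (le_trans s2)// mulrC ler_pM2l//.
    by rewrite expr2 ler_peMl// ltW.
  have := @ge0_ler_powR _ a _ ((M / l) `^ a^-1) (k * s ^+ 2).
  rewrite (ltW a0) !nnegrE powR_ge0 (ltW (y0 s s0)) => /(_ isT isT isT h).
  by rewrite -powRrM mulVf ?gt_eqF// powRr1// divr_ge0 ?ltW.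
- by move=> s s1s; have [] := dF s (lt_trans s10 s1s).
- by apply: cvg_at_right_filter; exact: cF.
- move=> s; rewrite in_itv/= andbT => s1s; rewrite derive1E.
  by have ? := dF s (lt_trans s10 s1s); exact: derive_val.
Unshelve. all: by end_near. Qed.

End antiderivatives.

(** * Characteristic functions in the variable u *)

Section explicit_charfun.
Context {d} {T : measurableType d} {R : realType} (P : probability T R).
Variables (alpha sigma c : R) (W G : nat -> {RV P >-> R}).
Hypotheses (alpha0 : 0 < alpha) (alpha2 : alpha < 2).
Hypothesis sigma0 : 0 < sigma.
Hypothesis c0 : 0 < c.
Hypothesis G_poisson : unit_poisson_arrivals P G.
Hypothesis W_indep : mutually_independent P W.
Hypothesis W_normal : forall j A, measurable A ->
  distribution P (W j) A = normal_prob 0 sigma A.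
Hypothesis WG_indep : independent_families P W G.

Let a := alpha / 2.

(* The variable u of the paper is frequency_scale * s ^+ 2. *)
Definition frequency_scale : R := sigma ^+ 2 / 2 * c `^ (- a^-1).

Let a0 : 0 < a. Proof. by rewrite divr_gt0. Qed.
Let a1 : a < 1. Proof. by rewrite ltr_pdivrMr// mul1r. Qed.

Lemma frequency_scale_gt0 : 0 < frequency_scale.
Proof. by rewrite mulr_gt0 ?powR_gt0// divr_gt0// exprn_gt0. Qed.

Let lam_gt0 s : s != 0 -> 0 < (sigma * s) ^+ 2 / 2.
Proof. by move=> s0; rewrite divr_gt0// exprn_even_gt0// mulf_neq0// gt_eqF. Qed.

Let scale_fun_c s : scale_fun alpha ((sigma * s) ^+ 2 / 2) c = frequency_scale * s ^+ 2.
Proof. by rewrite scale_funE// /frequency_scale -/a; ring. Qed.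

Let dF0 (x : R) : is_derive x (1 : R) (cst 0 : R -> R)
  (1 - expR (- ((sigma * 0) ^+ 2 / 2 * (x `^ (- alpha^-1)) ^+ 2))).
Proof. by rewrite mulr0 expr0n/= !mul0r oppr0 expR0 subrr; exact: is_derive_cst. Qed.

Lemma charfun_head_exponent s th :
  \int[P]_w cos (s * lepage_head alpha c (W : nat -> T -> R) (G : nat -> T -> R) w + th) =
  expR (- (c * head_exponent a (frequency_scale * s ^+ 2))) * cos th.
Proof.
(* At s = 0 the parameter [lam] vanishes, outside the range of [laplace_exponent]; the zero function
   is then the exponent. *)
have [->|s0] := eqVneq s 0.
  rewrite (charfun_head alpha0 sigma0 c0 G_poisson W_indep W_normal WG_indep
    (F := cst 0) (fun x _ => dF0 x) (cvg_cst (0 : R))).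
  by rewrite expr0n/= mulr0 head_exponent0// mulr0.
rewrite (charfun_head alpha0 sigma0 c0 G_poisson W_indep W_normal WG_indep
  (is_derive_laplace_exponent alpha0 alpha2 (lam_gt0 s0))
  (laplace_exponent_cvg0 alpha0 alpha2 (lam_gt0 s0))).
by rewrite laplace_exponentE ?lam_gt0// scale_fun_c.
Qed.

Lemma charfun_series_exponent (X : {RV P >-> R}) s th :
  {ae P, forall w, series (lepage_term alpha (W : nat -> T -> R) (G : nat -> T -> R) w)
    @ \oo --> X w} ->
  \int[P]_w cos (s * X w + th) =
  expR (- (c * head_exponent a (frequency_scale * s ^+ 2) -
    c * gfun a (frequency_scale * s ^+ 2))) * cos th.
Proof.
move=> hX.
have [->|s0] := eqVneq s 0.
  rewrite (charfun_series alpha0 sigma0 G_poisson W_indep W_normal WG_indep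
    (F := cst 0) (fun x _ => dF0 x) (cvg_cst (0 : R)) (cvg_cst (0 : R)) _ hX).
  by rewrite expr0n/= mulr0 head_exponent0// gfun0// !mulr0 subr0.
rewrite (charfun_series alpha0 sigma0 G_poisson W_indep W_normal WG_indep
  (is_derive_laplace_exponent alpha0 alpha2 (lam_gt0 s0))
  (laplace_exponent_cvg0 alpha0 alpha2 (lam_gt0 s0))
  (laplace_exponent_cvgy alpha0 alpha2 (lam_gt0 s0)))//.
by rewrite (laplace_exponent_infE alpha0 alpha2 (lam_gt0 s0) c0) scale_fun_c.
Qed.

Lemma tail_variance_gt0 : 0 < tail_variance sigma alpha c.
Proof.
by rewrite !mulr_gt0 ?powR_gt0 ?exprn_gt0 ?invr_gt0 ?subr_gt0.
Qed.

(** Here alpha/(2 - alpha) = 1/eta and c^((alpha-2)/alpha) = c * c^(-1/a), so the Gaussian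
    replacement contributes exactly e^(-c u/eta). *)
Lemma tail_variance_scale s :
  (Num.sqrt (tail_variance sigma alpha c) * s) ^+ 2 / 2 =
  c * (frequency_scale * s ^+ 2) / Defs.eta a.
Proof.
rewrite exprMn sqr_sqrtr ?(ltW tail_variance_gt0)// /tail_variance /frequency_scale.
have -> : (alpha - 2) / alpha = 1 - a^-1 by rewrite /a; field; rewrite gt_eqF.
rewrite powRD_gt0// powRr1 ?(ltW c0)// /Defs.eta /a.
by field; rewrite ?gt_eqF ?subr_gt0.
Qed.

Lemma charfun_approx_exponent (V : {RV P >-> R}) s th :
  (forall A, measurable A -> distribution P V A =
    normal_prob 0 (Num.sqrt (tail_variance sigma alpha c)) A) ->
  independent2 P (lepage_head alpha c (W : nat -> T -> R) (G : nat -> T -> R)) V ->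
  \int[P]_w cos (s * (lepage_head alpha c (W : nat -> T -> R) (G : nat -> T -> R) w + V w) + th) =
  expR (- (c * head_exponent a (frequency_scale * s ^+ 2))) *
  expR (- (c * (frequency_scale * s ^+ 2) / Defs.eta a)) * cos th.
Proof.
move=> V_normal ZV.
rewrite (charfun_add_normal _ _ _ V_normal ZV (charfun_head_exponent s)).
- by rewrite mulNr tail_variance_scale.
- by rewrite sqrtr_gt0 tail_variance_gt0.
- exact: measurable_lepage_head.
Qed.

End explicit_charfun.

Lemma ge0_integral_itv_cut {R : realType} (f : R -> \bar R) (r s : R) (b : itv_bound R) :
  r <= s -> (BRight s <= b)%O ->
  measurable_fun [set` Interval (BLeft r) b] f ->
  (forall x, [set` Interval (BLeft r) b] x -> (0 <= f x)%E) ->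
  (\int[lebesgue_measure]_(x in [set` Interval (BLeft r) b]) f x =
   \int[lebesgue_measure]_(x in `[r, s]) f x +
   \int[lebesgue_measure]_(x in [set` Interval (BLeft s) b]) f x)%E.
Proof.
move=> rs sb mf f0.
have rE : [set` Interval (BLeft r) b] = `[r, s]%classic `|` [set` Interval (BRight s) b].
  by rewrite -itv_bndbnd_setU.
rewrite -(@integral_itv_obnd_cbnd _ s).
  rewrite {1}rE ge0_integral_setU// -?rE//.
  - apply/disj_setPS => x [/=]; rewrite in_itv/= => /andP[_ xs].
    rewrite itv_boundlr bnd_simp/= => /andP[sx _].
    by move: (lt_le_trans sx xs); rewrite ltxx.
apply: (measurable_funS _ _ mf); first exact: measurable_itv.
by rewrite rE; exact: subsetUr.
Qed.

(** * Integral of the envelope over the subdivision and the tail *)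

Section envelope_integral.
Context {R : realType}.
Notation mu := (@lebesgue_measure R).
Variables (a c k : R) (N : nat) (u : nat -> R).
Hypotheses (a0 : 0 < a) (a1 : a < 1) (c1 : 1 < c) (k0 : 0 < k).
Hypotheses (u_0 : u 0%N = 0) (u_N : u N = 1).
Hypothesis u_lt : forall i, (i < N)%N -> u i < u i.+1.

Let c0 : 0 < c. Proof. exact: lt_trans c1. Qed.

(* With v = k * s ^+ 2, this is v ^+ 2 * envelope v / s. *)
Definition envelope_density (s : R) : R := k ^+ 2 * s ^+ 3 * envelope a c (k * s ^+ 2).

Lemma envelope_density_ge0 s : 0 <= s -> 0 <= envelope_density s.
Proof. by move=> s0; rewrite mulr_ge0 ?expR_ge0// mulr_ge0 ?sqr_ge0// exprn_ge0. Qed.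

Lemma measurable_envelope_density :
  measurable_fun (`[0, +oo[%classic : set R) envelope_density.
Proof.
apply/measurable_fun_itv_obnd_cbndP; apply: open_continuous_measurable_fun.
  exact: interval_open.
move=> s; rewrite inE/= in_itv/= andbT => s0.
have ks0 : 0 < k * s ^+ 2 by rewrite mulr_gt0// exprn_gt0.
apply: cvgM.
  by apply: cvgMr; exact: exprn_continuous.
apply: (@continuous_comp _ _ _ (fun s : R => k * s ^+ 2) (envelope a c)).
  by apply: cvgMr; exact: exprn_continuous.
exact: continuous_envelope.
Qed.

Let sq (x : R) := Num.sqrt (x / k).

Let sqK x : 0 <= x -> k * sq x ^+ 2 = x.
Proof.
by move=> x0; rewrite sqr_sqrtr ?divr_ge0 ?(ltW k0)// mulrCA mulfV ?mulr1// gt_eqF.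
Qed.

Let u_ge0 i : (i <= N)%N -> 0 <= u i.
Proof.
elim: i => [_|i IH iN]; first by rewrite u_0.
by rewrite (le_trans (IH (ltnW iN)))// ltW// u_lt.
Qed.

Let u_le1 i : (i <= N)%N -> u i <= 1.
Proof.
rewrite -u_N => iN; rewrite -(subKn iN).
(* Backward induction from u N = 1; once j reaches N the truncated subtraction stays at 0. *)
elim: (N - i)%N => [|j IH]; first by rewrite subn0.
apply: le_trans IH.
have [jN|jN] := ltnP j N; last by move: (jN); rewrite -subn_eq0 => /eqP E; rewrite subnS E.
rewrite subnS -[leRHS](congr1 u (prednK _)) ?subn_gt0//.
by rewrite ltW// u_lt// prednK ?subn_gt0// leq_subr.
Qed.

(** The value prescribed at i = 0 fits the general formula because u 0 = 0 and the head exponent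
    vanishes there. *)
Let fptE i : fpt c a u i = - (c * head_exponent a (u i)).
Proof.
rewrite /fpt; case: eqP => [->|_]; first by rewrite u_0 head_exponent0// mulr0 oppr0.
by rewrite /omega_head expRK.
Qed.

(** This keeps the denominators in [B5] away from zero: the chord slope of - c * head_exponent is
    nonpositive and (c - 1) * gbar is negative. *)
Let mtpt_lt0 i : (i < N)%N -> mtpt c a u i < 0.
Proof.
move=> iN; rewrite /mtpt ltr_wnDl//; last first.
  by rewrite pmulr_rlt0 ?gbar_lt0// subr_gt0.
have ui := u_lt iN.
rewrite /mpt !fptE mulr_le0_ge0 ?invr_ge0 ?subr_ge0 ?(ltW ui)//.
rewrite opprK addrC subr_le0 ler_pM2l// le_head_exponent// ?(ltW ui)//.
exact: u_ge0 (ltnW iN).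
Qed.

Let term i := expR (qpt c a u i) / mtpt c a u i *
  (expR (mtpt c a u i * u i.+1) * (u i.+1 - (mtpt c a u i)^-1)
   - expR (mtpt c a u i * u i) * (u i - (mtpt c a u i)^-1)).

Let mdens (b : itv_bound R) (r : R) : 0 <= r ->
  measurable_fun [set` Interval (BLeft r) b] (EFin \o envelope_density).
Proof.
move=> r0; apply/measurable_EFinP; apply: measurable_funS measurable_envelope_density => //.
by apply: subset_itv; rewrite ?bnd_simp//; case: b => [[] ?|[]].
Qed.

Let dens_ge0 (b : itv_bound R) (r x : R) : 0 <= r -> [set` Interval (BLeft r) b] x ->
  (0 <= (EFin \o envelope_density) x)%E.
Proof.
move=> r0 /=; rewrite itv_boundlr bnd_simp => /andP[rx _].
by rewrite lee_fin envelope_density_ge0// (le_trans r0).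
Qed.

Let integral_cell i : (i < N)%N ->
  (\int[mu]_(s in `[sq (u i), sq (u i.+1)]) (envelope_density s)%:E <= (term i / 2)%:E)%E.
Proof.
move=> iN; have ui := u_lt iN.
have ui0 : 0 <= u i := u_ge0 (ltnW iN).
have ui10 : 0 <= u i.+1 := u_ge0 iN.
have sqi : sq (u i) < sq (u i.+1).
  by rewrite ltr_sqrt ?ltr_pM2r ?invr_gt0// divr_gt0// (le_lt_trans ui0).
have mt0 : mtpt c a u i != 0 by rewrite lt_eqF// mtpt_lt0.
have := integral_piece k (qpt c a u i) mt0 sqi.
rewrite /= !sqK// -mulrBr -/(term i) => <-.
apply: ge0_le_integral => //=.
- by move=> x; exact: (dens_ge0 (sqrtr_ge0 _)).
- apply: mdens; exact: sqrtr_ge0.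
- apply/measurable_EFinP; apply: measurable_funTS; apply: continuous_measurable_fun => s.
  by apply: differentiable_continuous; apply/derivable1_diffP.
- move=> s; rewrite in_itv/= => /andP[s1 s2].
  have s0 : 0 <= s by exact: le_trans (sqrtr_ge0 _) s1.
  rewrite lee_fin ler_wpM2l//; first by rewrite mulr_ge0 ?sqr_ge0// exprn_ge0.
  rewrite /qpt fptE.
  apply: (envelope_piece a0 a1 c1 (y := u i.+1)) => //; last by rewrite /mpt !fptE.
    exact: u_le1.
  apply/andP; split.
    by rewrite -(sqK ui0) ler_pM2l// lerXn2r ?nnegrE ?sqrtr_ge0.
  by rewrite -[leRHS](sqK ui10) ler_pM2l// lerXn2r ?nnegrE ?sqrtr_ge0.
Qed.

Let integral_cells n : (n <= N)%N ->
  (\int[mu]_(s in `[0%R, sq (u n)]) (envelope_density s)%:E <=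
   ((\sum_(i < n) term i) / 2)%:E)%E.
Proof.
elim: n => [_|n IH nN].
  by rewrite u_0 /sq mul0r sqrtr0 set_itv1 integral_set1 big_ord0 mul0r.
have sn : sq (u n) <= sq (u n.+1).
  by rewrite ler_wsqrtr// ler_pM2r ?invr_gt0// ltW// u_lt.
rewrite (@ge0_integral_itv_cut _ _ 0 (sq (u n))) ?sqrtr_ge0 ?bnd_simp//; last 2 first.
- exact: mdens.
- by move=> x; exact: dens_ge0.
by rewrite big_ord_recr/= mulrDl EFinD leeD// ?IH ?integral_cell// ltnW.
Qed.

Let bracket := \sum_(i < N) term i + expR (kttail c a) / (a * lttail c a `^ (2 / a)) *
  upper_gamma (2 / a) (lttail c a).

Lemma integral_envelope_density :
  (\int[mu]_(s in `[0%R, +oo[) (envelope_density s)%:E <= (bracket / 2)%:E)%E.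
Proof.
have l0 : 0 < lttail c a by rewrite mulr_gt0 ?gammabar_gt0// subr_gt0.
have sN0 : 0 < sq 1 by rewrite sqrtr_gt0 divr_gt0.
rewrite (@ge0_integral_itv_cut _ _ 0 (sq 1)) ?sqrtr_ge0//; last 2 first.
- exact: mdens.
- by move=> x; exact: dens_ge0.
rewrite /bracket mulrDl EFinD leeD//; first by have := integral_cells (leqnn N); rewrite u_N.
have := integral_tail (kttail c a) a0 k0 l0 sN0.
rewrite sqK// powR1 mulr1 => <-.
apply: ge0_le_integral => //=.
- by move=> x; exact: (dens_ge0 (sqrtr_ge0 _)).
- apply: mdens; exact: sqrtr_ge0.
- apply/measurable_EFinP; apply: measurable_funTS.
  apply: measurable_funM; first by apply: measurable_funM => //; exact: measurable_funX.
  apply: measurableT_comp => //; apply: measurable_funB => //; apply: measurable_funM => //.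
  apply: (measurableT_comp (measurable_powR a)); exact: measurable_funM.
- move=> s; rewrite in_itv/= andbT => s1.
  have s0 : 0 <= s by exact: le_trans (ltW sN0) s1.
  rewrite lee_fin ler_wpM2l//; first by rewrite mulr_ge0 ?sqr_ge0// exprn_ge0.
  apply: envelope_tail => //.
  by rewrite -(sqK ler01) ler_pM2l// lerXn2r ?nnegrE ?sqrtr_ge0.
Qed.

(** The sign is not visible termwise; it follows from the bracket majorizing a nonnegative integral,
    and it allows the constant in front to be enlarged to [Kconst]. *)
Lemma bracket_ge0 : 0 <= bracket.
Proof.
have : (0 <= (bracket / 2)%:E)%E.
  apply: le_trans integral_envelope_density; apply: integral_ge0 => x; exact: dens_ge0.
by rewrite lee_fin pmulr_lge0.
Qed.

Lemma le_envelope_bound :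
  ((2 / pi)%:E * \int[mu]_(s in `[0%R, +oo[)
     (c * (a / (2 * (2 - a))) * envelope_density s)%:E <= (c * Kconst a * bracket)%:E)%E.
Proof.
have sa : 0 < 2 - a by rewrite subr_gt0 (lt_trans a1)// ltr1n.
have K0 : 0 <= c * (a / (2 * (2 - a))).
  by rewrite mulr_ge0 ?(ltW c0)// divr_ge0 ?(ltW a0)// mulr_ge0// ltW.
under eq_integral do rewrite EFinM.
rewrite ge0_integralZl_EFin//; last 2 first.
- by move=> x; exact: dens_ge0.
- exact: mdens.
rewrite muleA -EFinM.
apply: (@le_trans _ _ ((2 / pi * (c * (a / (2 * (2 - a)))))%:E * (bracket / 2)%:E)%E).
  apply: lee_wpmul2l; last exact: integral_envelope_density.
  by rewrite lee_fin mulr_ge0// divr_ge0// pi_ge0.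
rewrite -EFinM lee_fin.
have -> : 2 / pi * (c * (a / (2 * (2 - a)))) * (bracket / 2) =
  c * (pi^-1 * (a / (2 * (2 - a)))) * bracket.
  have : (pi : R) != 0 by rewrite gt_eqF ?pi_gt0.
  by move: (pi : R) => p p0; field; rewrite p0 gt_eqF.
rewrite ler_wpM2r ?bracket_ge0// ler_pM2l// /Kconst ler_wpM2l ?invr_ge0 ?pi_ge0//.
by rewrite lerDl invr_ge0 sqr_ge0.
Qed.

End envelope_integral.

(** * Assembly of the bound *)

Theorem theorem5 (R : realType) (d : measure_display) (T : measurableType d)
    (P : probability T R)
    (alpha sigmaW c : R)
    (alpha_gt0 : 0 < alpha) (alpha_lt2 : alpha < 2) (alpha_neq1 : alpha != 1)
    (sigmaW_gt0 : 0 < sigmaW) (c_gt1 : 1 < c)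
    (G W : nat -> {RV P >-> R})
    (G_poisson : unit_poisson_arrivals P G)
    (W_indep : mutually_independent P W)
    (W_normal : forall j A, measurable A ->
      distribution P (W j) A = normal_prob 0 sigmaW A)
    (WG_indep : independent_families P W G)
    (X : {RV P >-> R})
    (X_series : {ae P, forall w,
      series (lepage_term alpha W G w) @ \oo --> X w})
    (Rhat : {RV P >-> R})
    (Rhat_normal : forall A, measurable A ->
      distribution P Rhat A =
      normal_prob 0 (Num.sqrt (tail_variance sigmaW alpha c)) A)
    (Rhat_indep : independent2 P (lepage_head alpha c W G) Rhat)
    (N : nat) (N_ge1 : (1 <= N)%N)
    (u : nat -> R) (u_0 : u 0%N = 0) (u_N : u N = 1)
    (u_lt : forall i, (i < N)%N -> u i < u i.+1) :
  (kolmogorov_distance P X (fun w => lepage_head alpha c W G w + Rhat w)%R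
   <= (B5 c alpha N u)%:E)%E.
Proof.
pose a := alpha / 2; pose k := frequency_scale alpha sigmaW c.
have a0 : 0 < a by rewrite divr_gt0.
have a1 : a < 1 by rewrite ltr_pdivrMr// mul1r.
have c0 : 0 < c by exact: lt_trans c_gt1.
have k0 : 0 < k by exact: frequency_scale_gt0.
pose C := c * (a / (2 * (2 - a))).
have C0 : 0 <= C.
  have sa : 0 < 2 - a by rewrite subr_gt0 (lt_trans a1)// ltr1n.
  by rewrite mulr_ge0 ?(ltW c0)// divr_ge0 ?(ltW a0)// mulr_ge0// ltW.
apply: ge_ereal_sup => _ [x _ <-].
(* [B] is the bound C u^2 envelope(u) on the difference of characteristic functions, divided by s,
   with u = k s^2. *)
apply: (smoothing_inequality (B := fun s => C * envelope_density a c k s)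
  _ _
  (fun s th => charfun_series_exponent alpha_gt0 alpha_lt2 sigmaW_gt0 c0
    G_poisson W_indep W_normal WG_indep s th X_series)
  (fun s th => charfun_approx_exponent alpha_gt0 alpha_lt2 sigmaW_gt0 c0
    G_poisson W_indep W_normal WG_indep s th Rhat_normal Rhat_indep)).
- exact: measurable_funPT.
- by apply: measurable_funD; [exact: measurable_lepage_head|exact: measurable_funPT].
- by apply: measurable_funM => //; exact: measurable_envelope_density.
- by move=> s s0; rewrite mulr_ge0// envelope_density_ge0.
- move=> s s0; rewrite (le_trans (tail_gauss_le a0 a1 c_gt1 _))//.
    by rewrite mulr_ge0 ?sqr_ge0// ltW.
  rewrite /envelope_density -/a -/k -/C le_eqVlt; apply/orP; left; apply/eqP; ring.
- exact: le_envelope_bound.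
Qed.
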